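(* There exists a separable reflexive Banach space $X_u$ such that every infinite dimensional separable reflexive real Banach space $X$ with $S_z(X)=S_z(X^* )=\omega$ is isomorphic to a closed subspace of $X_u$ (that is, $X_u$ is universal for the class $\{X: X\text{ is reflexive and }S_z(X)=S_z(X^* )=\omega\}$). In particular, $X_u$ contains an isomorph of every separable superreflexive Banach space.
   Context: All Banach spaces are real and separable. Szlenk index: for $\varepsilon>0$ let $K_0(X,\varepsilon)=B_{X^*}$ (dual unit ball); let $K_{\alpha+1}(X,\varepsilon)$ be the set of $x^*\in K_\alpha(X,\varepsilon)$ for which there is a sequence $(x_n^* )\subseteq K_\alpha(X,\varepsilon)$ with $w^*$-$\lim x_n^*=x^*$ and $\liminf\|x_n^*-x^*\|\ge\varepsilon$; for limit ordinals $\alpha$, $K_\alpha(X,\varepsilon)=\bigcap_{\beta<\alpha}K_\beta(X,\varepsilon)$. $S_z(X,\varepsilon)$ is the smallest $\alpha<\omega_1$ with $K_\alpha(X,\varepsilon)=\emptyset$, or $\omega_1$ if there is none, and $S_z(X)=\sup_{0<\varepsilon<1}S_z(X,\varepsilon)$. *)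

(* Defs.v *)
From HB Require Import structures.
From mathcomp Require Import all_boot all_order all_algebra.
From mathcomp Require Import boolp classical_sets functions cardinality wochoice.
From mathcomp Require Import reals ereal topology normedtype sequences.
Set Implicit Arguments.
Unset Strict Implicit.
Unset Printing Implicit Defensive.
Import Order.TTheory GRing.Theory Num.Theory.
Import numFieldNormedType.Exports.
Local Open Scope classical_set_scope.
Local Open Scope ring_scope.

Section Dual.
Context {R : realType} (X : normedModType R).

Definition is_functional : {pred X -> R^o} :=
  fun f => `[< linear f /\ continuous f >].

Record dual := Dual { functional :> X -> R^o; _ : is_functional functional }.

HB.instance Definition _ := [isSub for functional].
HB.instance Definition _ := [Choice of dual by <:].

Lemma is_functional_submod : submod_closed is_functional.
Proof.
split.
  by apply/asboolP; split=> [k u v|]; [rewrite scaler0 addr0|exact: cst_continuous].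
move=> a f g /asboolP[lf cf] /asboolP[lg cg]; apply/asboolP; split=> [k u v|x].
  rewrite -[LHS]/(a *: f (k *: u + v) + g (k *: u + v)) lf lg.
  rewrite -[RHS]/(k *: (a *: f u + g u) + (a *: f v + g v)).
  by rewrite !scalerDr !scalerA (mulrC k) addrACA.
have afx : a *: f z @[z --> x] --> a *: f x by apply: cvgZl_tmp; exact: cf.
exact: (cvgD afx (cg x)).
Qed.

HB.instance Definition _ :=
  GRing.isSubmodClosed.Build R (X -> R^o) is_functional is_functional_submod.
HB.instance Definition _ := [SubChoice_isSubLmodule of dual by <:].

Lemma dual_linear (f : dual) : linear f.
Proof. by case: f => f /= /asboolP[]. Qed.

Lemma dual_continuous (f : dual) : continuous f.
Proof. by case: f => f /= /asboolP[]. Qed.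

HB.instance Definition _ (f : dual) :=
  GRing.isLinear.Build R X R^o *:%R f (@dual_linear f).

Definition dual_norm (f : dual) : R := sup [set `|f x| | x in [set x : X | `|x| <= 1]].

Lemma dual_boundedP (f : dual) : exists2 M, 0 < M & forall x, `|f x| <= M * `|x|.
Proof.
have /linear_bounded_continuous/linear_boundedP/pinfty_ex_gt0[M M0 fM] :=
  @dual_continuous f.
by exists M.
Qed.

Lemma dual_norm_has_sup (f : dual) :
  has_sup [set `|f x| | x in [set x : X | `|x| <= 1]].
Proof.
split; first by exists `|f 0|, 0 => //=; rewrite normr0.
have [M M0 fM] := dual_boundedP f.
exists M => _ [x /= x1 <-]; rewrite (le_trans (fM x))// ler_piMr// ltW//.
Qed.

Lemma dual_norm_ub (f : dual) x : `|f x| <= dual_norm f * `|x|.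
Proof.
have [->|x0] := eqVneq x 0; first by rewrite linear0 !normr0 mulr0.
rewrite -ler_pdivrMr ?normr_gt0// -[X in _ / X]ger0_norm// -normf_div.
apply: (sup_upper_bound (dual_norm_has_sup f)); exists (`|x|^-1 *: x) => /=.
  by rewrite normrZ normfV normr_id mulVf ?normr_eq0.
by rewrite linearZ/= [in RHS]mulrC.
Qed.

Lemma dual_norm_ge0 (f : dual) : 0 <= dual_norm f.
Proof.
apply: (le_trans (normr_ge0 (f 0))).
by apply: (sup_upper_bound (dual_norm_has_sup f)); exists 0; rewrite //= normr0.
Qed.

Lemma dual_norm_le (f : dual) (M : R) :
  (forall x, `|x| <= 1 -> `|f x| <= M) -> dual_norm f <= M.
Proof.
move=> fM; apply: ge_sup; first exact: (dual_norm_has_sup f).1.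
by move=> _ [x /= /fM fxM <-].
Qed.

Lemma dualDE (f g : dual) x : (f + g) x = f x + g x. Proof. by []. Qed.
Lemma dualNE (f : dual) x : (- f) x = - f x. Proof. by []. Qed.
Lemma dualZE a (f : dual) x : (a *: f) x = a *: f x. Proof. by []. Qed.

Lemma dual_normD f g : dual_norm (f + g) <= dual_norm f + dual_norm g.
Proof.
apply: dual_norm_le => x x1; rewrite dualDE (le_trans (ler_normD _ _))// lerD//.
  by apply: (sup_upper_bound (dual_norm_has_sup f)); exists x.
by apply: (sup_upper_bound (dual_norm_has_sup g)); exists x.
Qed.

Lemma dual_norm0_eq0 f : dual_norm f = 0 -> f = 0.
Proof.
move=> f0; apply/val_inj/funext => x /=; apply/eqP.
by rewrite -normr_le0 (le_trans (dual_norm_ub f x))// f0 mul0r.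
Qed.

Lemma dual_normZ a f : dual_norm (a *: f) = `|a| * dual_norm f.
Proof.
have le b g : dual_norm (b *: g) <= `|b| * dual_norm g.
  apply: dual_norm_le => x x1; rewrite dualZE normrZ ler_wpM2l//.
  by apply: (sup_upper_bound (dual_norm_has_sup g)); exists x.
apply/eqP; rewrite eq_le le /=.
have [->|a0] := eqVneq a 0.
  by rewrite normr0 mul0r dual_norm_ge0.
rewrite -ler_pdivlMl ?normr_gt0// -normfV.
by rewrite -{1}[f](scalerK a0) le.
Qed.

HB.instance Definition _ :=
  Lmodule_isNormed.Build R dual dual_normD dual_normZ dual_norm0_eq0.

Lemma dual_normE (f : dual) : `|f| = dual_norm f. Proof. by []. Qed.

Lemma dual_complete (F : set_system dual) :
  ProperFilter F -> cauchy F -> cvg F.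
Proof.
move=> FF /cauchy_ballP Fc.
have ballE e (f g : dual) : ball f e g -> forall x, `|f x - g x| <= e * `|x|.
  rewrite -ball_normE/= => fg x; apply: (le_trans (dual_norm_ub (f - g) x)).
  by rewrite ler_wpM2r// ltW.
have cvgx x : cvg ((fun f : dual => f x) @ F).
  apply/cauchy_cvgP/cauchy_ballP => _/posnumP[e].
  have x1 : 0 < `|x| + 1 by rewrite ltr_wpDl.
  have e0 : 0 < e%:num / (`|x| + 1) by rewrite divr_gt0.
  have [[A B] [/= FA FB] AB] := Fc _ e0.
  exists ((fun f : dual => f x) @` A, (fun f : dual => f x) @` B) => /=.
    by split; [apply: filterS FA|apply: filterS FB] => f ?; exists f.
  move=> [_ _] /= [[f Af <-] [g Bg <-]].
  rewrite /ball/=; have /ballE/(_ x)/le_lt_trans := AB (f, g) (conj Af Bg); apply.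
  by rewrite mulrAC ltr_pdivrMr// ltr_pM2l// ltrDl.
pose l : X -> R^o := fun x => lim ((fun f : dual => f x) @ F).
have lx x : (fun f : dual => f x) @ F --> l x by exact: cvgx.
have near_l e : 0 < e -> F [set f : dual | forall x, `|l x - f x| <= e * `|x|].
  move=> e0; have [[A B] [/= FA FB] AB] := Fc _ e0.
  apply: filterS FA => f Af x.
  have lfx : (fun g : dual => `|g x - f x|) @ F --> `|l x - f x|.
    by apply: cvg_norm; apply: cvgB; [exact: lx|exact: cvg_cst].
  apply: (cvgr_to_le lfx).
  apply: filterS FB => g Bg /=; rewrite distrC.
  exact: (ballE _ _ _ (AB (f, g) (conj Af Bg))).
have llin : linear l.
  move=> a u v; have : (fun f : dual => f (a *: u + v)) @ F --> a *: l u + l v.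
    under eq_fun do rewrite linearP.
    by apply: cvgD; [apply: cvgZl_tmp; exact: lx|exact: lx].
  by move=> /cvg_lim <-.
pose lL : {linear X -> R^o} := HB.pack l (GRing.isLinear.Build R X R^o *:%R l llin).
have lcont : continuous l.
  apply: (@bounded_linear_continuous _ _ _ lL); apply/linear_boundedP.
  have [f lf] := filter_ex (near_l 1 ltr01).
  near=> r => x; apply: (@le_trans _ _ ((1 + `|f|) * `|x|)).
    rewrite -[lL x]/(l x) -[l x](subrK (f x)) (le_trans (ler_normD _ _))// mulrDl lerD//.
    exact: dual_norm_ub.
  by rewrite ler_wpM2r//; near: r; apply: nbhs_pinfty_ge; exact: num_real.
apply/cvg_ex; exists (Dual (asboolT (conj llin lcont))).
apply/cvgrPdist_le => e e0; apply: filterS (near_l _ e0) => f lf.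
by apply: dual_norm_le => x x1; apply: (le_trans (lf x)); rewrite ler_piMr// ltW.
Unshelve. all: by end_near. Qed.

HB.instance Definition _ := Uniform_isComplete.Build dual dual_complete.
End Dual.

(* The ordinals needed here are those up to omega_1. They are modelled by a
   well-ordered set long enough to reach omega_1: a well-ordering (Zermelo) of
   the uncountable set [set nat], extended by a top element [None].  [omega1] is
   then the least element having uncountably many predecessors. *)
Definition set_nat_le : rel (set nat) :=
  sval (well_ordering_principle (set nat)).

Lemma set_nat_le_wo : well_order set_nat_le.
Proof. exact: svalP (well_ordering_principle (set nat)). Qed.

Definition ord := option (set nat).
HB.instance Definition _ := Choice.on ord.

Definition ord_le (a b : ord) : bool :=
  match a, b with
  | _, None => true
  | None, Some _ => false
  | Some x, Some y => set_nat_le x y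
  end.

Lemma ord_le_wf (P : set ord) : P !=set0 ->
  exists a, P a /\ forall b, P b -> ord_le a b.
Proof.
move=> [a Pa].
have [[x Px]|noS] := pselect (exists x, P (Some x)); last first.
  case: a Pa => [x Px|PN]; first by case: noS; exists x.
  by exists None; split => // -[y Py|//]; case: noS; exists y.
have [|z [[/asboolP/= Pz zmin] _]] :=
  @set_nat_le_wo (fun x => `[< P (Some x) >]); first by exists x; apply/asboolP.
by exists (Some z); split => // -[y Py|//]; apply: zmin; apply/asboolP.
Qed.

Lemma ord_le_total : total ord_le.
Proof.
move=> a b; have [|c [[->|->] cP]] := @ord_le_wf [set a; b].
- by exists a; left.
- by rewrite cP//; right.
- by rewrite orbC cP//; left.
Qed.

Lemma set_nat_le_anti : antisymmetric set_nat_le.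
Proof.
move=> x y xy; have : wo_chain set_nat_le predT by move=> A _; exact: set_nat_le_wo.
by move=> /wo_chain_antisymmetric/(_ x y isT isT xy).
Qed.

Lemma ord_le_anti : antisymmetric ord_le.
Proof. by move=> [x|] [y|] //= /set_nat_le_anti ->. Qed.

Lemma ord_le_trans : transitive ord_le.
Proof.
move=> b a c ab bc; have [|m [mabc mP]] := @ord_le_wf [set d | [\/ d = a, d = b | d = c]].
  by exists a; apply: Or31.
have ma : ord_le m a by apply: mP; apply: Or31.
case: mabc => mE; subst m.
- by apply: mP; apply: Or33.
- by rewrite (@ord_le_anti a b) // ab ma.
- by rewrite -(@ord_le_anti b c) // bc mP//; apply: Or32.
Qed.


Lemma ord_le_refl : reflexive ord_le.
Proof. by move=> a; rewrite -[ord_le a a]orbb; exact: ord_le_total. Qed.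

Fact ord_display : Order.disp_t. Proof. exact: Order.Disp tt tt. Qed.

HB.instance Definition _ :=
  Order.Le_isPOrder.Build ord_display ord ord_le_refl ord_le_anti ord_le_trans.
HB.instance Definition _ := Order.POrder_isTotal.Build ord_display ord ord_le_total.

Section Ordinals.
Local Open Scope order_scope.
Implicit Types (a b c : ord) (P : set ord).

(* Junk value [None] if [P] is empty. *)
Definition ord_least P : ord := xget None [set a | P a /\ forall b, P b -> a <= b].

Lemma ord_leastP P : P !=set0 ->
  P (ord_least P) /\ forall b, P b -> ord_least P <= b.
Proof. by move=> /ord_le_wf[a aP]; apply: (@xgetI _ _ [set a | P a /\ _] a). Qed.

Definition ord_sup P : ord := ord_least [set a | forall b, P b -> b <= a].

Definition omega : ord := ord_least [set a | infinite_set [set b | b < a]].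

Definition omega1 : ord := ord_least [set a | ~ countable [set b | b < a]].

Definition ord_zero a := forall b, a <= b.

Definition ord_succ b a := b < a /\ forall c, b < c -> a <= c.

Definition ord_limit a := ~ ord_zero a /\ ~ exists b, ord_succ b a.

Lemma omega1_uncountable : ~ countable [set b | b < omega1].
Proof.
apply: (@ord_leastP [set a | ~ countable [set b | b < a]] _).1.
exists None => /= /countable_injP[f finj].
pose D : set nat := [set n | exists2 x : set nat, n = f (Some x) & ~ x n].
have DN : ~ D (f (Some D)).
  move=> /[dup] DD [x Dx]; suff -> : x = D by [].
  by have /Some_inj := finj (Some D) (Some x) (mem_set isT) (mem_set isT) Dx.
by apply: (DN); exists D.
Qed.

Lemma omega1_least a : a < omega1 -> countable [set b | b < a].
Proof.
move=> a1; apply: contrapT => /= ca.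
have [|_ /(_ a ca)] := @ord_leastP [set a | ~ countable [set b | b < a]].
  by exists a.
by rewrite leNgt a1.
Qed.

Lemma omega_infinite : infinite_set [set b | b < omega].
Proof.
apply: (@ord_leastP [set a | infinite_set [set b | b < a]] _).1.
by exists omega1 => /= /finite_set_countable /omega1_uncountable.
Qed.

Lemma omega_least a : a < omega -> finite_set [set b | b < a].
Proof.
move=> ao; apply: contrapT => /= fa.
have [|_ /(_ a fa)] := @ord_leastP [set a | infinite_set [set b | b < a]].
  by exists a.
by rewrite leNgt ao.
Qed.

Lemma ord_succ_inj a b c : ord_succ b a -> ord_succ c a -> b = c.
Proof.
move=> [ba bP] [ca cP]; apply/eqP; rewrite eq_le !leNgt.
apply/andP; split; apply/negP; first by move=> /cP; rewrite leNgt ba.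
by move=> /bP; rewrite leNgt ca.
Qed.

Lemma ord_succ_nzero a b : ord_succ b a -> ~ ord_zero a.
Proof. by move=> [ba _] /(_ b); rewrite leNgt ba. Qed.

End Ordinals.

Section Szlenk.
Context {R : realType}.
Implicit Types X Y Z : completeNormedModType R.

Definition weak_star_cvg X (u : nat -> dual X) (f : dual X) :=
  forall x : X, (fun n => u n x) @ \oo --> f x.

(* [szlenk_derived X eps a f] : f belongs to K_a(X, eps).  The three clauses are
   those of the transfinite recursion on a; they are disjoint, and every ordinal
   falls under exactly one of them. *)
Inductive szlenk_derived X (eps : R) : ord -> set (dual X) :=
| szlenk_derived_zero a f : ord_zero a -> `|f| <= 1 -> szlenk_derived eps a f
| szlenk_derived_succ b a f (u : nat -> dual X) : ord_succ b a ->
    szlenk_derived eps b f ->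
    (forall n, szlenk_derived eps b (u n)) ->
    weak_star_cvg u f ->
    (eps%:E <= limn_einf (fun n => `|u n - f|%:E))%E ->
    szlenk_derived eps a f
| szlenk_derived_limit a f : ord_limit a ->
    (forall b, (b < a)%O -> szlenk_derived eps b f) -> szlenk_derived eps a f.

Lemma szlenk_derived_zeroE X (eps : R) a : ord_zero a ->
  szlenk_derived eps a = [set f : dual X | `|f| <= 1].
Proof.
move=> a0; apply/seteqP; split=> f; last exact: szlenk_derived_zero.
move=> H; case: H a0 => {a f} //.
- by move=> b a f u /ord_succ_nzero.
- by move=> a f [na _] _ /na.
Qed.

Lemma szlenk_derived_succE X (eps : R) b a : ord_succ b a ->
  szlenk_derived eps a = [set f : dual X | szlenk_derived eps b f /\
    exists u : nat -> dual X, [/\ forall n, szlenk_derived eps b (u n),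
      weak_star_cvg u f & (eps%:E <= limn_einf (fun n => `|u n - f|%:E))%E]].
Proof.
move=> ba; apply/seteqP; split=> f; last first.
  by move=> [bf [u [bu uf le]]]; exact: szlenk_derived_succ ba bf bu uf le.
move=> H; case: H b ba => {a f}.
- by move=> a f a0 _ b /ord_succ_nzero.
- move=> b a f u ba bf bu uf le c /(ord_succ_inj ba) <-; split=> //.
  by exists u.
- by move=> a f [_ na] _ b ba; case: na; exists b.
Qed.

Lemma szlenk_derived_limitE X (eps : R) a : ord_limit a ->
  szlenk_derived eps a =
  \bigcap_(b in [set b | (b < a)%O]) szlenk_derived (X:=X) eps b.
Proof.
move=> al; apply/seteqP; split=> f; last exact: szlenk_derived_limit.
move=> H; case: H al => {a f} //.
- by move=> a f a0 _ [na _]; case: na.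
- by move=> b a f u ba _ _ _ _ [_ na]; case: na; exists b.
Qed.

Definition szlenk_eps X (eps : R) : ord :=
  ord_least ([set a | (a < omega1)%O /\ szlenk_derived (X:=X) eps a = set0]
             `|` [set omega1]).

Definition szlenk X : ord :=
  ord_sup [set szlenk_eps X eps | eps in [set eps : R | 0 < eps < 1]].

Definition separable X := exists2 A : set X, countable A & dense A.

Definition span X n (e : 'I_n -> X) : set X :=
  [set x | exists c : 'I_n -> R, x = \sum_i c i *: e i].

Definition infinite_dimensional X :=
  ~ exists n (e : 'I_n -> X), span e = setT.

(* The canonical embedding of X into its bidual is onto. *)
Definition reflexive_space X :=
  forall phi : dual (dual X), exists x : X, forall f : dual X, phi f = f x.

(* (1 + eps)-isomorphic copies of all finite-dimensional subspaces [span e] of Y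
   are found in X.  Only the values of T on [span e] matter. *)
Definition finitely_representable Y X :=
  forall n (e : 'I_n -> Y) (eps : R), 0 < eps ->
  exists T : Y -> X,
    (forall (a : R) y z, span e y -> span e z -> T (a *: y + z) = a *: T y + T z) /\
    (forall y, span e y -> (1 - eps) * `|y| <= `|T y| <= (1 + eps) * `|y|).

Definition superreflexive X :=
  forall Y, finitely_representable Y X -> reflexive_space Y.

(* T is a linear homeomorphism of X onto the closed subspace [range T] of Z, and
   S is its inverse there. *)
Definition embeds_as_closed_subspace X Z :=
  exists (T : {linear X -> Z}) (S : Z -> X),
    [/\ continuous T, closed (range T), cancel T S & {within range T, continuous S}].

End Szlenk.

(* Main.v *)
(* Write Y = X^*.  Finite w*-derivations of the two balls, whose indices are
   submultiplicative, give for successive blocks of a suitably blocked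
   Markushevich basis of (Y, X) both an upper estimate (p blocks of norm at most 1
   have a sum of norm at most p/8 for some p) and a lower p-estimate for suitable
   decompositions of the elements of the unit ball of Y; no finite-dimensional
   decomposition of X or Y is needed.

   The universal space is the dual of a space E of finitely supported arrays
   indexed by the nodes of a countable tree.  A branch of the tree codes rounded
   values x(y_k), |x| <= 1, of the elements of the unit ball of some space X on a
   basis of Y.  The norm of E is the l_2-sum over p of the p-variation, over all
   cuts of the set of nodes, of the supremum of those functionals along branches
   that satisfy the condition "p blocks bounded by 1 have a sum bounded by p/2".
   That condition and the lower estimate built into the norm make functionals on E
   and on E^* small on tails, so E^* is separable and reflexive.  The map
   x |-> (w |-> sum_k w_k y_k(x)) along the branch of X is bounded by the upper
   estimate for X, and bounded below because, by the lower estimate, norming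
   elements of Y lift to E.

   If X is superreflexive and the derivations of the ball of X^* or of X^** do not
   terminate, then they provide finite arrays with f_k(x_i) small for k < i and
   bounded below for i <= k; an ultralimit of these is a nonreflexive space
   finitely representable in X. *)
From HB Require Import structures.
Require Import Defs.
From mathcomp Require Import all_boot all_order all_algebra.
From mathcomp Require Import boolp classical_sets functions cardinality.
From mathcomp Require Import reals ereal topology normedtype sequences.
From mathcomp Require Import ring lra zify.
Set Implicit Arguments.
Unset Strict Implicit.
Unset Printing Implicit Defensive.
Import Order.TTheory GRing.Theory Num.Theory.
Import numFieldNormedType.Exports.
Opaque dual_norm.
Local Open Scope classical_set_scope.
Local Open Scope ring_scope.

(** * Ultralimits and the Hahn-Banach theorem *)

(** The space has to be built before any X is known, while the class contains uncountably many
    spaces. Rounding resolves this: only finitely many coefficient histories occur at a node, so a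
    label is an integer, the tree is countable, and the conditions on branches mention the histories
    alone. No single exponent suits all X, hence the sum over p. A condition for one number of
    blocks suffices because it improves itself: p^k blocks have sums of at most (p/2)^k, a vanishing
    fraction of their number, and a gliding hump then excludes functionals that stay large on tails.
    Rounding costs constants: the 1/8 obtained for X leaves room for the 1/2 imposed on branches.
    The partial sum operators of a Markushevich basis need not be uniformly bounded; truncations are
    therefore obtained by compactness and corrected by finitely supported vectors, and a
    decomposition recovers y at a point x only up to half the norm of x. This is enough, since y is
    used to norm one x at a time. *)

Lemma free_ultrafilter_ex : exists F : set_system nat, UltraFilter F /\ (\oo : set_system nat) `<=` F.
Proof. exact: ultraFilterLemma. Qed.

(** One free ultrafilter is fixed throughout: bounded real sequences and norm-bounded sequences of
    functionals converge along it, so no subsequences are extracted and w*-limits exist without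
    separability. *)
Definition ufil : set_system nat := sval (cid free_ultrafilter_ex).

Lemma ufil_ultra : UltraFilter ufil.
Proof. exact: (svalP (cid free_ultrafilter_ex)).1. Qed.

Instance ufil_proper : ProperFilter ufil.
Proof. by case: ufil_ultra. Qed.

Lemma ufil_ge n : ufil [set m | (n <= m)%N].
Proof.
by apply: (svalP (cid free_ultrafilter_ex)).2; exists n.
Qed.

Lemma ufilVC (A : set nat) : ufil A \/ ufil (~` A).
Proof. exact: in_ultra_setVsetC ufil_ultra. Qed.

Section DualTools.
Context {R : realType}.

Lemma leVlt (a b : R) : a <= b \/ b < a.
Proof. by case: (lerP a b) => ?; [left|right]. Qed.

Lemma ucvg_bounded (u : nat -> R) (M : R) : (forall n, `|u n| <= M) ->
  exists l : R, u @ ufil --> l.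
Proof.
move=> uM; have := @segment_compact R (- M) M; rewrite compact_ultra.
move=> /(_ (u @ ufil)) [].
- split; [exact: fmap_proper_filter|move=> G GF FG].
  apply/seteqP; split=> // A GA.
  have [//|UA] := ufilVC (u @^-1` A).
  by have : (G (A `&` ~` A)) by [apply: filterI => //; exact: FG]; rewrite setICr => /filter_not_empty.
- change (ufil (u @^-1` [set` `[- M, M]])).
  by apply: filterE => n; rewrite /= in_itv/= -ler_norml.
by move=> l [_ ?]; exists l.
Qed.

Lemma ucvgr_near (u : nat -> R) (l e : R) : u @ ufil --> l -> 0 < e ->
  ufil [set n | `|l - u n| < e].
Proof. by move=> /cvgrPdist_lt ul e0; exact: ul. Qed.

Lemma ucvg_le (u : nat -> R) (l b : R) : u @ ufil --> l -> ufil [set n | u n <= b] -> l <= b.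
Proof. by move=> ul; apply: (cvgr_to_le ul). Qed.

Lemma ucvg_ge (u : nat -> R) (l b : R) : u @ ufil --> l -> ufil [set n | b <= u n] -> b <= l.
Proof. by move=> ul; apply: (cvgr_to_ge ul). Qed.

Lemma ucvg_unique (u : nat -> R) (l l' : R) : u @ ufil --> l -> u @ ufil --> l' -> l = l'.
Proof. exact: cvg_unique. Qed.

Lemma dual_ex (Z : normedModType R) (l : Z -> R^o) M : linear l ->
  (forall z, `|l z| <= M * `|z|) ->
  exists f : dual Z, (forall z, f z = l z) /\ (0 <= M -> `|f| <= M).
Proof.
move=> ll lM.
pose lL : {linear Z -> R^o} := HB.pack l (GRing.isLinear.Build R Z R^o *:%R l ll).
have lc : continuous l.
  apply: (@bounded_linear_continuous _ _ _ lL); apply/linear_boundedP.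
  near=> r => x; apply: (le_trans (lM x)).
  by rewrite ler_wpM2r//; near: r; apply: nbhs_pinfty_ge; exact: num_real.
exists (Dual (asboolT (conj ll lc))); split => // M0.
apply: dual_norm_le => x x1; apply: (le_trans (lM x)).
by rewrite -[leRHS]mulr1 ler_wpM2l.
Unshelve. all: by end_near. Qed.

Lemma dual_ub (Z : normedModType R) (f : dual Z) z : `|f z| <= `|f| * `|z|.
Proof. exact: dual_norm_ub. Qed.

Lemma dual_ub1 (Z : normedModType R) (f : dual Z) z M : `|f| <= M -> `|f z| <= M * `|z|.
Proof. by move=> fM; apply: (le_trans (dual_ub f z)); rewrite ler_wpM2r. Qed.

Lemma eval_dual (V : normedModType R) (z : V) :
  exists F : dual (dual V), (forall f : dual V, F f = f z) /\ `|F| <= `|z|.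
Proof.
have [|f|F [Fz Fn]] := @dual_ex (dual V) (fun f => f z) `|z|.
- by [].
- by rewrite mulrC; exact: dual_ub.
by exists F; split => //; exact: Fn.
Qed.

Lemma dual_ext (Z : normedModType R) (f g : dual Z) : (forall z, f z = g z) -> f = g.
Proof. by move=> fg; apply/val_inj/funext. Qed.

Definition wscvg (Z : normedModType R) (u : nat -> dual Z) (f : dual Z) :=
  forall z, (fun n => u n z : R) @ ufil --> (f z : R).

Lemma wscvg_ex (Z : normedModType R) (u : nat -> dual Z) M :
  (forall n, `|u n| <= M) -> exists f : dual Z, wscvg u f /\ `|f| <= M.
Proof.
move=> uM.
have M0 : 0 <= M by apply: le_trans (uM 0%N).
have ucv z : exists l : R, (fun n => u n z : R) @ ufil --> (l : R).
  by apply: (@ucvg_bounded _ (M * `|z|)) => n; exact: dual_ub1.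
pose l z : R^o := sval (cid (ucv z)).
have lP z : (fun n => u n z : R) @ ufil --> (l z : R) := svalP (cid (ucv z)).
have [|z|f [fl fM]] := @dual_ex Z l M.
- move=> a x y; have : (fun n => u n (a *: x + y) : R) @ ufil --> (a * l x + l y : R).
    have -> : (fun n => u n (a *: x + y) : R) = (fun n => a * (u n x : R) + (u n y : R)).
      by apply/funext => n; rewrite linearP.
    by apply: cvgD => //; apply: cvgMl_tmp.
  by move=> h; exact: (ucvg_unique (lP (a *: x + y)) h).
- apply: (ucvg_le (cvg_norm (lP z))); apply: filterE => n /=.
  exact: dual_ub1.
exists f; split => [z|]; last exact: fM.
by rewrite fl.
Qed.

Lemma wscvg_norm (Z : normedModType R) (u : nat -> dual Z) f M : 0 <= M ->
  wscvg u f -> ufil [set n | `|u n| <= M] -> `|f| <= M.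
Proof.
move=> M0 uf uM; apply: dual_norm_le => z z1.
apply: (ucvg_le (cvg_norm (uf z))); apply: filterS uM => n /= un.
by apply: (le_trans (dual_ub1 z un)); rewrite -[leRHS]mulr1 ler_wpM2l.
Qed.

Lemma wscvgD (Z : normedModType R) (u v : nat -> dual Z) f g :
  wscvg u f -> wscvg v g -> wscvg (u \+ v) (f + g).
Proof. by move=> uf vg z; exact: (cvgD (uf z) (vg z)). Qed.

Lemma wscvgB (Z : normedModType R) (u v : nat -> dual Z) f g :
  wscvg u f -> wscvg v g -> wscvg (u \- v) (f - g).
Proof. by move=> uf vg z; exact: (cvgB (uf z) (vg z)). Qed.

Lemma norm_wscvg (Z : normedModType R) (u : nat -> dual Z) f :
  (forall e, 0 < e -> ufil [set n | `|u n - f| < e]) -> wscvg u f.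
Proof.
move=> uf z; apply/cvgrPdist_lt => d d0; have z1 : 0 < `|z| + 1 by rewrite ltr_wpDl.
apply: filterS (uf _ (divr_gt0 d0 z1)) => n /= /ltW/(dual_ub1 z) un; rewrite distrC.
apply: (le_lt_trans un).
by rewrite mulrAC ltr_pdivrMr// ltr_pM2l// ltrDl.
Qed.

Section HahnBanach.
Context (Z : normedModType R) (p : Z -> R).
Hypothesis pD : forall x y, p (x + y) <= p x + p y.
Hypothesis pZ : forall a x, p (a *: x) = `|a| * p x.
Hypothesis pn : forall x, p x <= `|x|.
Variable z0 : Z.

(** Partial functionals are represented by their graphs, so that Zorn's lemma is applied to plain
    sets and the union of a chain is again a candidate. *)
Definition hb_graph (G : set (Z * R)) :=
  [/\ G (0, 0), forall a x r y s, G (x, r) -> G (y, s) -> G (a *: x + y, a * r + s),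
      forall x r, G (x, r) -> r <= p x & G (z0, p z0)].

Definition hb_type := {G : set (Z * R) | hb_graph G}.

Lemma hb0 : p 0 = 0.
Proof. by have := pZ 0 0; rewrite scaler0 normr0 mul0r. Qed.

Lemma hbN x : p (- x) = p x.
Proof. by rewrite -scaleN1r pZ normrN1 mul1r. Qed.

Lemma hb_graph_func G x r s : hb_graph G -> G (x, r) -> G (x, s) -> r = s.
Proof.
move=> [G0 GL Gn _] xr xs; have le u v : G (x, u) -> G (x, v) -> u <= v.
  move=> xp xq; have := Gn _ _ (GL (-1) _ _ _ _ xq xp).
  by rewrite scaleN1r addNr hb0 mulN1r addrC subr_le0.
by apply/eqP; rewrite eq_le !le.
Qed.

Lemma hb_start : hb_graph [set q | exists a, q = (a *: z0, a * p z0)].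
Proof.
split.
- by exists 0; rewrite scale0r mul0r.
- move=> a _ _ _ _ [b [-> ->]] [c [-> ->]]; exists (a * b + c).
  by rewrite scalerDl scalerA mulrDl mulrA.
- by move=> _ _ [a [-> ->]]; rewrite pZ ler_wpM2r ?ler_norm//; have := pD z0 (- z0); rewrite subrr hb0 hbN; lra.
- by exists 1; rewrite scale1r mul1r.
Qed.

Lemma hb_extend G x0 : hb_graph G -> exists2 G', hb_graph G' & G `<=` G' /\ exists r, G' (x0, r).
Proof.
move=> [G0 GL Gn Gz].
have GN x r : G (x, r) -> G (- x, - r).
  by move=> /GL/(_ G0) => /(_ (-1)); rewrite scaleN1r mulN1r !addr0.
have GD x r y s : G (x, r) -> G (y, s) -> G (x + y, r + s).
  by move=> /(GL 1) h /h; rewrite scale1r mul1r.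
pose A := [set q.2 - p (q.1 - x0) | q in G].
have Aub x r : G (x, r) -> ubound A (p (x + x0) - r).
  move=> Gx _ [[y s] /= Gy <-]; rewrite lerBrDr addrAC lerBlDr.
  apply: (le_trans (Gn _ _ (GD _ _ _ _ Gy Gx))).
  rewrite addrC.
  have -> : x + y = (x + x0) + (y - x0) by rewrite addrACA subrr addr0.
  exact: pD.
have supA : has_sup A.
  by split; [exists (0 - p (0 - x0)), (0, 0)|exists (p (0 + x0) - 0); exact: Aub].
(* Any value between [sup A] and the infimum of [p (x + x0) - r] is admissible at [x0]; [c1] serves
   the negative multiples of [x0] and [c2] the positive ones. *)
pose c := sup A.
have c1 x r : G (x, r) -> r - p (x - x0) <= c.
  by move=> Gx; apply: (sup_upper_bound supA); exists (x, r).
have c2 x r : G (x, r) -> c <= p (x + x0) - r.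
  by move=> Gx; apply: ge_sup; [exact: supA.1|exact: Aub].
pose G' := [set q | exists x r a, G (x, r) /\ q = (x + a *: x0, r + a * c)].
have GG' : G `<=` G'.
  by move=> [x r] Gx; exists x, r, 0; rewrite scale0r mul0r !addr0.
exists G'; last by split => //; exists c, 0, 0, 1; rewrite scale1r mul1r !add0r.
split.
- exact: GG'.
- move=> a _ _ _ _ [x [r [b [Gx [-> ->]]]]] [y [s [d [Gy [-> ->]]]]].
  exists (a *: x + y), (a * r + s), (a * b + d); split; first exact: GL.
  congr pair; first by rewrite scalerDr scalerA scalerDl addrACA.
  by rewrite mulrDr mulrDl mulrA addrACA.
- move=> _ _ [x [r [a [Gx [-> ->]]]]].
  have [a0|a0|->] := ltgtP a 0; last by rewrite scale0r mul0r !addr0; exact: Gn.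
  + have b0 : 0 < - a by rewrite oppr_gt0.
    have := GL (- a)^-1 _ _ _ _ Gx G0; rewrite !addr0 => /c1.
    set n := p _; have -> : p (x + a *: x0) = - a * n.
      rewrite /n -[X in X * _]gtr0_norm// -pZ scalerBr scalerA divff ?gt_eqF//.
      by rewrite scale1r scaleNr opprK.
    by rewrite -(ler_pM2l b0) mulrBr mulrA divff ?gt_eqF// mul1r; lra.
  + have := GL a^-1 _ _ _ _ Gx G0; rewrite !addr0 => /c2.
    set n := p _; have -> : p (x + a *: x0) = a * n.
      rewrite /n -[X in X * _]gtr0_norm// -pZ scalerDr scalerA divff ?gt_eqF//.
      by rewrite scale1r.
    by rewrite -(ler_pM2l a0) mulrBr mulrA divff ?gt_eqF// mul1r; lra.
- exact: GG'.
Qed.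

(** Domination by a seminorm [p] below the norm, not only by the norm: with [p] the distance to a
    span, the functional obtained vanishes on that span. *)
Lemma hahn_banach : exists f : dual Z, (forall z, `|f z| <= p z) /\ f z0 = p z0.
Proof.
pose le (G H : hb_type) := `[< sval G `<=` sval H >].
have [||||[G GP] Gmax] := @Zorn hb_type le.
- by move=> G; apply/asboolP.
- by move=> G H K /asboolP GH /asboolP HK; apply/asboolP; exact: subset_trans HK.
- move=> [G GP] [H HP] /asboolP/= GH /asboolP/= HG.
  by apply: eq_exist; apply/seteqP.
- move=> C Ctot; have [[G0 CG0]|C0] := pselect (exists G, C G); last first.
    by exists (exist _ _ hb_start) => G CG; case: C0; exists G.
  have UP : hb_graph (\bigcup_(G in C) sval G).
    split.
    + by exists G0 => //; case: (svalP G0).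
    + move=> a x r y s [G CG Gx] [H CH Hy].
      have [/asboolP GH|/asboolP HG] := Ctot _ _ CG CH.
        by exists H => //; case: (svalP H) => _ HL _ _; apply: HL => //; exact: GH.
      by exists G => //; case: (svalP G) => _ GL _ _; apply: GL => //; exact: HG.
    + by move=> x r [G CG]; case: (svalP G) => _ _ Gn _; exact: Gn.
    + by exists G0 => //; case: (svalP G0).
  exists (exist _ _ UP) => G CG; apply/asboolP => q Gq; by exists G.
have Gtot x : exists r, G (x, r).
  have [G' G'P [GG' [r G'r]]] := hb_extend x GP.
  have /(congr1 sval)/= <- : exist _ G' G'P = exist _ G GP.
    by apply: Gmax; apply/asboolP.
  by exists r.
have [G0 GL Gn Gz] := GP.
pose l x : R^o := sval (cid (Gtot x)).
have lP x : G (x, l x) := svalP (cid (Gtot x)).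
have ll : linear l.
  by move=> a x y; apply: (hb_graph_func GP (lP _)); exact: GL.
have lp x : `|l x| <= p x.
  rewrite ler_norml (Gn _ _ (lP x)) andbT lerNl.
  have := GL (-1) _ _ _ _ (lP x) G0; rewrite !addr0 scaleN1r mulN1r => /Gn.
  by rewrite hbN.
have [|f [fl _]] := @dual_ex Z l 1 ll.
  by move=> x; rewrite mul1r (le_trans (lp x)).
exists f; split; first by move=> z; rewrite fl.
by rewrite fl; apply: (hb_graph_func GP (lP _)).
Qed.

End HahnBanach.

Lemma hahn_banach_norming (Z : normedModType R) (z0 : Z) :
  exists f : dual Z, `|f| <= 1 /\ f z0 = `|z0|.
Proof.
have [] := @hahn_banach Z (fun z => `|z|) _ _ _ z0.
- exact: ler_normD.
- exact: normrZ.
- by [].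
move=> f [fn fz]; exists f; split => //.
by apply: dual_norm_le => z z1; exact: le_trans (fn z) z1.
Qed.
End DualTools.

(** * Weak-star derivations *)

Lemma dist_triangle {R : realType} (V : normedModType R) (x y z : V) :
  `|x - y| <= `|x - z| + `|y - z|.
Proof. by rewrite -(subrKA z) (le_trans (ler_normD _ _))// lerD2l distrC. Qed.

Section Derivation.
Context {R : realType} {Z : normedModType R}.
Implicit Types (K : set (dual Z)) (F : seq Z) (f g h : dual Z) (eps eta : R).

Definition wnbhd F eta f : set (dual Z) :=
  [set g | forall z, z \in F -> `|g z - f z| < eta].

(* Unlike the sequential derivation defining [szlenk], this one uses all basic
   w*-neighbourhoods, which makes it available without separability. *)
Definition wder eps K : set (dual Z) := [set f | K f /\
  forall F eta, 0 < eta -> exists g h,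
    [/\ K g, K h, wnbhd F eta f g, wnbhd F eta f h & eps <= `|g - h|]].

Definition wdern n eps K := iter n (wder eps) K.

Lemma wder_sub eps K : wder eps K `<=` K.
Proof. by move=> f []. Qed.

(** One member of a pair at distance [eps + eps] is at distance [eps] from the centre. This doubling
    is the price for passing from pairs to points that approach [f]. *)
Lemma wder_half eps K f F eta : wder (eps + eps) K f -> 0 < eta ->
  exists g, [/\ K g, wnbhd F eta f g & eps <= `|g - f|].
Proof.
move=> [_ fP] eta0; have [g [h [Kg Kh gF hF gh]]] := fP F eta eta0.
have := le_trans gh (@dist_triangle _ _ g h f).
have [ge _|ge geh] := leVlt eps `|g - f|; first by exists g.
by exists h; split => //; move: (`|g - f|) (`|h - f|) ge geh => r s; lra.
Qed.

Lemma wdern_sub n eps K : wdern n eps K `<=` K.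
Proof. by elim: n => [//|n IH] f /wder_sub/IH. Qed.

Lemma wder_mono eps K K' : K `<=` K' -> wder eps K `<=` wder eps K'.
Proof.
move=> KK' f [Kf fP]; split; first exact: KK'.
move=> F eta eta0; have [g [h [Kg Kh gF hF gh]]] := fP F eta eta0.
by exists g, h; split => //; exact: KK'.
Qed.

Lemma wdern_mono n eps K K' : K `<=` K' -> wdern n eps K `<=` wdern n eps K'.
Proof. by move=> KK'; elim: n => [//|n IH]; exact: wder_mono. Qed.

Lemma wnbhd_refl F eta f : 0 < eta -> wnbhd F eta f f.
Proof. by move=> e0 z _; rewrite subrr normr0. Qed.

Lemma wnbhd_open F eta f g : wnbhd F eta f g ->
  exists2 d, 0 < d & wnbhd F d g `<=` wnbhd F eta f.
Proof.
elim: F => [|z F IH] fg; first by exists 1; rewrite ?ltr01// => h _ z; rewrite in_nil.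
have [z' Fz'|d d0 dP] := IH; first by apply: fg; rewrite inE Fz' orbT.
have zg : 0 < eta - `|g z - f z| by rewrite subr_gt0 fg// mem_head.
exists (Num.min d (eta - `|g z - f z|)); first by rewrite lt_min d0.
move=> h gh z'; rewrite inE => /predU1P[->|Fz'].
  have := gh z (mem_head _ _); rewrite lt_min => /andP[_].
  rewrite ltrBrDr; apply: le_lt_trans.
  by apply: le_trans (ler_normD _ _); rewrite addrA subrK.
apply: dP => // y Fy; have := gh y; rewrite inE Fy orbT lt_min => /(_ isT).
by move=> /andP[].
Qed.

Lemma wnbhd_cat F F' eta eta' f g :
  wnbhd (F ++ F') (Num.min eta eta') f g -> wnbhd F eta f g /\ wnbhd F' eta' f g.
Proof.
move=> fg; split=> z zF; have := fg z; rewrite mem_cat zF ?orbT lt_min => /(_ isT);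
  by move=> /andP[].
Qed.

(** A basic neighbourhood is w*-open, so the pairs that keep [f] in the derived set can be taken
    inside it. *)
Lemma wder_local F eta c eps K :
  wder eps K `&` wnbhd F eta c `<=` wder eps (K `&` wnbhd F eta c).
Proof.
move=> f [[Kf fP] cf]; split => // F' eta' eta'0.
have [d d0 dP] := wnbhd_open cf.
have [|g [h [Kg Kh gF hF gh]]] := fP (F ++ F') (Num.min d eta').
  by rewrite lt_min d0.
move: gF hF => /wnbhd_cat[gF gF'] /wnbhd_cat[hF hF'].
by exists g, h; split => //; split => //; exact: dP.
Qed.

Lemma wdern_local n F eta c eps K :
  wdern n eps K `&` wnbhd F eta c `<=` wdern n eps (K `&` wnbhd F eta c).
Proof.
elim: n => [//|n IH] f [fn cf]; apply: (wder_mono IH).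
by apply: wder_local.
Qed.

Lemma wder_affine (t : R) c eps K : 0 < t ->
  [set f | wder (t * eps) K (c + t *: f)] `<=` wder eps [set f | K (c + t *: f)].
Proof.
move=> t0 f [Kf fP]; split => //= F eta eta0.
have [g [h [Kg Kh gF hF gh]]] := fP F (t * eta) (mulr_gt0 t0 eta0).
have tK g' : c + t *: (t^-1 *: (g' - c)) = g'.
  by rewrite scalerA divff ?gt_eqF// scale1r addrC subrK.
have tN g' : wnbhd F (t * eta) (c + t *: f) g' -> wnbhd F eta f (t^-1 *: (g' - c)).
  move=> g'F z /g'F.
  change (`|g' z - (c z + t * f z)| < t * eta ->
    `|t^-1 * (g' z - c z) - f z| < eta).
  have -> : g' z - (c z + t * f z) = t * (t^-1 * (g' z - c z) - f z).
    by rewrite mulrBr mulrA divff ?gt_eqF// mul1r opprD addrA.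
  by rewrite normrM (gtr0_norm t0) ltr_pM2l.
exists (t^-1 *: (g - c)), (t^-1 *: (h - c)); split.
- by rewrite /= tK.
- by rewrite /= tK.
- exact: tN.
- exact: tN.
- rewrite -scalerBr normrZ opprB addrA subrK gtr0_norm ?invr_gt0//.
  by rewrite mulrC ler_pdivlMr// mulrC.
Qed.

Lemma wdern_affine n (t : R) c eps K : 0 < t ->
  [set f | wdern n (t * eps) K (c + t *: f)] `<=` wdern n eps [set f | K (c + t *: f)].
Proof.
move=> t0; elim: n => [//|n IH] f fn.
apply: (wder_mono IH); exact: wder_affine.
Qed.

Definition dball : set (dual Z) := [set f | `|f| <= 1].

(** If [f] is lost in one derivation at scale [eps], some neighbourhood of [f] meets [K] inside the
    ball of radius [eps] about [f], since a point further away would form a pair with [f]. This ball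
    is a scaled copy of the unit ball, so [m] derivations at scale [eps * delta] empty it. *)
Lemma wdern_absorb m (eps delta : R) K : 0 < eps ->
  wdern m delta dball = set0 -> wdern m (eps * delta) K `<=` wder eps K.
Proof.
move=> eps0 m0 f fm; split; first exact: wdern_sub fm.
move=> F eta eta0; apply: contrapT => nP.
have sub : K `&` wnbhd F eta f `<=` [set g | `|g - f| <= eps].
  move=> g [Kg gF]; rewrite /= leNgt; apply/negP => gf; apply: nP.
  by exists g, f; split => //; [exact: wdern_sub fm|exact: wnbhd_refl|exact: ltW].
have /(wdern_mono sub) := @wdern_local m F eta f (eps * delta) K f (conj fm (@wnbhd_refl F eta f eta0)).
move=> fm'; have : wdern m delta dball 0.
  have := @wdern_affine m eps f delta [set g | `|g - f| <= eps] eps0 0.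
  rewrite /= scaler0 addr0 => /(_ fm'); apply: wdern_mono => g /=.
  by rewrite addrAC subrr add0r normrZ gtr0_norm// -[leRHS]mulr1 ler_pM2l.
by rewrite m0.
Qed.

Lemma wdern_submult n m (eps delta : R) : 0 < eps ->
  wdern n eps dball = set0 -> wdern m delta dball = set0 ->
  wdern (n * m) (eps * delta) dball = set0.
Proof.
move=> eps0 n0 m0; apply/seteqP; split => // f; rewrite -n0.
suff : wdern (n * m) (eps * delta) dball `<=` wdern n eps dball by apply.
elim: n {n0} => [//|n IH] g; rewrite mulSn {1}/wdern iterD => gm.
by apply: (wder_mono IH); apply: wdern_absorb m0 _ gm.
Qed.

(** Termination at the single scale 1/2 gives a power-type bound at all dyadic scales; this is what
    makes the lower estimate below an l_p estimate with finite p. *)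
Lemma wdern_pow M k : wdern M (2^-1) dball = set0 ->
  wdern (M ^ k.+1) (2^-1 ^+ k.+1) dball = set0.
Proof.
move=> M0; elim: k => [|k IH]; first by rewrite expn1 expr1.
by rewrite expnSr exprSr; apply: wdern_submult => //; rewrite exprn_gt0.
Qed.

Definition wclosed K := forall (u : nat -> dual Z) f,
  ufil [set n | K (u n)] -> wscvg u f -> K f.

Lemma wscvg_nbhd (u : nat -> dual Z) f F eta : 0 < eta -> wscvg u f ->
  ufil [set n | wnbhd F eta f (u n)].
Proof.
move=> eta0 uf; elim: F => [|z F IH]; first exact: filterE.
apply: filterS2 IH (ucvgr_near (uf z) eta0) => n nF nz y.
by rewrite inE => /predU1P[->|/nF//]; rewrite distrC.
Qed.

Lemma wder_closed eps K : wclosed K -> wclosed (wder eps K).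
Proof.
move=> Kc u f uK uf; split.
  by apply: Kc uf; apply: filterS uK => n [].
move=> F eta eta0; have [n [[Kn nP] nF]] := filter_ex (filterI uK (wscvg_nbhd F eta0 uf)).
have [d d0 dP] := wnbhd_open nF.
have [g [h [Kg Kh gF hF gh]]] := nP F d d0.
by exists g, h; split => //; exact: dP.
Qed.

Lemma wder_lim eps K (u : nat -> dual Z) f : wclosed K ->
  ufil [set n | K (u n)] -> wscvg u f -> ufil [set n | eps <= `|u n - f|] ->
  wder eps K f.
Proof.
move=> Kc uK uf ue; have Kf := Kc _ _ uK uf; split => // F eta eta0.
have [n [[Kn nF] ne]] := filter_ex (filterI (filterI uK (wscvg_nbhd F eta0 uf)) ue).
by exists (u n), f; split => //; exact: wnbhd_refl.
Qed.

Lemma dball_closed : wclosed dball.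
Proof. by move=> u f uB uf; exact: wscvg_norm uf uB. Qed.

Lemma wdern_closed n eps : wclosed (wdern n eps dball).
Proof. by elim: n => [|n IH]; [exact: dball_closed|exact: wder_closed]. Qed.

Lemma wdern_eps_mono n (eps eps' : R) (K : set (dual Z)) : eps <= eps' ->
  wdern n eps' K `<=` wdern n eps K.
Proof.
move=> ee'; elim: n => [//|n IH] f /(wder_mono IH)[Kf fP]; split=> // F eta eta0.
have [g [h [Kg Kh gF hF gh]]] := fP F eta eta0.
by exists g, h; split => //; exact: le_trans gh.
Qed.

Lemma wdern_leq n m (eps : R) (K : set (dual Z)) : (n <= m)%N -> wdern m eps K `<=` wdern n eps K.
Proof.
move=> /subnKC <-; rewrite addnC; elim: (m - n)%N => [//|k IH] f.
by rewrite addSn => /wder_sub/IH.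
Qed.

End Derivation.

(** * Szlenk indices *)

Section Separable.
Context {R : realType}.

Lemma separable_seq (X : completeNormedModType R) : separable X ->
  exists z : nat -> X, forall x (e : R), 0 < e -> exists n, `|x - z n| < e.
Proof.
move=> [A /countable_injP[f finj] Ad].
exists (fun n => xget 0 [set a | A a /\ f a = n]) => x e e0.
have [||y [By Ay]] := Ad (ball x e).
- by exists x; exact: ballxx.
- exact: ball_open.
exists (f y); case: xgetP => [w _ [Aw /finj ->]|/(_ y)[]//]; rewrite ?inE//.
by rewrite -ball_normE in By.
Qed.

Lemma seq_separable (X : completeNormedModType R) (T : countType) (z : T -> X) :
  (forall x (e : R), 0 < e -> exists n, `|x - z n| < e) -> separable X.
Proof.
move=> zd; exists (range z); first exact: sub_countable (card_image_le _ _) (@countableP _ _).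
move=> O [x Ox] Oo; have /nbhs_ballP[e/= e0 eO] := open_nbhs_nbhs (conj Oo Ox).
have [n zn] := zd x e e0; exists (z n); split; last by exists n.
by apply: eO; rewrite -ball_normE.
Qed.

End Separable.

Section SzlenkOmega.
Local Open Scope order_scope.

Lemma seq_has_max (s : seq ord) x0 : x0 \in s ->
  exists2 m, m \in s & forall x, x \in s -> x <= m.
Proof.
elim: s x0 => [//|y s IH] x0 _; case: s IH => [_|y' s IH].
  by exists y; rewrite ?mem_head// => x; rewrite inE => /eqP->.
have [m ms mP] := IH y' (mem_head _ _).
have [ym|my] := leP y m.
  by exists m => [|x]; rewrite in_cons ?ms ?orbT// => /predU1P[->|/mP].
exists y; first exact: mem_head.
by move=> x; rewrite in_cons => /predU1P[->//|/mP xm]; exact: le_trans xm (ltW my).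
Qed.

Lemma finite_ord_cases a : finite_set [set b | b < a] ->
  ord_zero a \/ exists b, ord_succ b a.
Proof.
move=> /finite_seqP[s sP].
have sE b : (b < a) = (b \in s).
  by apply/idP/idP => h; [have : [set b | b < a] b by []; rewrite sP|have : [set` s] b by []; rewrite -sP].
have [s0|/eqP s0] := eqVneq s [::].
  by left=> b; rewrite leNgt sE s0.
case: s {sP} sE s0 => [//|x s] sE _.
have [m ms mP] := seq_has_max (mem_head x s).
right; exists m; split; first by rewrite sE.
by move=> c mc; rewrite leNgt sE; apply/negP => /mP; rewrite leNgt mc.
Qed.

Lemma omega_limit : ord_limit omega.
Proof.
split=> [o0|[b [bo bP]]]; apply: omega_infinite.
  suff -> : [set b | b < omega] = set0 by exact: finite_set0.
  by apply/seteqP; split=> // b /=; rewrite ltNge o0.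
apply: (@sub_finite_set _ _ ([set c | c < b] `|` [set b])).
  move=> c /= co; have [cb|bc|->] := ltgtP c b; [by left| |by right].
  by have := bP c bc; rewrite leNgt co.
by rewrite finite_setU; split; [exact: omega_least|exact: finite_set1].
Qed.

(** An ordinal below [omega] is determined by the number of its predecessors, because a larger one
    has strictly more. *)
Lemma omega_countable : countable [set b | b < omega].
Proof.
apply/countable_injP; exists (fun b => size (finmap.enum_fset (fset_set [set c | c < b]))).
move=> b b'; rewrite !inE /= => bo b'o.
wlog bb' : b b' bo b'o / b <= b'.
  move=> W; have [bb'|/ltW b'b] := leP b b'; first exact: W.
  by move=> e; apply/esym; apply: W.
move: bb'; rewrite le_eqVlt => /predU1P[//|bb'] e.
have /finmap.fproper_ltn_card : (finmap.fproper (fset_set [set c | c < b]) (fset_set [set c | c < b'])).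
  have fb := omega_least bo; have fb' := omega_least b'o.
  rewrite finmap.fproperE; apply/andP; split.
    by rewrite -fset_set_sub// => c /= cb; exact: lt_trans cb bb'.
  by apply/negP; rewrite -fset_set_sub// => /(_ b bb') /=; rewrite ltxx.
by rewrite e ltnn.
Qed.

Lemma omega_lt_omega1 : omega < omega1.
Proof.
rewrite ltNge; apply/negP => o1o; apply: omega1_uncountable.
by apply: sub_countable omega_countable; apply: subset_card_le => b /= /lt_le_trans; exact.
Qed.

End SzlenkOmega.

Section SzlenkDerivation.
Context {R : realType} (Z : completeNormedModType R).

Lemma limn_einf_ge (u : nat -> R) (e : R) : (forall n, e <= u n) ->
  (e%:E <= limn_einf (fun n => (u n)%:E))%E.
Proof.
move=> eu; rewrite limn_einf_lim; apply: lime_ge; first exact: is_cvg_einfs.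
apply: nearW => n; apply: le_ereal_inf_tmp => _ [m _ <-].
by rewrite lee_fin.
Qed.

(** Separability replaces neighbourhoods by a sequence: the n-th point is close to [f] on the first
    n terms of a dense sequence, and boundedness extends the convergence to all points. *)
Lemma wder_szlenk_seq (eps : R) (K : set (dual Z)) f : separable Z ->
  K `<=` dball -> wder (eps + eps) K f ->
  exists u : nat -> dual Z, [/\ forall n, K (u n), weak_star_cvg u f &
    (eps%:E <= limn_einf (fun n => `|u n - f|%:E))%E].
Proof.
move=> /separable_seq[z zd] KB fP; have Kf := wder_sub fP.
have uex n : exists g, [/\ K g, wnbhd (mkseq z n) (n.+1%:R^-1) f g & eps <= `|g - f|].
  have n0 : 0 < n.+1%:R^-1 :> R by rewrite invr_gt0.
  exact: (@wder_half R Z eps K f (mkseq z n) n.+1%:R^-1 fP n0).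
pose u n := sval (cid (uex n)); 
have uP n : [/\ K (u n), wnbhd (mkseq z n) n.+1%:R^-1 f (u n) & eps <= `|u n - f|].
  exact: (svalP (cid (uex n))).
exists u; split; [by move=> n; case: (uP n)| |by apply: limn_einf_ge => n; case: (uP n)].
move=> x; apply/cvgrPdist_le => e e0.
have e4 : 0 < e / 4 by rewrite divr_gt0.
have [m zm] := zd x _ e4.
near=> n; have [Kun un _] := uP n.
have -> : f x - u n x = (f (x - z m) - u n (x - z m)) + (f (z m) - u n (z m)).
  by rewrite !linearB/=; ring.
have f1 : `|f (x - z m)| <= e / 4.
  by apply: (le_trans (dual_ub1 _ (KB _ Kf))); rewrite mul1r ltW.
have u1 : `|u n (x - z m)| <= e / 4.
  by apply: (le_trans (dual_ub1 _ (KB _ Kun))); rewrite mul1r ltW.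
have zmn : `|f (z m) - u n (z m)| <= e / 4.
  rewrite distrC ltW// (lt_le_trans (un (z m) _))//.
    by apply: map_f; rewrite mem_iota/= add0n; near: n; exists m.+1.
  by apply: ltW; near: n; exact: (near_infty_natSinv_lt (PosNum e4)).
rewrite (le_trans (ler_normD _ _))//; apply: (le_trans (lerD (ler_normB _ _) zmn)).
lra.
Unshelve. all: by end_near. Qed.

Local Open Scope order_scope.

(** An ordinal below [omega] is zero or a successor, and each successor step costs one derivation;
    argued on a least counterexample. *)
Lemma wdern_szlenk (eps : R) a : separable Z -> a < omega ->
  exists n, wdern n (eps + eps)%R (dball (Z := Z)) `<=` szlenk_derived eps a.
Proof.
move=> Zs ao; apply: contrapT => nex.
have [|m [mP mmin]] := @ord_le_wf [set a | a < omega /\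
   ~ exists n, wdern n (eps + eps)%R (dball (Z := Z)) `<=` szlenk_derived eps a].
  by exists a.
case: mP => mo; apply.
have [m0|[b bm]] := finite_ord_cases (omega_least mo).
  by exists 0%N; rewrite szlenk_derived_zeroE.
have bm1 := bm.1.
have [n nP] : exists n, wdern n (eps + eps)%R (dball (Z := Z)) `<=` szlenk_derived eps b.
  apply: contrapT => nb; have := mmin b (conj (lt_trans bm1 mo) nb).
  by change (m <= b -> False); rewrite leNgt bm1.
exists n.+1; rewrite (szlenk_derived_succE Z eps bm) => f fn; split.
  by apply: nP; exact: wder_sub fn.
have [u [Ku uf ue]] := wder_szlenk_seq Zs (@wdern_sub _ _ _ _ _) fn.
by exists u; split => // k; exact: nP.
Qed.

(** Index [omega] only says that the derivation is empty at stage [omega] at the latest. If every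
    finite derived set had a point, a limit of such points along [ufil] would lie in all these
    decreasing w*-closed sets, hence in stage [omega]. *)
Lemma szlenk_omega_wdern (eps : R) : separable Z -> szlenk Z = omega -> (0 < eps)%R ->
  exists n, wdern n eps (dball (Z := Z)) = set0.
Proof.
(* [d < 1] because [szlenk] ranges over scales below 1; [d + d <= eps] because of the doubling in
   [wder_half]. *)
move=> Zs Zo eps0; pose d := (Num.min (eps / 2) (1 / 2))%R.
have d0 : (0 < d)%R by rewrite lt_min !divr_gt0.
have d1 : (d < 1)%R by rewrite gt_min; apply/orP; right; lra.
have dd : (d + d <= eps)%R.
  have : (d <= eps / 2)%R by rewrite ge_min lexx.
  by lra.
have zd : szlenk_eps Z d <= omega.
  rewrite -Zo; apply: (@ord_leastP [set a | forall b, _ -> b <= a] _).1 => /=.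
    by exists None => b _; case: b.
  by exists d => //; rewrite d0.
have [|zP _] := @ord_leastP ([set a | (a < omega1)%O /\ szlenk_derived (X:=Z) d a = set0]
             `|` [set omega1]); first by exists omega1; right.
change ([set a | (a < omega1)%O /\ szlenk_derived (X:=Z) d a = set0]
             `|` [set omega1]) with ([set a | (a < omega1)%O /\ szlenk_derived (X:=Z) d a = set0]
             `|` [set omega1]) in zP.
have {zP} z0 : szlenk_derived (X:=Z) d (szlenk_eps Z d) = set0.
  case: zP => [[]//|zE]; exfalso.
  by move: zd; rewrite /szlenk_eps zE leNgt omega_lt_omega1.
apply: contrapT => nex.
have fex n : exists f, wdern n (d + d)%R (dball (Z := Z)) f.
  apply: contrapT => nf; apply: nex; exists n; apply/seteqP; split => // f fn.
  by apply: nf; exists f; exact: wdern_eps_mono dd _ fn.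
pose u n := sval (cid (fex n)); have uP n : wdern n (d + d)%R dball (u n) := svalP (cid (fex n)).
have [|f [uf _]] := @wscvg_ex _ Z u 1%R; first by move=> n; exact: wdern_sub (uP n).
have fP n : wdern n (d + d)%R dball f.
  apply: (wdern_closed _ uf); apply: filterS (ufil_ge n) => m nm /=.
  exact: wdern_leq nm _ (uP m).
have fa a : a < omega -> szlenk_derived d a f.
  by move=> /(wdern_szlenk d Zs)[n]; apply.
have : szlenk_derived d (szlenk_eps Z d) f.
  move: zd; rewrite le_eqVlt => /predU1P[->|/fa//].
  by rewrite (szlenk_derived_limitE Z d omega_limit).
by rewrite z0.
Qed.

End SzlenkDerivation.

(** * Separability and reflexivity *)

Section Span.
Context {R : realType}.

Definition lincomb (V : normedModType R) T (e : T -> V) (l : seq (R * T)) : V :=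
  \sum_(i <- l) i.1 *: e i.2.

Lemma lincomb_ratr (V : normedModType R) T (e : T -> V) (l : seq (R * T)) (d : R) : 0 < d ->
  exists l' : seq (rat * T),
    `|lincomb e l - lincomb e [seq (ratr i.1, i.2) | i <- l']| < d.
Proof.
elim: l d => [|[a t] l IH] d d0; first by exists [::]; rewrite subrr normr0.
have d2 : 0 < d / 2 by rewrite divr_gt0.
have [l' l'P] := IH _ d2.
have et : 0 < `|e t| + 1 by rewrite ltr_wpDl.
have [|q] := @rat_in_itvoo R (a - d / 2 / (`|e t| + 1)) (a + d / 2 / (`|e t| + 1)).
  by rewrite ltrD2l gtrN// divr_gt0.
rewrite in_itv/= -ltr_distl distrC => qP.
exists ((q, t) :: l'); rewrite /lincomb/= !big_cons/= opprD addrACA -scalerBl.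
rewrite (le_lt_trans (ler_normD _ _))// normrZ [ltRHS](splitr d) ler_ltD//.
apply: (@le_trans _ _ (`|a - ratr q| * (`|e t| + 1))); first by rewrite ler_wpM2l// lerDl.
by rewrite -ler_pdivlMr// ltW.
Qed.

Lemma span_separable (V : completeNormedModType R) (T : countType) (e : T -> V) :
  (forall v (d : R), 0 < d -> exists l, `|v - lincomb e l| < d) -> separable V.
Proof.
move=> ed; apply: (@seq_separable R V (seq (rat * T))
  (fun l => lincomb e [seq (ratr i.1, i.2) | i <- l])) => v d d0.
have d2 : 0 < d / 2 by rewrite divr_gt0.
have [l lP] := ed v _ d2; have [l' l'P] := @lincomb_ratr V T e l _ d2.
exists l'; rewrite (le_lt_trans (@dist_triangle _ _ _ _ (lincomb e l)))//.
by rewrite [ltRHS](splitr d) ltrD// distrC.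
Qed.

End Span.

Section DistSpan.
Context {R : realType} (V : normedModType R) (T : Type) (e : T -> V).

Definition span_dist (v : V) : R := inf [set `|v - lincomb e l| | l in setT].

Lemma span_dist_has_inf v : has_inf [set `|v - lincomb e l| | l in setT].
Proof. by split; [exists `|v - lincomb e [::]|, [::]|exists 0 => _ [l _ <-]]. Qed.

Lemma span_dist_le v l : span_dist v <= `|v - lincomb e l|.
Proof. by apply: ge_inf; [exact: (span_dist_has_inf v).2|exists l]. Qed.

Lemma span_dist_approx v (d : R) : 0 < d -> exists l, `|v - lincomb e l| < span_dist v + d.
Proof.
by move=> d0; have [_ [l _ <-] lP] := inf_adherent d0 (span_dist_has_inf v); exists l.
Qed.

Lemma lincomb_cat l l' : lincomb e (l ++ l') = lincomb e l + lincomb e l'.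
Proof. by rewrite /lincomb big_cat. Qed.

Lemma lincombZ a l : lincomb e [seq (a * i.1, i.2) | i <- l] = a *: lincomb e l.
Proof. by rewrite /lincomb big_map scaler_sumr; apply: eq_bigr => i _; rewrite scalerA. Qed.

Lemma span_distD u v : span_dist (u + v) <= span_dist u + span_dist v.
Proof.
apply/ler_addgt0Pr => d d0; have d2 : 0 < d / 2 by rewrite divr_gt0.
have [l lP] := span_dist_approx u d2; have [l' l'P] := span_dist_approx v d2.
apply: (le_trans (span_dist_le _ (l ++ l'))); rewrite lincomb_cat opprD addrACA.
apply: (le_trans (ler_normD _ _)); rewrite (splitr d) addrACA.
by apply: lerD; exact: ltW.
Qed.

Lemma span_dist_ge0 v : 0 <= span_dist v.
Proof. by apply: lb_le_inf; [exact: (span_dist_has_inf v).1|move=> _ [l _ <-]]. Qed.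

Lemma span_distZ a v : span_dist (a *: v) = `|a| * span_dist v.
Proof.
have le b w : span_dist (b *: w) <= `|b| * span_dist w.
  apply/ler_addgt0Pr => d d0; have b0 : 0 < `|b| + 1 by rewrite ltr_wpDl.
  have [|l lP] := @span_dist_approx w (d / (`|b| + 1)); first by rewrite divr_gt0.
  apply: (le_trans (span_dist_le _ [seq (b * i.1, i.2) | i <- l])).
  rewrite lincombZ -scalerBr normrZ.
  apply: (@le_trans _ _ (`|b| * (span_dist w + d / (`|b| + 1)))).
    by rewrite ler_wpM2l// ltW.
  rewrite mulrDr lerD2l mulrCA ler_piMr ?(ltW d0)//.
  by rewrite ler_pdivrMr// mul1r lerDl.
apply/eqP; rewrite eq_le le /=.
have [->|a0] := eqVneq a 0; first by rewrite normr0 mul0r span_dist_ge0.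
rewrite -ler_pdivlMl ?normr_gt0// -normfV.
by rewrite -{1}[v](scalerK a0) le.
Qed.

Lemma span_dist_norm v : span_dist v <= `|v|.
Proof. by apply: (le_trans (span_dist_le v [::])); rewrite /lincomb big_nil subr0. Qed.

Lemma span_dist0 t : span_dist (e t) = 0.
Proof.
apply/eqP; rewrite eq_le span_dist_ge0 andbT.
apply: (le_trans (span_dist_le _ [:: (1, t)])).
by rewrite /lincomb big_seq1 scale1r subrr normr0.
Qed.

End DistSpan.

Section Reflexive.
Context {R : realType} (X : completeNormedModType R).
Hypothesis Xr : reflexive_space X.

Lemma reflexive_wcvg (u : nat -> X) (M : R) : (forall n, `|u n| <= M) ->
  exists x : X, (forall f : dual X, (fun n => f (u n) : R) @ ufil --> (f x : R)).
Proof.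
move=> uM.
pose F n := sval (cid (@eval_dual R X (u n))).
have FP n : (forall f, F n f = f (u n)) /\ `|F n| <= `|u n| := svalP (cid (@eval_dual R X (u n))).
have [|G [FG _]] := @wscvg_ex R (dual X) F M.
  by move=> n; exact: le_trans (FP n).2 (uM n).
have [x xP] := Xr G; exists x => f; rewrite -xP.
have -> : (fun n => f (u n) : R) = (fun n => F n f : R) by apply/funext => n; rewrite (FP n).1.
exact: FG.
Qed.

(** Norming functionals of a dense sequence have dense span. Otherwise some nonzero functional on
    the dual vanishes on all of them; by reflexivity it is a point [x] with [f n x = 0] for every n,
    and then [|z n| <= |x - z n|] for [z n] close to [x], which forces [x = 0]. *)
Lemma separable_dual : separable X -> separable (dual X).
Proof.
move=> /separable_seq[z zd].
pose f n := sval (cid (hahn_banach_norming (z n))).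
have fP n : `|f n| <= 1 /\ f n (z n) = `|z n| := svalP (cid (hahn_banach_norming (z n))).
apply: (@span_separable _ _ _ f) => v d d0; apply: contrapT => nl.
have dv : d <= span_dist f v.
  apply: lb_le_inf; first exact: (span_dist_has_inf f v).1.
  move=> _ [l _ <-]; rewrite leNgt; apply/negP => vl; apply: nl; by exists l.
have [F [Fs Fv]] := hahn_banach (span_distD f) (span_distZ f) (span_dist_norm f) v.
have [x xP] := Xr F.
have x0 : x = 0.
  apply/eqP; rewrite -normr_le0 leNgt; apply/negP => x0.
  have x4 : 0 < `|x| / 4 by rewrite divr_gt0.
  have [n xn] := zd x _ x4.
  have fx : f n x = 0.
    rewrite -xP; apply/eqP; rewrite -normr_le0.
    by apply: (le_trans (Fs _)); rewrite span_dist0.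
  have : `|z n| <= `|x - z n|.
    rewrite -(fP n).2 -[f n (z n)]subr0 -fx -linearB distrC.
    apply: (le_trans (ler_norm _)); apply: (le_trans (dual_ub _ _)).
    by rewrite ler_piMl// (fP n).1.
  have : `|x| <= `|x - z n| + `|z n| by rewrite -{1}(subrK (z n) x) ler_normD.
  move: xn; move: (`|x - z n|) (`|z n|) (`|x|) x0 => a b c; lra.
have : 0 < F v by rewrite Fv (lt_le_trans d0).
by rewrite xP x0 linear0 ltxx.
Qed.

End Reflexive.

(** * Markushevich bases *)

Section MBasis.
Context {R : realType} (X : normedModType R).
Local Notation Y := (dual X).

Variables (f : nat -> Y) (z : nat -> X).
Hypothesis fd : forall v (e : R), 0 < e -> exists n, `|v - f n| < e.
Hypothesis zd : forall v (e : R), 0 < e -> exists n, `|v - z n| < e.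

Definition resY (s : seq (Y * X)) (v : Y) : Y := v - \sum_(p <- s) (v p.2 : R) *: p.1.
Definition resX (s : seq (Y * X)) (v : X) : X := v - \sum_(p <- s) (p.1 v : R) *: p.2.

(* Gram-Schmidt, alternating between the two dense sequences; (0, 0) is added
   when the vector to be orthogonalised is already in the span. *)
Definition mb_new (n : nat) (s : seq (Y * X)) : Y * X :=
  if odd n then
    let x := resX s (z n./2) in
    if x == 0 then (0, 0) else (resY s (xget 0 [set y : Y | y x = 1]), x)
  else
    let y := resY s (f n./2) in
    if y == 0 then (0, 0) else (y, resX s (xget 0 [set x : X | y x = 1])).

Fixpoint mb_hist n : seq (Y * X) :=
  if n is m.+1 then mb_new m (mb_hist m) :: mb_hist m else [::].

Definition mbasis n := mb_new n (mb_hist n).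

Lemma mb_hist_sum (V : nmodType) (F : Y * X -> V) n :
  \sum_(p <- mb_hist n) F p = \sum_(k < n) F (mbasis k).
Proof.
elim: n => [|n IH]; first by rewrite big_nil big_ord0.
by rewrite big_ord_recr/= big_cons IH addrC.
Qed.

Lemma dual_sumE (I : Type) (r : seq I) (P : pred I) (F : I -> Y) v :
  (\sum_(i <- r | P i) F i) v = \sum_(i <- r | P i) (F i v : R).
Proof.
elim/big_rec2: _ => [//|i a b _ <-]; exact: dualDE.
Qed.

Lemma resYE s v x : resY s v x = v x - \sum_(p <- s) (v p.2 : R) * (p.1 x : R) :> R.
Proof. by rewrite /resY -[LHS]/(v x - (\sum_(p <- s) (v p.2 : R) *: p.1) x) dual_sumE. Qed.

Lemma resXE s v (y : Y) : y (resX s v) = y v - \sum_(p <- s) (p.1 v : R) * (y p.2 : R) :> R.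
Proof.
rewrite /resX linearB/= linear_sum/=; congr (_ - _).
by apply: eq_bigr => p _; rewrite linearZ.
Qed.

(** The second alternative admits the zero pairs inserted by [mb_new]: at such an index the
    functional and the vector vanish together. *)
Definition biorth (s : nat -> Y * X) n := forall k l, (k < n)%N -> (l < n)%N ->
  (k != l -> (s k).1 (s l).2 = 0) /\
  ((s k).1 (s k).2 = 1 \/ ((s k).1 = 0 /\ (s k).2 = 0)).

Lemma resY_orth n v l : biorth mbasis n -> (l < n)%N -> resY (mb_hist n) v (mbasis l).2 = 0.
Proof.
move=> bn ln; rewrite resYE mb_hist_sum.
rewrite (bigD1 (Ordinal ln))//= big1 => [|k kl].
  have [_ [b1|[b1 b2]]] := bn l l ln ln.
    by rewrite b1 mulr1 addr0 subrr.
  by rewrite b2 !linear0 mulr0 addr0 subr0.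
by rewrite (bn k l (ltn_ord k) ln).1 ?mulr0.
Qed.

Lemma resX_orth n v l : biorth mbasis n -> (l < n)%N -> (mbasis l).1 (resX (mb_hist n) v) = 0.
Proof.
move=> bn ln; rewrite resXE mb_hist_sum.
rewrite (bigD1 (Ordinal ln))//= big1 => [|k kl].
  have [_ [b1|[b1 b2]]] := bn l l ln ln.
    by rewrite b1 mulr1 addr0 subrr.
  by rewrite b1 mulr0 addr0 subr0.
by rewrite (bn l k ln (ltn_ord k)).1 ?mulr0// eq_sym.
Qed.

Lemma norming_one (x : X) : x != 0 -> exists y : Y, y x = 1.
Proof.
move=> x0; have [y [_ yx]] := hahn_banach_norming x.
by exists (`|x|^-1 *: y); rewrite dualZE yx /GRing.scale/= mulVf ?normr_eq0.
Qed.

Lemma dual_neq0 (y : Y) : y != 0 -> exists x : X, y x = 1.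
Proof.
move=> y0; have [x yx] : exists x, y x != 0.
  apply: contrapT => nx; move/eqP: y0; apply; apply/val_inj/funext => x.
  by apply/eqP; apply: contrapT => /negP ?; apply: nx; exists x.
by exists ((y x : R)^-1 *: x); rewrite linearZ/= /GRing.scale/= mulVf.
Qed.

Lemma mbasis_biorth n : biorth mbasis n.
Proof.
elim: n => [//|n IH].
have new : [/\ forall l, (l < n)%N -> (mbasis n).1 (mbasis l).2 = 0,
  forall l, (l < n)%N -> (mbasis l).1 (mbasis n).2 = 0 &
  (mbasis n).1 (mbasis n).2 = 1 \/ ((mbasis n).1 = 0 /\ (mbasis n).2 = 0)].
  suff H p : p = mbasis n -> [/\ forall l, (l < n)%N -> p.1 (mbasis l).2 = 0,
      forall l, (l < n)%N -> (mbasis l).1 p.2 = 0 &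
      p.1 p.2 = 1 \/ (p.1 = 0 /\ p.2 = 0)] by exact: H.
  rewrite /mbasis /mb_new; case: ifP => on.
    case: ifPn => [_ ->|x0 ->]; first by split => [l _|l _|]; rewrite ?linear0//; right.
    case: xgetP => [y _ yx|/(_ _)]; last first.
      by have [y yx] := norming_one x0; move=> /(_ y) /(_ yx).
    split=> [l ln|l ln|]; [exact: resY_orth|exact: resX_orth|left=> /=].
    change ((resY (mb_hist n) y (resX (mb_hist n) (z n./2)) : R) = 1).
    by rewrite resYE mb_hist_sum yx big1 ?subr0// => k _; rewrite resX_orth ?mulr0.
  case: ifPn => [_ ->|y0 ->]; first by split => [l _|l _|]; rewrite ?linear0//; right.
  case: xgetP => [x _ yx|/(_ _)]; last first.
    by have [x yx] := dual_neq0 y0; move=> /(_ x) /(_ yx).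
  split=> [l ln|l ln|]; [exact: resY_orth|exact: resX_orth|left=> /=].
  change ((resY (mb_hist n) (f n./2) (resX (mb_hist n) x) : R) = 1).
  by rewrite resXE mb_hist_sum yx big1 ?subr0// => k _; rewrite resY_orth ?mul0r ?mulr0.
case: new => n1 n2 n3 k l; rewrite !ltnS => kn ln; split.
  move: kn ln; rewrite leq_eqVlt => /predU1P[->|kn]; rewrite leq_eqVlt => /predU1P[->|ln].
  - by rewrite eqxx.
  - by move=> _; exact: n1.
  - by move=> _; exact: n2.
  - by move=> kl; have [h _] := IH k l kn ln; exact: h.
move: kn; rewrite leq_eqVlt => /predU1P[->//|kn].
by have [_ h] := IH k k kn kn.
Qed.

(** Step [i.*2] either adds the residual of [f i] or finds it zero; in both cases [f i] lies in the
    span of the first [i.*2.+1] functionals. *)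
Lemma mbasis_denseY v (e : R) : 0 < e -> exists n (c : nat -> R),
  `|v - \sum_(k < n) c k *: (mbasis k).1| < e.
Proof.
move=> /(fd v)[i vi]; pose n := i.*2; exists n.+1.
have on : odd n = false by rewrite odd_double.
have ni : n./2 = i by rewrite /n doubleK.
exists (fun k => if k == n then 1 else f i (mbasis k).2 : R).
rewrite big_ord_recr/= eqxx scale1r.
rewrite (_ : \sum_(k < n) _ = \sum_(k < n) (f i (mbasis k).2 : R) *: (mbasis k).1); last first.
  by apply: eq_bigr => k _; rewrite (ltn_eqF (ltn_ord k)).
suff -> : (mbasis n).1 = f i - \sum_(k < n) (f i (mbasis k).2 : R) *: (mbasis k).1 by rewrite addrC subrK.
rewrite -(mb_hist_sum (fun p => (f i p.2 : R) *: p.1)) -/(resY _ _) {1}/mbasis /mb_new on ni.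
by case: eqP => [->|].
Qed.

Lemma mbasis_denseX v (e : R) : 0 < e -> exists n (c : nat -> R),
  `|v - \sum_(k < n) c k *: (mbasis k).2| < e.
Proof.
move=> /(zd v)[i vi]; pose n := i.*2.+1; exists n.+1.
have on : odd n by rewrite /n/= odd_double.
have ni : n./2 = i by rewrite /n/= uphalf_double.
exists (fun k => if k == n then 1 else (mbasis k).1 (z i) : R).
rewrite big_ord_recr/= eqxx scale1r.
rewrite (_ : \sum_(k < n) _ = \sum_(k < n) ((mbasis k).1 (z i) : R) *: (mbasis k).2); last first.
  by apply: eq_bigr => k _; rewrite (ltn_eqF (ltn_ord k)).
suff -> : (mbasis n).2 = z i - \sum_(k < n) ((mbasis k).1 (z i) : R) *: (mbasis k).2 by rewrite addrC subrK.
rewrite -(mb_hist_sum (fun p => (p.1 (z i) : R) *: p.2)) -/(resX _ _) {1}/mbasis /mb_new on ni.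
by case: eqP => [->|].
Qed.

End MBasis.

(** * Estimates for skipped blocks *)

Section Strategy.
Context {R : realType} (X : normedModType R).
Local Notation Y := (dual X).
Variable b : nat -> Y * X.
Hypothesis bi : forall n, biorth b n.
Hypothesis dY : forall v (e : R), 0 < e -> exists n (c : nat -> R),
  `|v - \sum_(k < n) c k *: (b k).1| < e.
Hypothesis dX : forall v (e : R), 0 < e -> exists n (c : nat -> R),
  `|v - \sum_(k < n) c k *: (b k).2| < e.
Hypothesis Xr : forall phi : dual Y, exists x : X, forall f : Y, phi f = f x.

Definition mcoord (v : Y) k : R := v (b k).2.
(** Partial sum operator of the basis. No bound uniform in [m] is available, so norm control of
    truncations comes from compactness below. *)
Definition bproj m (v : Y) : Y := \sum_(k < m) mcoord v k *: (b k).1.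
Definition inH m (v : Y) := bproj m v = v.
Definition annih m (v : Y) := forall k, (k < m)%N -> mcoord v k = 0.

Lemma mcoordD v w k : mcoord (v + w) k = mcoord v k + mcoord w k. Proof. by []. Qed.
Lemma mcoordB v w k : mcoord (v - w) k = mcoord v k - mcoord w k. Proof. by []. Qed.
Lemma mcoordZ a v k : mcoord (a *: v) k = a * mcoord v k. Proof. by []. Qed.
Lemma mcoord0 k : mcoord 0 k = 0. Proof. by []. Qed.

Lemma mcoord_sum (c : nat -> R) m k :
  mcoord (\sum_(l < m) c l *: (b l).1) k = if (k < m)%N then c k * mcoord (b k).1 k else 0.
Proof.
rewrite /mcoord dual_sumE.
have zero l : l != k -> ((c l *: (b l).1) (b k).2 : R) = 0.
  move=> lk; rewrite -[LHS]/(c l * ((b l).1 (b k).2 : R)).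
  have [] := @bi (maxn l k).+1 l k; rewrite ?ltnS ?leq_maxl ?leq_maxr//.
  by move=> -> //; rewrite mulr0.
case: ifP => km; last by rewrite big1 // => l _; apply: zero; rewrite neq_ltn; have := ltn_ord l; lia.
rewrite (bigD1 (Ordinal km))//= big1 ?addr0// => l lk; exact: zero.
Qed.

Lemma mcoord_self v k : mcoord v k * mcoord (b k).1 k = mcoord v k.
Proof.
have [_ [h|[_ h]]] := @bi k.+1 k k (ltnSn k) (ltnSn k).
by rewrite {2}/mcoord h mulr1.
by rewrite /mcoord h !linear0 mulr0.
Qed.

Lemma bproj_mcoord m v k : mcoord (bproj m v) k = if (k < m)%N then mcoord v k else 0.
Proof. by rewrite mcoord_sum mcoord_self. Qed.

Lemma bprojD m v w : bproj m (v + w) = bproj m v + bproj m w.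
Proof. by rewrite /bproj -big_split; apply: eq_bigr => k _; rewrite mcoordD scalerDl. Qed.

Lemma bprojZ m a v : bproj m (a *: v) = a *: bproj m v.
Proof. by rewrite /bproj scaler_sumr; apply: eq_bigr => k _; rewrite mcoordZ scalerA. Qed.

Lemma bprojN m v : bproj m (- v) = - bproj m v.
Proof. by rewrite -scaleN1r bprojZ scaleN1r. Qed.

Lemma bproj0 m : bproj m 0 = 0.
Proof. by rewrite /bproj big1// => k _; rewrite mcoord0 scale0r. Qed.

Lemma bproj_annih m v : annih m v -> bproj m v = 0.
Proof. by move=> av; rewrite /bproj big1// => k _; rewrite av ?scale0r. Qed.

Lemma inH_comb (c : nat -> R) m : inH m (\sum_(k < m) c k *: (b k).1).
Proof.
rewrite /inH /bproj; apply: eq_bigr => k _; rewrite mcoord_sum ltn_ord.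
have [_ [h|[h _]]] := @bi k.+1 k k (ltnSn k) (ltnSn k); last by rewrite h !scaler0.
by rewrite /mcoord h mulr1.
Qed.

Lemma inH_bproj m v : inH m (bproj m v).
Proof. exact: inH_comb. Qed.

Lemma inHD m v w : inH m v -> inH m w -> inH m (v + w).
Proof. by rewrite /inH bprojD => -> ->. Qed.

Lemma inHN m v : inH m v -> inH m (- v).
Proof. by rewrite /inH bprojN => ->. Qed.

Lemma inHB m v w : inH m v -> inH m w -> inH m (v - w).
Proof. by move=> ? ?; apply: inHD => //; exact: inHN. Qed.

Lemma inHZ m a v : inH m v -> inH m (a *: v).
Proof. by rewrite /inH bprojZ => ->. Qed.

Lemma inH0 m : inH m 0.
Proof. exact: bproj0. Qed.

Lemma inH_mcoord m v k : inH m v -> (m <= k)%N -> mcoord v k = 0.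
Proof. by move=> <- mk; rewrite bproj_mcoord ltnNge mk. Qed.

Lemma inH_mono m n v : (m <= n)%N -> inH m v -> inH n v.
Proof.
move=> mn vm; rewrite /inH -[RHS]vm /bproj -(subnKC mn) big_split_ord/=.
rewrite [X in _ + X]big1 ?addr0// => k _.
by rewrite (inH_mcoord vm) ?leq_addr// scale0r.
Qed.

Lemma inH_sum (I : Type) (r : seq I) (P : pred I) (F : I -> Y) m :
  (forall i, P i -> inH m (F i)) -> inH m (\sum_(i <- r | P i) F i).
Proof. by move=> FH; elim/big_rec: _ => [|i x Pi xH]; [exact: inH0|apply: inHD => //; exact: FH]. Qed.

Lemma inH_dense v (e : R) : 0 < e -> exists m s, inH m s /\ `|v - s| < e.
Proof. by move=> /(dY v)[m [c mc]]; exists m; eexists; split; [exact: inH_comb|exact: mc]. Qed.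

Lemma annih_mono m n v : (m <= n)%N -> annih n v -> annih m v.
Proof. by move=> mn vn k km; apply: vn; exact: leq_trans mn. Qed.

Lemma annihD m v w : annih m v -> annih m w -> annih m (v + w).
Proof. by move=> va wa k km; rewrite mcoordD va ?wa ?addr0. Qed.

Lemma annih_sum (I : Type) (r : seq I) (P : pred I) (F : I -> Y) m :
  (forall i, P i -> annih m (F i)) -> annih m (\sum_(i <- r | P i) F i).
Proof. by move=> FH; elim/big_rec: _ => [//|i x Pi xH]; apply: annihD => //; exact: FH. Qed.

Lemma mcoord_eq0 (v : Y) : (forall k, mcoord v k = 0) -> v = 0.
Proof.
move=> vk; apply: dual_ext => x; apply/eqP; rewrite -normr_le0.
apply/ler_addgt0Pr => e e0; rewrite add0r.
have e1 : 0 < e / (`|v| + 1) by rewrite divr_gt0// ltr_wpDl.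
have [n [c xc]] := dX x e1.
have -> : v x = v (x - \sum_(k < n) c k *: (b k).2).
  rewrite linearB/= linear_sum/= big1 ?subr0// => k _.
  by rewrite linearZ/= [v _]vk /GRing.scale/= mulr0.
apply: (le_trans (dual_ub _ _)).
apply: (@le_trans _ _ ((`|v| + 1) * (e / (`|v| + 1)))).
  by apply: ler_pM => //; [rewrite lerDl|exact: ltW].
by rewrite mulrC divfK// gt_eqF// ltr_wpDl.
Qed.

Lemma mcoord_cvg (u : nat -> Y) v k : wscvg u v -> (fun n => mcoord (u n) k) @ ufil --> mcoord v k.
Proof. by move=> uv; exact: uv. Qed.

Lemma wscvg_annih (u : nat -> Y) v : (forall n, annih n (u n)) -> wscvg u v -> v = 0.
Proof.
move=> ua uv; apply: mcoord_eq0 => k; apply: (ucvg_unique (@mcoord_cvg u v k uv)).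
apply/cvgrPdist_lt => d d0; apply: filterS (ufil_ge k.+1) => n /= kn.
by rewrite ua// subrr normr0.
Qed.

(** A finite-rank operator given by points of X turns w*-convergence into norm convergence. *)
Lemma bproj_cvg m (u : nat -> Y) v (e : R) : wscvg u v -> 0 < e ->
  ufil [set n | `|bproj m (u n) - bproj m v| < e].
Proof.
move=> uv; rewrite /bproj; elim: m e => [|m IH] e e0.
  by apply: filterE => n /=; rewrite !big_ord0 subrr normr0.
have e2 : 0 < e / 2 by rewrite divr_gt0.
have bm : 0 < `|(b m).1| + 1 by rewrite ltr_wpDl.
have e3 : 0 < e / 2 / (`|(b m).1| + 1) by rewrite divr_gt0.
apply: filterS2 (IH _ e2) (ucvgr_near (uv (b m).2) e3) => n /= h1 h2.
rewrite !big_ord_recr/= opprD addrACA -scalerBl (le_lt_trans (ler_normD _ _))//.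
rewrite [ltRHS](splitr e) ltr_leD// normrZ distrC.
apply: (@le_trans _ _ (`|v (b m).2 - u n (b m).2 : R| * (`|(b m).1| + 1))).
  by rewrite ler_wpM2l// lerDl.
by rewrite -ler_pdivlMr// ltW.
Qed.

Definition thick (eta : R) (K : set Y) : set Y := [set v | exists2 g, K g & `|v - g| <= eta].

Lemma thick_le eta eta' K : eta <= eta' -> thick eta K `<=` thick eta' K.
Proof. by move=> ee v [g Kg vg]; exists g => //; exact: le_trans ee. Qed.

(** By contradiction, with bad [f n], [u n], [g n] for every n. The [f n] converge in norm, as they
    stay in one finite-dimensional span, and [u n] tends to 0 in the w*-sense; so the limit of the
    [g n] is as close to the limit of the [f n] as the tolerances allow. If [|u n| >= 2 * eps] for
    many n, the [g n] keep distance [eps] from their limit, which therefore survives one more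
    derivation. *)
Lemma lower_step (eps theta : R) r m : 0 < eps -> 0 < theta ->
  exists n, forall eta f u, 0 <= eta -> eta <= eps / 4 -> inH m f -> annih n u ->
    thick eta (wdern r eps dball) (f + u) ->
    thick (eta + theta) (wdern r eps dball) f /\
    (2 * eps <= `|u| -> thick (eta + theta) (wdern r.+1 eps dball) f).
Proof.
move=> eps0 th0; apply: contrapT => nex.
have bad n : exists t : R * Y * Y * Y, [/\ 0 <= t.1.1.1 <= eps / 4, inH m t.1.1.2,
    annih n t.1.2, wdern r eps dball t.2 /\ `|t.1.1.2 + t.1.2 - t.2| <= t.1.1.1 &
    ~ (thick (t.1.1.1 + theta) (wdern r eps dball) t.1.1.2 /\
    (2 * eps <= `|t.1.2| -> thick (t.1.1.1 + theta) (wdern r.+1 eps dball) t.1.1.2))].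
  apply: contrapT => nt; apply: nex; exists n => eta f u e0 e1 fH un [g gD fug].
  by apply: contrapT => no; apply: nt; exists (eta, f, u, g); rewrite /= e0 e1.
pose t n := sval (cid (bad n)); have tP n := svalP (cid (bad n)).
pose eta n := (t n).1.1.1; pose f n := (t n).1.1.2; pose u n := (t n).1.2; pose g n := (t n).2.
have etaP n : 0 <= eta n <= eps / 4 by have [] := tP n.
have fP n : inH m (f n) by have [] := tP n.
have uP n : annih n (u n) by have [] := tP n.
have gP n : wdern r eps dball (g n) by have [_ _ _ []] := tP n.
have fugP n : `|f n + u n - g n| <= eta n by have [_ _ _ []] := tP n.
have noP n : ~ (thick (eta n + theta) (wdern r eps dball) (f n) /\
    (2 * eps <= `|u n| -> thick (eta n + theta) (wdern r.+1 eps dball) (f n))).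
  by have [] := tP n.
have g1 n : `|g n| <= 1 := wdern_sub (gP n).
have eta4 n : eta n <= eps / 4 by have /andP[] := etaP n.
have [|eta' etac] := @ucvg_bounded R eta (eps / 4).
  by move=> n; have /andP[? ?] := etaP n; rewrite ger0_norm.
have [g' [gg' _]] := wscvg_ex g1.
have e1 n : `|f n + u n - g n| <= eps / 4 by exact: le_trans (fugP n) (eta4 n).
have [e' [ee' _]] := wscvg_ex e1.
have vv' : wscvg (fun n => f n + u n) (g' + e').
  have -> : (fun n => f n + u n) = g \+ (fun n => f n + u n - g n).
    by apply/funext => n; rewrite /= [RHS]addrC subrK.
  exact: wscvgD.
have Pf n : (m <= n)%N -> bproj m (f n + u n) = f n.
  by move=> mn; rewrite bprojD fP bproj_annih ?addr0//; exact: annih_mono mn (uP n).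
pose f' := bproj m (g' + e').
have ff' d : 0 < d -> ufil [set n | `|f n - f'| < d].
  move=> d0; apply: filterS2 (ufil_ge m) (bproj_cvg m vv' d0) => n mn.
  by rewrite /= Pf.
have fw : wscvg f f' := norm_wscvg ff'.
have uw : wscvg u (g' + e' - f').
  have -> : u = (fun n => f n + u n) \- f by apply/funext => n; rewrite /= addrAC subrr add0r.
  exact: wscvgB.
have {uw} f'E : g' + e' = f'.
  by apply/eqP; rewrite -subr_eq0; apply/eqP; exact: wscvg_annih uw.
have etaD d : 0 < d -> ufil [set n | eta n <= eta' + d].
  move=> d0; apply: filterS (ucvgr_near etac d0) => n /=.
  by rewrite ltr_distlC => /andP[_ /ltW].
have etaB d : 0 < d -> ufil [set n | eta' <= eta n + d].
  move=> d0; apply: filterS (ucvgr_near etac d0) => n /=.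
  by rewrite ltr_distl => /andP[_ /ltW].
have eta'0 : 0 <= eta' by apply: (ucvg_ge etac); apply: filterE => n; have /andP[] := etaP n.
have eta'4 : eta' <= eps / 4 by apply: (ucvg_le etac); apply: filterE => n /=.
have e'n : `|e'| <= eta'.
  apply/ler_addgt0Pr => d d0; apply: (wscvg_norm _ ee'); first by rewrite addr_ge0// ltW.
  by apply: filterS (etaD d d0) => n /=; apply: le_trans.
have g'D : wdern r eps dball g' by apply: wdern_closed gg'; exact: filterE.
have g'f' : `|g' - f'| <= eta' by rewrite -f'E opprD addrA subrr add0r normrN.
have th4 : 0 < theta / 4 by rewrite divr_gt0.
have eps8 : 0 < eps / 8 by rewrite divr_gt0.
have fg : ufil [set n | `|f n - g'| <= eta n + theta].
  apply: filterS2 (ff' _ th4) (etaB _ th4) => n /= h1 h2.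
  apply: (le_trans (@dist_triangle _ _ _ _ f')).
  by move: h1 h2 g'f' th0; move: (`|f n - f'|) (`|g' - f'|) => p q; lra.
have [big|small] := ufilVC [set n | 2 * eps <= `|u n|]; last first.
  have [n [h1 h2]] := filter_ex (filterI small fg).
  by apply: (noP n); split; [exists g'|by move=> /h1].
(* [2 * eps] minus two tolerances [eps / 4] and the approximation error [eps / 8] still exceeds
   [eps]. *)
have gD : wdern r.+1 eps dball g'.
  apply: (wder_lim (@wdern_closed _ _ _ _) _ gg'); first exact: filterE.
  apply: filterS2 big (ff' _ eps8) => n /= h1 h2.
  have uE : u n = f n + u n - f n by rewrite addrAC subrr add0r.
  have t1 := @dist_triangle _ _ (f n + u n) (f n) (g n).
  have t2 := @dist_triangle _ _ (f n) (g n) g'.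
  have t3 := @dist_triangle _ _ (f n) g' f'.
  rewrite -uE in t1.
  move: h1 h2 t1 t2 t3 (e1 n) (le_trans g'f' eta'4).
  move: (`|u n|) (`|g n - g'|) (`|f n + u n - g n|) (`|f n - f'|) (`|f n - g n|) (`|f n - g'|) (`|g' - f'|).
  by move=> p1 p2 p3 p4 p5 p6 p7; lra.
have [n h2] := filter_ex fg.
by apply: (noP n); split; [exists g'|exists g'].
Qed.

(** The derived sets are now those of the ball of the bidual. Along a bad sequence [phi n] tends to
    some [psi], a point of X by reflexivity, so [psi (v n)] tends to 0. Dropping [v] then costs
    about the distance from [phi n] to [psi]: less than [eps], or else at most 2 while [psi] lies
    one derivation deeper. *)
Lemma upper_step (eps delta B : R) r m : 0 < eps -> 0 < delta ->
  exists n, forall (y v : Y) (phi : dual Y), inH m y -> `|y| <= B -> annih n v -> `|v| <= 1 ->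
    wdern r eps dball phi -> exists psi : dual Y,
    (wdern r eps dball psi /\ phi (y + v) <= psi y + (eps + delta)) \/
    (wdern r.+1 eps dball psi /\ phi (y + v) <= psi y + (2 + delta)).
Proof.
move=> eps0 d0; apply: contrapT => nex.
have bad n : exists t : Y * Y * dual Y, [/\ inH m t.1.1 /\ `|t.1.1| <= B,
    annih n t.1.2, `|t.1.2| <= 1, wdern r eps dball t.2 &
    ~ exists psi : dual Y,
    (wdern r eps dball psi /\ t.2 (t.1.1 + t.1.2) <= psi t.1.1 + (eps + delta)) \/
    (wdern r.+1 eps dball psi /\ t.2 (t.1.1 + t.1.2) <= psi t.1.1 + (2 + delta))].
  apply: contrapT => nt; apply: nex; exists n => y v phi yH yB va v1 phiD.
  by apply: contrapT => no; apply: nt; exists (y, v, phi).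
pose t n := sval (cid (bad n)); have tP n := svalP (cid (bad n)).
pose y n := (t n).1.1; pose v n := (t n).1.2; pose phi n := (t n).2.
have yH n : inH m (y n) by have [[]] := tP n.
have yB n : `|y n| <= B by have [[]] := tP n.
have va n : annih n (v n) by have [] := tP n.
have v1 n : `|v n| <= 1 by have [] := tP n.
have phiD n : wdern r eps dball (phi n) by have [] := tP n.
have noP n : ~ exists psi : dual Y,
    (wdern r eps dball psi /\ phi n (y n + v n) <= psi (y n) + (eps + delta)) \/
    (wdern r.+1 eps dball psi /\ phi n (y n + v n) <= psi (y n) + (2 + delta)).
  by have [] := tP n.
have phi1 n : `|phi n| <= 1 := wdern_sub (phiD n).
have [y' [yy' _]] := wscvg_ex yB.
have [v' [vv' _]] := wscvg_ex v1.
have v'0 : v' = 0 by exact: wscvg_annih vv'.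
have [psi [ppsi psi1]] := wscvg_ex phi1.
pose y2 := bproj m y'.
have d8 : 0 < delta / 8 by rewrite divr_gt0.
have yy2 : ufil [set n | `|y n - y2| < delta / 8].
  by apply: filterS (bproj_cvg m yy' d8) => n /=; rewrite yH.
have psiv : ufil [set n | psi (v n) <= delta / 8].
  have [x xP] := Xr psi.
  have := ucvgr_near (vv' x) d8; apply: filterS => n /=.
  rewrite v'0 sub0r normrN xP => /ltW; apply: le_trans; exact: ler_norm.
have phiy := ucvgr_near (ppsi y2) d8.
have psiD : wdern r eps dball psi by apply: wdern_closed ppsi; exact: filterE.
have key n : `|y n - y2| < delta / 8 -> psi (v n) <= delta / 8 ->
   `|psi y2 - phi n y2| < delta / 8 ->
   phi n (y n + v n) <= psi (y n) + (`|phi n - psi| + delta).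
  move=> h1 h2 h3.
  have e1 : `|phi n (y n - y2)| <= `|y n - y2| by have := dual_ub1 (y n - y2) (phi1 n); rewrite mul1r.
  have e2 : `|psi (y n - y2)| <= `|y n - y2| by have := dual_ub1 (y n - y2) psi1; rewrite mul1r.
  have e3 : `|(phi n - psi) (v n)| <= `|phi n - psi|.
    by apply: (le_trans (dual_ub _ _)); rewrite ler_piMr.
  rewrite linearD/=; rewrite linearB/= in e1; rewrite linearB/= in e2.
  move: e3; rewrite -[(phi n - psi) (v n)]/(phi n (v n) - psi (v n) : R).
  move: h1 h2 h3 e1 e2; move: (`|y n - y2|) (`|phi n - psi|) => p1 p2.
  move: (phi n (y n) : R) (phi n (v n) : R) (psi (y n) : R) (psi (v n) : R) (phi n y2 : R) (psi y2 : R).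
  move=> q1 q2 q3 q4 q5 q6 h1 h2.
  by rewrite ltr_distl !ler_norml => /andP[h3 h4] /andP[h5 h6] /andP[h7 h8] /andP[h9 h10]; lra.
have near := filterI (filterI yy2 psiv) phiy.
have [big|small] := ufilVC [set n | eps <= `|phi n - psi|].
  have psiD1 : wdern r.+1 eps dball psi.
    by apply: (wder_lim (@wdern_closed _ _ _ _) _ ppsi) => //; exact: filterE.
  have [n [[h1 h2] h3]] := filter_ex (near _ _).
  apply: (noP n); exists psi; right; split => //.
  apply: (le_trans (key n h1 h2 h3)); rewrite lerD2l lerD2r.
  by apply: (le_trans (ler_normB _ _)); rewrite [leRHS](_ : _ = 1 + 1)// lerD.
have [n [[[h1 h2] h3] h4]] := filter_ex (filterI (near _ _) small).
apply: (noP n); exists psi; left; split => //.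
apply: (le_trans (key n h1 h2 h3)); rewrite lerD2l lerD2r.
by have [/h4|/ltW] := leVlt eps `|phi n - psi|.
Qed.

Lemma bounded_choice (Q : nat -> nat -> Prop) :
  (forall i n n', (n <= n')%N -> Q i n -> Q i n') -> (forall i, exists n, Q i n) ->
  forall K, exists n, forall i, (i < K)%N -> Q i n.
Proof.
move=> Qm Qe; elim=> [|K [n nP]]; first by exists 0%N.
have [n' n'P] := Qe K; exists (maxn n n') => i; rewrite ltnS leq_eqVlt => /predU1P[->|iK].
  by apply: Qm n'P; exact: leq_maxr.
by apply: Qm (nP i iK); exact: leq_maxl.
Qed.

(* [skipped next n h v]: the vectors v_0, ..., v_(n-1) are successive blocks of the
   M-basis, the block v_(i+1) starting after next (h i), where v_i ends before h i. *)
Definition skipped (next : nat -> nat) n (h : nat -> nat) (v : nat -> Y) :=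
  [/\ forall i, (i < n)%N -> inH (h i) (v i),
      forall i, (i.+1 < n)%N -> (h i <= h i.+1)%N &
      forall i, (i.+1 < n)%N -> annih (next (h i)) (v i.+1)].

Lemma skipped_partial next n h v i : skipped next n h v -> (i < n)%N ->
  inH (h i) (\sum_(j < i.+1) v j).
Proof.
move=> [vH hm va]; elim: i => [|i IH] iN; first by rewrite big_ord1; exact: vH.
rewrite big_ord_recr/=; apply: inHD; last exact: vH.
by apply: inH_mono (hm i iN) _; apply: IH; exact: ltnW.
Qed.

Definition upper_next (eps : R) MU (B : R) (next : nat -> nat) := forall m r, (r < MU)%N ->
  forall (y v : Y) (phi : dual Y), inH m y -> `|y| <= B -> annih (next m) v -> `|v| <= 1 ->
    wdern r eps dball phi -> exists psi : dual Y,
    (wdern r eps dball psi /\ phi (y + v) <= psi y + (eps + eps)) \/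
    (wdern r.+1 eps dball psi /\ phi (y + v) <= psi y + 3).

(** All scales [2^-1 ^+ k.+1] with [k <= m], and all orders below [ML ^ k.+1], are served by the
    same [next]. The tolerance grows by [2^-1 ^+ m / 32], which is summable along successive
    blocks. *)
Definition lower_next ML (next : nat -> nat) := forall m k r, (k <= m)%N ->
  (r < ML ^ k.+1)%N -> forall eta f u, 0 <= eta -> eta <= 2^-1 ^+ k.+1 / 4 ->
  inH m f -> annih (next m) u ->
  thick eta (wdern r (2^-1 ^+ k.+1) dball) (f + u) ->
  thick (eta + 2^-1 ^+ m / 32) (wdern r (2^-1 ^+ k.+1) dball) f /\
  (2 * 2^-1 ^+ k.+1 <= `|u| -> thick (eta + 2^-1 ^+ m / 32) (wdern r.+1 (2^-1 ^+ k.+1) dball) f).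

Lemma next_ex (eps B : R) MU ML : 0 < eps -> eps <= 1 ->
  exists next, [/\ forall m, (m < next m)%N, {homo next : m n / (m <= n)%N},
    upper_next eps MU B next & lower_next ML next].
Proof.
move=> eps0 eps1.
pose QU m r n := forall (y v : Y) (phi : dual Y), inH m y -> `|y| <= B -> annih n v -> `|v| <= 1 ->
    wdern r eps dball phi -> exists psi : dual Y,
    (wdern r eps dball psi /\ phi (y + v) <= psi y + (eps + eps)) \/
    (wdern r.+1 eps dball psi /\ phi (y + v) <= psi y + 3).
pose QL m k r n := forall eta f u, 0 <= eta -> eta <= 2^-1 ^+ k.+1 / 4 ->
  inH m f -> annih n u ->
  thick eta (wdern r (2^-1 ^+ k.+1) dball) (f + u) ->
  thick (eta + 2^-1 ^+ m / 32) (wdern r (2^-1 ^+ k.+1) dball) f /\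
  (2 * 2^-1 ^+ k.+1 <= `|u| -> thick (eta + 2^-1 ^+ m / 32) (wdern r.+1 (2^-1 ^+ k.+1) dball) f).
have ex m : exists n, (forall r, (r < MU)%N -> QU m r n) /\
    forall k, (k < m.+1)%N -> forall r, (r < ML ^ k.+1)%N -> QL m k r n.
  have [|r|n1 n1P] := @bounded_choice (QU m) _ _ MU.
  - by move=> r n n' nn' Q y v phi yH yB /(annih_mono nn'); exact: Q.
  - have [n nP] := @upper_step eps eps B r m eps0 eps0; exists n => y v phi yH yB va v1 phiD.
    have [psi [[p1 p2]|[p1 p2]]] := nP y v phi yH yB va v1 phiD; exists psi; [by left|right].
    by split => //; apply: (le_trans p2); rewrite lerD2l; lra.
  have [|k|n2 n2P] := @bounded_choice (fun k n => forall r, (r < ML ^ k.+1)%N -> QL m k r n) _ _ m.+1.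
  - by move=> k n n' nn' Q r rM eta f u e0 e1 fH /(annih_mono nn'); exact: (Q r).
  - apply: (@bounded_choice (QL m k) _ _ (ML ^ k.+1)%N).
    + by move=> r n n' nn' Q eta f u e0 e1 fH /(annih_mono nn'); exact: Q.
    + by move=> r; apply: lower_step; rewrite ?divr_gt0// exprn_gt0.
  exists (maxn n1 n2); split.
    by move=> r rM y v phi yH yB /(annih_mono (leq_maxl _ _)); exact: n1P.
  by move=> k km r rM eta f u e0 e1 fH /(annih_mono (leq_maxr _ _)); exact: n2P.
pose N m := sval (cid (ex m)); have NP m := svalP (cid (ex m)).
(* Summing the [N k] instead of taking [N m] makes [next] monotone. *)
pose next m := (m + \sum_(k < m.+1) N k).+1.
have Nn m : (N m <= next m)%N by rewrite /next big_ord_recr/=; lia.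
exists next; split.
- by move=> m; rewrite /next ltnS leq_addr.
- move=> m n mn; rewrite /next ltnS leq_add//.
  by rewrite -(subnKC mn) -addSn big_split_ord/= leq_addr.
- by move=> m r rM y v phi yH yB /(annih_mono (Nn m)); exact: (NP m).1.
- move=> m k r km rM eta f u e0 e1 fH /(annih_mono (Nn m)); exact: (NP m).2.
Qed.

(** Evaluate at a point [phi] of the ball of the bidual and drop blocks from the last one on. Each
    drop costs [eps + eps], or 3 while [phi] moves one derivation deeper, which happens fewer than
    [MU] times; the final 1 pays for the first block. *)
Lemma upper_estimate (eps : R) MU N next : 0 < eps ->
  wdern MU eps (dball (Z := Y)) = set0 -> upper_next eps MU N%:R next ->
  forall n h v, (n <= N)%N -> skipped next n h v -> (forall i, (i < n)%N -> `|v i| <= 1) ->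
  `|\sum_(i < n) v i| <= n%:R * (eps + eps) + 3 * MU%:R + 1.
Proof.
move=> eps0 MU0 up n h v nN sk v1.
have claim i r (phi : dual Y) : (i <= n)%N -> wdern r eps dball phi ->
    phi (\sum_(j < i) v j) <= i%:R * (eps + eps) + 3 * (MU%:R - r%:R) + 1.
  have rM s (psi : dual Y) : wdern s eps dball psi -> (s < MU)%N.
    move=> psiD; rewrite ltnNge; apply/negP => Ms.
    by have := wdern_leq Ms psiD; rewrite MU0.
  elim: i r phi => [|i IH] r phi iN phiD.
    rewrite big_ord0 linear0 mul0r add0r.
    have : (r%:R <= MU%:R :> R) by rewrite ler_nat ltnW// (rM _ phi).
    move: (r%:R : R) (MU%:R : R) => p q; lra.
  have rMU := rM _ _ phiD.
  have rq : (r.+1%:R <= MU%:R :> R) by rewrite ler_nat.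
  case: i IH iN => [|i] IH iN.
    rewrite big_ord1 -natr1 in rq *.
    apply: (le_trans (ler_norm _)); apply: (le_trans (dual_ub1 _ (wdern_sub phiD))).
    by rewrite mul1r (le_trans (v1 0%N iN))// mul1r; move: (r%:R : R) (MU%:R : R) rq => p q; lra.
  rewrite big_ord_recr/=; set y := \sum_(j < i.+1) _.
  have yH : inH (h i) y by apply: skipped_partial sk _; exact: ltnW.
  have yN : `|y| <= N%:R.
    rewrite (le_trans (ler_norm_sum _ _ _))//.
    apply: (@le_trans _ _ (\sum_(j < i.+1) 1)).
      by apply: ler_sum => j _; apply: v1; have := ltn_ord j; lia.
    by rewrite sumr_const card_ord ler_nat; lia.
  have [_ _ va] := sk.
  have [psi [[pD pE]|[pD pE]]] := up _ _ rMU y (v i.+1) phi yH yN (va _ iN) (v1 _ iN) phiD.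
    apply: (le_trans pE); have := IH _ _ (ltnW iN) pD; rewrite -/y -!natr1.
    by move: (psi y : R) (i%:R : R) (r%:R : R) (MU%:R : R) => p q1 q2 q3; lra.
  apply: (le_trans pE); have := IH _ _ (ltnW iN) pD; rewrite -/y -!natr1.
  by move: (psi y : R) (i%:R : R) (r%:R : R) (MU%:R : R) => p q1 q2 q3; nra.
apply: dual_norm_le => x x1.
have [F [FP F1]] := @eval_dual R X x.
have FD : wdern 0 eps dball F by exact: le_trans F1 x1.
have FD' : wdern 0 eps dball (- F) by rewrite /= /dball/= normrN; exact: le_trans F1 x1.
rewrite ler_norml; apply/andP; split.
  by have := claim n 0%N _ (leqnn n) FD'; rewrite dualNE FP subr0 lerNl.
by have := claim n 0%N _ (leqnn n) FD; rewrite FP subr0.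
Qed.

End Strategy.

Section Lower.
Context {R : realType} (X : normedModType R).
Local Notation Y := (dual X).
Variable b : nat -> Y * X.
Hypothesis bi : forall n, biorth b n.

Definition big_at k (t : R) : bool := 2^-1 ^+ k <= t.

(** Descending induction on [i]: the full sum lies in the ball, and removing [u i] raises the order
    by one whenever [|u i| >= 2^-1 ^+ k], twice the scale [2^-1 ^+ k.+1] as [lower_next] demands.
    The restriction [k < i] keeps the tolerance below a quarter of that scale. *)
Lemma lower_count ML next n h u k :
  wdern ML 2^-1 (dball (Z := X)) = set0 -> lower_next b ML next ->
  skipped b next n h u -> (forall i, (i < n)%N -> (i <= h i)%N) ->
  `|\sum_(i < n) u i| <= 1 -> forall d i, (i + d)%N = n -> (k < i)%N ->
  thick (2^-1 ^+ i / 8) (wdern (\sum_(i <= j < n) big_at k `|u j|)%N (2^-1 ^+ k.+1) dball)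
    (\sum_(j < i) u j).
Proof.
move=> ML0 ln sk hi u1; elim=> [|d IH] i.
  rewrite addn0 => -> _; rewrite big_geq//; exists (\sum_(j < n) u j) => //.
  by rewrite subrr normr0 divr_ge0// exprn_ge0.
move=> ind ki; have [||g gD gE] := IH i.+1; [by lia|by lia|].
have iN : (i < n)%N by lia.
have i0 : i.-1.+1 = i by rewrite prednK//; lia.
have ux : (\sum_(j < i.+1) u j) = \sum_(j < i) u j + u i by rewrite big_ord_recr.
have SH : inH b (h i.-1) (\sum_(j < i) u j).
  by have := skipped_partial bi sk (_ : (i.-1 < n)%N); rewrite i0; apply; lia.
have ua : annih b (next (h i.-1)) (u i) by have [_ _ /(_ i.-1)] := sk; rewrite i0; apply.
have rM : (\sum_(i.+1 <= j < n) big_at k `|u j| < ML ^ k.+1)%N.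
  rewrite ltnNge; apply/negP => Mr; have := wdern_leq Mr gD.
  by rewrite (wdern_pow _ ML0).
have kh : (k <= h i.-1)%N.
  by have := hi i.-1; rewrite i0; have : (i.-1 < n)%N by [lia]; move=> + /(_ _); lia.
have pw a c : (a <= c)%N -> (2^-1 ^+ c : R) <= 2^-1 ^+ a.
  by move=> ac; rewrite ler_wiXn2l// ?invr_ge0// invf_le1// ler1n.
have e1 : (2^-1 ^+ i.+1 / 8 : R) <= 2^-1 ^+ k.+1 / 4.
  have : (2^-1 ^+ i.+1 : R) <= 2^-1 ^+ k.+1 by apply: pw; lia.
  have : (0 : R) <= 2^-1 ^+ k.+1 by rewrite exprn_ge0.
  by move: (2^-1 ^+ i.+1 : R) (2^-1 ^+ k.+1 : R) => p q; clear; lra.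
(* The old tolerance is half of the new one; the loss [2^-1 ^+ h i.-1 / 32] fits into the other half
   because [i.-1 <= h i.-1]. *)
have e2 : (2^-1 ^+ i.+1 / 8 + 2^-1 ^+ h i.-1 / 32 : R) <= 2^-1 ^+ i / 8.
  have : (2^-1 ^+ h i.-1 : R) <= 2^-1 ^+ i.-1 by apply: pw; have := hi i.-1; lia.
  by rewrite -i0 !exprS; move: (2^-1 ^+ h _ : R) (2^-1 ^+ i.-1 : R) => p q; clear; lra.
have [||t1 t2] := @ln (h i.-1) k _ kh rM (2^-1 ^+ i.+1 / 8) _ (u i) _ e1 SH ua _.
- by rewrite divr_ge0// exprn_ge0.
- by rewrite -ux; exists g.
rewrite (big_ltn iN); case: (leVlt (2^-1 ^+ k) `|u i|) => [bg|sm].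
  rewrite /big_at bg add1n; apply: thick_le e2 _ _; apply: t2.
  by rewrite exprS mulrA divff// mul1r.
by rewrite /big_at leNgt sm add0n; apply: thick_le e2 _ _.
Qed.

Lemma dyadic_scale (t : R) : 0 < t -> t <= 4 -> exists k, 2^-1 ^+ k <= t /\ t <= 4 * 2^-1 ^+ k.
Proof.
move=> t0 t4; have ex : exists k, (2^-1 ^+ k : R) <= t.
  have [k _ /(_ k (leqnn k))] := near_infty_natSinv_expn_lt (PosNum t0).
  by rewrite /= => h; exists k; rewrite exprVn -[leLHS]mul1r ltW.
case: (ex_minnP ex) => k kt kmin; exists k; split => //.
case: k kt kmin => [|k] kt kmin; first by rewrite mulr1.
have : t < 2^-1 ^+ k by rewrite ltNge; apply/negP => /kmin; rewrite ltnn.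
rewrite exprS => /ltW/le_trans; apply.
by have := exprn_ge0 k (_ : 0 <= 2^-1 :> R); move=> /(_ _); move: (2^-1 ^+ k : R) => q; lra.
Qed.

Lemma geometric_half n : \sum_(k < n) (2^-1 : R) ^+ k <= 2.
Proof.
suff -> : \sum_(k < n) (2^-1 : R) ^+ k = 2 - 2 * 2^-1 ^+ n.
  by have := exprn_ge0 n (_ : 0 <= 2^-1 :> R); move=> /(_ _); move: (2^-1 ^+ n : R) => q; lra.
elim: n => [|n IH]; first by rewrite big_ord0 expr0 mulr1 subrr.
by rewrite big_ord_recr/= IH exprS; move: (2^-1 ^+ n : R) => q; lra.
Qed.

(** [4 * ML <= 2 ^ p] makes the p-th power of the size [2^-1 ^+ k] beat the number of blocks of that
    size with a factor [2 ^ k] to spare, which leaves a geometric series. *)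
Lemma lower_weight ML p k : (4 * ML <= 2 ^ p)%N -> (1 < p)%N ->
  (2^-1 : R) ^+ (k * p) * (ML ^ k.+1 + k.+1)%:R <= (ML + 1)%:R * 2^-1 ^+ k.
Proof.
move=> Mp p1.
have : (2 ^ k * (ML ^ k.+1 + k.+1) <= (ML + 1) * 2 ^ (k * p))%N.
  rewrite mulnDr mulnDl leq_add//.
    rewrite expnS mulnCA leq_mul2l; apply/orP; right.
    case: (posnP k) => [->//|k0].
    by rewrite -expnMn (mulnC k) expnM leq_exp2r//; lia.
  rewrite mul1n; apply: (@leq_trans (2 ^ k * 2 ^ k)).
    by rewrite leq_mul2l ltn_expl// orbT.
  by rewrite -expnD leq_exp2l//; nia.
rewrite -(ler_nat R) !natrM !natrX => h.
rewrite !exprVn mulrC [leLHS](_ : _ = (ML ^ k.+1 + k.+1)%:R / 2 ^+ (k * p))//.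
by rewrite ler_pdivrMr ?exprn_gt0// mulrAC ler_pdivlMr ?exprn_gt0// mulrC.
Qed.

(** Blocks are sorted by dyadic size. Among those of index above [k], at most [ML ^ k.+1] have norm
    at least [2^-1 ^+ k], because longer derivations at the corresponding scale are empty; the first
    [k.+1] blocks are not controlled and are simply counted. *)
Lemma lower_estimate ML next n h u p : (4 * ML <= 2 ^ p)%N -> (1 < p)%N ->
  wdern ML 2^-1 (dball (Z := X)) = set0 -> lower_next b ML next ->
  skipped b next n h u -> (forall i, (i < n)%N -> (i <= h i)%N) ->
  `|\sum_(i < n) u i| <= 1 -> \sum_(i < n) `|u i| ^+ p <= 4 ^+ p * ((ML + 1)%:R * 2).
Proof.
move=> Mp p1 ML0 ln sk hi u1.
(* A nonempty partial sum is within 1/8 of a point of the ball. The resulting bound 4 on a single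
   block is the top of the dyadic scale. *)
have S1 i : (i <= n)%N -> `|\sum_(j < i) u j| <= 2.
  case: i => [|i] iN; first by rewrite big_ord0 normr0.
  have [g /wdern_sub gD gE] := lower_count ML0 ln sk hi u1 (subnKC iN) (ltn0Sn i).
  have := @dist_triangle _ _ (\sum_(j < i.+1) u j) 0 g; rewrite subr0 sub0r normrN.
  have : (2^-1 ^+ i.+1 : R) <= 1 by rewrite exprn_ile1// ?invf_le1// ler1n.
  move: gE (gD : `|g| <= 1); move: (`|_ - g|) (`|g|) (`|\sum_(_ < _) _|) (2^-1 ^+ i.+1 : R).
  by clear; move=> q1 q2 q3 q4; lra.
have u4 i : (i < n)%N -> `|u i| <= 4.
  move=> iN; have -> : u i = \sum_(j < i.+1) u j - \sum_(j < i) u j.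
    by rewrite big_ord_recr/= addrAC subrr add0r.
  by apply: (le_trans (ler_normB _ _)); rewrite [leRHS](_ : _ = 2 + 2)// ?lerD// ?S1//; [exact: ltnW|lra].
have count k : (\sum_(j < n) big_at k `|u j| <= ML ^ k.+1 + k.+1)%N.
  have [kn|nk] := leqP k.+1 n; last first.
    apply: (@leq_trans (\sum_(j < n) 1)); first by apply: leq_sum => j _; case: (big_at _ _).
    by rewrite sum1_card card_ord; lia.
  have [g gD _] := lower_count ML0 ln sk hi u1 (subnKC kn) (ltnSn k).
  rewrite -(big_mkord xpredT (fun j => big_at k `|u j| : nat)).
  rewrite (@big_cat_nat _ _ _ k.+1)//= addnC leq_add//.
    rewrite leqNgt; apply/negP => Mr; have := wdern_leq (ltnW Mr) gD.
    by rewrite (wdern_pow _ ML0).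
  apply: (@leq_trans (\sum_(0 <= j < k.+1) 1)); first by apply: leq_sum => j _; case: (big_at _ _).
  by rewrite sum_nat_const_nat; lia.
have kex (i : 'I_n) : exists k, `|u i| ^+ p <= 4 ^+ p * (2^-1 ^+ (k * p)) * (big_at k `|u i| : nat)%:R.
  have [u0|u0] := eqVneq `|u i| 0.
    by exists 0%N; rewrite u0 expr0n/= gtn_eqF ?(ltnW p1)// mulr_ge0// mulr_ge0// exprn_ge0.
  have [||k [k1 k2]] := @dyadic_scale `|u i|; [by rewrite lt_neqAle eq_sym u0/=|exact: u4|].
  exists k; rewrite /big_at k1 mulr1 exprM -exprMn; apply: lerXn2r k2; rewrite nnegrE//.
pose k i := sval (cid (kex i)); have kP i := svalP (cid (kex i)).
pose K := (\max_(i < n) k i).+1.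
apply: (@le_trans _ _ (\sum_(i < n) \sum_(l < K)
   4 ^+ p * (2^-1 ^+ (l * p)) * (big_at l `|u i| : nat)%:R)).
  apply: ler_sum => i _; apply: (le_trans (kP i)).
  have kK : (k i < K)%N by rewrite ltnS leq_bigmax.
  by rewrite (bigD1 (Ordinal kK))//= lerDl sumr_ge0// => l _; rewrite ?mulr_ge0 ?exprn_ge0.
rewrite exchange_big/=.
apply: (@le_trans _ _ (\sum_(l < K) 4 ^+ p * ((ML + 1)%:R * 2^-1 ^+ l))).
  apply: ler_sum => l _; rewrite -mulr_sumr -mulrA ler_wpM2l ?exprn_ge0//.
  apply: le_trans (lower_weight _ Mp p1); rewrite ler_wpM2l ?exprn_ge0//.
  by rewrite -natr_sum ler_nat.
rewrite -mulr_sumr ler_wpM2l ?exprn_ge0// -mulr_sumr ler_wpM2l//.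
exact: geometric_half.
Qed.

End Lower.

(** * Blocking a Markushevich basis *)

Section Blocks.
Context {R : realType} (X : normedModType R).
Local Notation Y := (dual X).
Variable b : nat -> Y * X.
Hypothesis bi : forall n, biorth b n.
Hypothesis dY : forall v (e : R), 0 < e -> exists n (c : nat -> R),
  `|v - \sum_(k < n) c k *: (b k).1| < e.
Hypothesis dX : forall v (e : R), 0 < e -> exists n (c : nat -> R),
  `|v - \sum_(k < n) c k *: (b k).2| < e.

Lemma annih_bproj m v : annih b m (v - bproj b m v).
Proof. by move=> k km; rewrite mcoordB bproj_mcoord// km subrr. Qed.

(* The two lemmas below are compactness arguments: a failure for every N has a
   w*-limit, which is approximated in norm by the span of the M-basis. *)
Lemma cut_ex (next : nat -> nat) M (e : R) : 0 < e -> exists2 N, (M < N)%N &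
  forall y : Y, `|y| <= 1 -> exists m s w, [/\ (M <= m < N)%N, inH b m s,
    `|s| <= 2, `|w| <= e & annih b (next m) (s - y - w)].
Proof.
move=> e0; apply: contrapT => nex.
have bad N : exists y : Y, `|y| <= 1 /\ ((M < N)%N -> ~ exists m s w, [/\ (M <= m < N)%N,
    inH b m s, `|s| <= 2, `|w| <= e & annih b (next m) (s - y - w)]).
  apply: contrapT => ny; apply: nex; exists (maxn N M.+1); first by rewrite leq_max leqnn orbT.
  move=> y y1; apply: contrapT => no; apply: ny; exists y; split => // MN.
  by move: no; rewrite (maxn_idPl MN).
pose y n := sval (cid (bad n)); have yP n := svalP (cid (bad n)).
have [y' [yy' y'1]] := wscvg_ex (fun n => (yP n).1).
pose d := Num.min (e / 2) 1.
have d0 : 0 < d by rewrite lt_min ltr01 divr_gt0.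
have [m0 [s [s0 sP]]] := inH_dense bi dY y' d0.
have dE : d <= e / 2 by rewrite ge_min lexx.
have d1 : d <= 1 by rewrite ge_min lexx orbT.
pose m := maxn M m0.
have sH : inH b m s by apply: inH_mono s0 => //; exact: leq_maxr.
have e2 : 0 < e / 2 by rewrite divr_gt0.
have [n [mn nP]] := filter_ex (filterI (ufil_ge m.+1) (bproj_cvg b (next m) yy' e2)).
have Mn : (M < n)%N by apply: leq_trans mn; rewrite ltnS leq_maxl.
have [_ /(_ Mn)] := yP n; apply.
(* [s] is a norm approximation of the limit [y']; [w] collects its error and the first [next m]
   coordinates of [y' - y n], which are small by w*-convergence. *)
exists m, s, (s - y' + bproj b (next m) (y' - y n)); split => //.
- by rewrite leq_maxl.
- have := @dist_triangle _ _ s 0 y'; rewrite subr0 sub0r normrN distrC => h.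
  by apply: (le_trans h); rewrite [leRHS](_ : _ = 1 + 1)// lerD// (le_trans (ltW sP)).
- apply: (le_trans (ler_normD _ _)); rewrite [leRHS]splitr lerD//.
    by rewrite distrC (le_trans (ltW sP)).
  by rewrite bprojD bprojN -normrN opprB ltW.
- have -> : s - y n - (s - y' + bproj b (next m) (y' - y n)) =
      (y' - y n) - bproj b (next m) (y' - y n).
    by rewrite opprD opprB addrA [s - y n + _]addrC subrKA.
  exact: annih_bproj.
Qed.

Lemma helly_ex m : exists2 n, (m <= n)%N & forall (w : Y) (a : R), 0 < a -> `|w| <= a ->
  exists w', [/\ inH b n w', annih b m (w - w') & `|w'| <= 2 * a].
Proof.
apply: contrapT => nex.
have bad n : exists w : Y, `|w| <= 1 /\ ((m <= n)%N -> ~ exists w', [/\ inH b n w',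
    annih b m (w - w') & `|w'| <= 2]).
  apply: contrapT => ny; apply: nex; exists (maxn n m); first exact: leq_maxr.
  move=> w a a0 wa; apply: contrapT => no; apply: ny; exists (a^-1 *: w); split.
    by rewrite normrZ gtr0_norm ?invr_gt0// mulrC ler_pdivrMr// mul1r.
  move=> mn [w' [w'H w'a w'2]]; apply: no; exists (a *: w'); split.
  - by rewrite (maxn_idPl mn); exact: inHZ.
  - move=> k km; have := w'a k km; rewrite !mcoordB !mcoordZ => /eqP.
    rewrite subr_eq0 => /eqP <-; rewrite mulrA divff ?gt_eqF// mul1r subrr//.
  - by rewrite normrZ gtr0_norm// mulrC ler_pM2r.
pose w n := sval (cid (bad n)); have wP n := svalP (cid (bad n)).
have [w' [ww' w'1]] := wscvg_ex (fun n => (wP n).1).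
have e4 : 0 < (4^-1 : R) by rewrite invr_gt0.
pose K := \sum_(k < m) `|(b k).2| * `|(b k).1|.
have K0 : 0 < K + 1 by rewrite ltr_wpDl// sumr_ge0.
pose d := Num.min 4^-1 (4^-1 / (K + 1)).
have d0 : 0 < d by rewrite lt_min e4 divr_gt0.
have [m0 [s [s0 sP]]] := inH_dense bi dY w' d0.
have d4 : d <= 4^-1 by rewrite ge_min lexx.
have dK : d <= 4^-1 / (K + 1) by rewrite ge_min lexx orbT.
have [n [/= mn nP]] := filter_ex (filterI (ufil_ge (maxn m m0)) (bproj_cvg b m ww' e4)).
have mn' : (m <= n)%N by apply: leq_trans mn; exact: leq_maxl.
have [_ /(_ mn')] := wP n; apply.
(* A norm approximation of the limit, corrected by a small finite-rank term so that its first [m]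
   coordinates are exactly those of [w n]. *)
exists (s + bproj b m (w n - s)); split.
- apply: inHD; first by apply: inH_mono s0 => //; apply: leq_trans mn; exact: leq_maxr.
  by apply: inH_mono (inH_bproj bi _ _) => //.
- by rewrite opprD addrA; exact: annih_bproj.
- have -> : bproj b m (w n - s) = (bproj b m (w n) - bproj b m w') + bproj b m (w' - s).
    by rewrite !bprojD !bprojN addrA subrK.
  have hK : `|bproj b m (w' - s)| <= 4^-1.
    apply: (@le_trans _ _ (\sum_(k < m) d * (`|(b k).2| * `|(b k).1|))).
      apply: (le_trans (ler_norm_sum _ _ _)); apply: ler_sum => k _.
      rewrite normrZ mulrA ler_wpM2r//; apply: (le_trans (dual_ub _ _)).
      by rewrite ler_wpM2r// ltW.
    rewrite -mulr_sumr -/K; apply: (@le_trans _ _ (d * (K + 1))).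
      by rewrite ler_pM2l// lerDl.
    by rewrite -ler_pdivlMr.
  have hs : `|s| <= 1 + 4^-1.
    have := @dist_triangle _ _ s 0 w'; rewrite subr0 sub0r normrN distrC => h.
    by apply: (le_trans h); rewrite addrC lerD// (le_trans (ltW sP)).
  apply: (le_trans (ler_normD _ _)).
  apply: (@le_trans _ _ ((1 + 4^-1) + (4^-1 + 4^-1))); last by lra.
  by rewrite lerD//; apply: (le_trans (ler_normD _ _)); rewrite lerD// ltW.
Qed.

(* [lo i.+1 < hi i] is allowed: consecutive F_i may overlap, so that only every
   other group of indices gives [skipped] vectors. *)
Definition inF (lo hi : nat -> nat) i v := inH b (hi i) v /\ annih b (lo i) v.

Definition block_bounds (next lo hi : nat -> nat) :=
  [/\ {homo hi : i j / (i <= j)%N}, {homo lo : i j / (i <= j)%N} &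
      forall i, (next (hi i) <= lo i.+2)%N].

Lemma skipped_groups next lo hi n (a : nat -> nat) q :
  block_bounds next lo hi -> (forall i, inF lo hi i (q i)) ->
  (forall i, (i < n)%N -> (a i.*2 < a i.*2.+1)%N) ->
  (forall i, (i.+1 < n)%N -> (a i.*2.+1 < a i.*2.+2)%N) ->
  skipped b next n (fun i => hi (a i.*2.+1).-1) (fun i => \sum_(a i.*2 <= j < a i.*2.+1) q j).
Proof.
move=> [him lom nx] qF a1 a2; split.
- move=> i iN; rewrite big_seq; apply: inH_sum => j; rewrite mem_index_iota => /andP[_ ja].
  by apply: inH_mono (qF j).1 => //; apply: him; have := a1 i iN; lia.
- move=> i iN; apply: him; have := a1 i.+1 iN; have := a2 i iN; rewrite doubleS; lia.
- move=> i iN; rewrite big_seq; apply: annih_sum => j; rewrite mem_index_iota doubleS => /andP[ja _].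
  have ai := a1 i (ltnW iN); have ai2 := a2 i iN.
  apply: annih_mono (qF j).2; apply: (leq_trans (nx _)); apply: lom; lia.
Qed.

(** Empty groups are removed because the position of a skipped block is read off the last index of
    its group. *)
Lemma strict_cuts (a : nat -> nat) n : (forall j, (j < n)%N -> (a j <= a j.+1)%N) ->
  exists n' c, [/\ (n' <= n)%N, c 0%N = a 0%N, c n' = a n,
    forall j, (j < n')%N -> (c j < c j.+1)%N &
    (forall j, (j < n')%N -> exists2 i, (i < n)%N & c j = a i /\ c j.+1 = a i.+1) /\
    forall F : nat -> nat -> R, (forall x, F x x = 0) ->
      \sum_(j < n) F (a j) (a j.+1) = \sum_(j < n') F (c j) (c j.+1)].
Proof.
elim: n => [_|n IH ai]; first by exists 0%N, a; split => //; split => // F _; rewrite !big_ord0.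
have [j jn|n' [c [n'n c0 cn cs [cg cF]]]] := IH; first by apply: ai; exact: ltnW.
have := ai n (ltnSn n); rewrite leq_eqVlt => /predU1P[an|an].
  exists n', c; split => //; [exact: leqW|by rewrite cn|].
  split; first by move=> j /cg[i iN ?]; exists i => //; exact: ltnW.
  by move=> F F0; rewrite big_ord_recr/= -an F0 addr0 cF.
exists n'.+1, (fun j => if j == n'.+1 then a n.+1 else c j); split => //.
- by rewrite eqxx.
- move=> j; rewrite ltnS leq_eqVlt => /predU1P[->|jn].
    by rewrite eqxx ltn_eqF// cn.
  by rewrite !ltn_eqF ?ltnS//; [exact: cs|exact: ltnW].
- split=> [j|F F0].
    rewrite ltnS leq_eqVlt => /predU1P[->|jn].
      by exists n => //; rewrite eqxx ltn_eqF// cn.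
    have [i iN ?] := cg j jn; exists i; first exact: ltnW.
    by rewrite !ltn_eqF ?ltnS//; exact: ltnW.
  rewrite !big_ord_recr/= cF// eqxx ltn_eqF// cn; congr (_ + _).
  by apply: eq_bigr => j _; have jn := ltn_ord j; rewrite !ltn_eqF ?ltnS// ltnW.
Qed.

Lemma sum_even_odd (V : nmodType) (F : nat -> V) n : \sum_(j < n) F j =
  \sum_(i < uphalf n) F i.*2 + \sum_(i < n./2) F i.*2.+1.
Proof.
elim: n => [|n IH]; first by rewrite !big_ord0 addr0.
rewrite big_ord_recr/= IH; have nE := odd_double_half n.
case: (boolP (odd n)) nE => on; rewrite uphalf_half ?(negbTE on) ?on ?add1n ?add0n => nE.
  by rewrite [X in _ = _ + X]big_ord_recr/= nE addrA.
by rewrite [X in _ = X + _]big_ord_recr/= nE addrAC.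
Qed.

Lemma sum_cuts (V : nmodType) (F : nat -> V) (a : nat -> nat) n :
  (forall j, (j < n)%N -> (a j <= a j.+1)%N) ->
  (a 0 <= a n)%N /\ \sum_(j < n) \sum_(a j <= i < a j.+1) F i = \sum_(a 0 <= i < a n) F i.
Proof.
elim: n => [|n IH] ai; first by rewrite big_ord0 big_geq.
have [|a0n IHs] := IH; first by move=> j jn; apply: ai; exact: ltnW.
have an := ai n (ltnSn n); split; first exact: leq_trans an.
by rewrite big_ord_recr/= IHs -big_cat_nat.
Qed.

(** The groups of even rank and those of odd rank form two skipped sequences; hence the factor 2. *)
Lemma upper_groups (eps : R) MU N next lo hi (a : nat -> nat) n q : 0 < eps ->
  wdern MU eps (dball (Z := Y)) = set0 -> upper_next b eps MU N%:R next ->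
  block_bounds next lo hi -> (forall i, inF lo hi i (q i)) -> (n <= N)%N ->
  (forall j, (j < n)%N -> (a j <= a j.+1)%N) ->
  (forall j, (j < n)%N -> `|\sum_(a j <= i < a j.+1) q i| <= 1) ->
  `|\sum_(a 0 <= i < a n) q i| <= (n%:R * (eps + eps) + 3 * MU%:R + 1) * 2.
Proof.
move=> eps0 MU0 up bb qF nN am a1.
have [n' [c [n'n <- <- cs [cg _]]]] := strict_cuts am.
have [_ <-] := @sum_cuts _ q c n' (fun j jn => ltnW (cs j jn)).
rewrite (sum_even_odd (fun j => \sum_(c j <= i < c j.+1) q i)).
have c1 j : (j < n')%N -> `|\sum_(c j <= i < c j.+1) q i| <= 1.
  by move=> /cg[i iN [-> ->]]; exact: a1.
have le k : (k <= n)%N -> (k%:R * (eps + eps) + 3 * MU%:R + 1 : R) <= n%:R * (eps + eps) + 3 * MU%:R + 1.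
  by move=> kn; rewrite !lerD2r ler_wpM2r ?ler_nat// addr_ge0// ltW.
apply: (le_trans (ler_normD _ _)); rewrite mulrDr mulr1.
have n2 : n' = (odd n' + n'./2.*2)%N by rewrite odd_double_half.
have u2 : uphalf n' = (odd n' + n'./2)%N by rewrite uphalf_half.
apply: lerD.
- have hn : (uphalf n' <= n)%N by lia.
  apply: (le_trans _ (le _ hn)).
  apply: (upper_estimate bi eps0 MU0 up (leq_trans hn nN) (skipped_groups bb qF _ _)).
  + by move=> i iN; apply: cs; case: (odd n') n2 u2 => /=; lia.
  + by move=> i iN; apply: cs; case: (odd n') n2 u2 => /=; lia.
  + by move=> i iN; apply: c1; case: (odd n') n2 u2 => /=; lia.
- have hn : (n'./2 <= n)%N by lia.
  apply: (le_trans _ (le _ hn)).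
  apply: (upper_estimate bi eps0 MU0 up (leq_trans hn nN)
    (@skipped_groups next lo hi n'./2 (fun j => c j.+1) q bb qF _ _)).
  + by move=> i iN; apply: cs; lia.
  + by move=> i iN; apply: cs; lia.
  + by move=> i iN; apply: c1; lia.
Qed.

(** The two compactness lemmas alternate: between [M i] and [N i] every [y] of the ball can be cut,
    and [M i.+1] leaves room for vectors that correct the first [next (N i)] coordinates. *)
Lemma block_sequence (next : nat -> nat) : (forall m, (m < next m)%N) ->
  {homo next : m n / (m <= n)%N} ->
  exists M N : nat -> nat, [/\ forall i, (M i < N i)%N, forall i, (next (N i) <= M i.+1)%N,
    forall i (y : Y), `|y| <= 1 -> exists m s w, [/\ (M i <= m < N i)%N, inH b m s,
      `|s| <= 2, `|w| <= 2^-1 ^+ i / 32 & annih b (next m) (s - y - w)] &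
    forall i (w : Y) (a : R), 0 < a -> `|w| <= a ->
      exists w', [/\ inH b (M i.+1) w', annih b (next (N i)) (w - w') & `|w'| <= 2 * a]].
Proof.
move=> nx nxm.
have cutP M i := @cut_ex next M (2^-1 ^+ i / 32).
have e0 i : 0 < (2^-1 ^+ i / 32 : R) by rewrite divr_gt0// exprn_gt0.
pose cut M i := s2val (cid2 (cutP M i (e0 i))).
pose hel m := s2val (cid2 (helly_ex m)).
pose fix M i := if i is j.+1 then hel (next (cut (M j) j)) else 0%N.
exists M, (fun i => cut (M i) i); split.
- by move=> i; exact: (s2valP (cid2 (cutP (M i) i (e0 i)))).
- by move=> i; exact: (s2valP (cid2 (helly_ex (next (cut (M i) i))))).
- by move=> i; exact: (s2valP' (cid2 (cutP (M i) i (e0 i)))).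
- by move=> i; exact: (s2valP' (cid2 (helly_ex (next (cut (M i) i))))).
Qed.

(** [d i.+1 = s i.+1 - s i - v i], where [s i] is the truncation of [y] at the i-th cut and the
    finitely supported [v i] has the same early coordinates as the error difference [w i.+1 - w i];
    so [d i.+1] vanishes there. The [v i] sum to at most 1/4 in norm and are never compensated,
    whence the loss [|x| / 2]. *)
Lemma lift_ex (next M N : nat -> nat) (y : Y) : (forall m, (m < next m)%N) ->
  {homo next : m n / (m <= n)%N} ->
  (forall i, (M i < N i)%N) -> (forall i, (next (N i) <= M i.+1)%N) ->
  (forall i (y : Y), `|y| <= 1 -> exists m s w, [/\ (M i <= m < N i)%N, inH b m s,
      `|s| <= 2, `|w| <= 2^-1 ^+ i / 32 & annih b (next m) (s - y - w)]) ->
  (forall i (w : Y) (a : R), 0 < a -> `|w| <= a ->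
      exists w', [/\ inH b (M i.+1) w', annih b (next (N i)) (w - w') & `|w'| <= 2 * a]) ->
  `|y| <= 1 -> exists d : nat -> Y, exists h : nat -> nat,
  [/\ forall i, (M i <= h i < N i)%N, forall n, skipped b next n h d,
    forall n, `|\sum_(i < n) d i| <= 3 &
    forall x e, 0 < e -> exists n, `|(y - \sum_(i < n) d i) x| <= `|x| / 2 + e].
Proof.
move=> nx nxm MN NM cutP helP y1.
pose t i := cid (cutP i y y1); pose h i := sval (t i).
have tP i := svalP (t i); pose s i := sval (cid (tP i)).
have sP i := svalP (cid (tP i)); pose w i := sval (cid (sP i)).
have wP i : [/\ (M i <= h i < N i)%N, inH b (h i) (s i),
      `|s i| <= 2, `|w i| <= 2^-1 ^+ i / 32 & annih b (next (h i)) (s i - y - w i)].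
  exact: (svalP (cid (sP i))).
have e0 i : 0 < (2^-1 ^+ i / 32 : R) by rewrite divr_gt0// exprn_gt0.
have wex i : exists w', [/\ inH b (M i.+1) w', annih b (next (N i)) (w i.+1 - w i - w') &
    `|w'| <= 2^-1 ^+ i / 8].
  have [||w' [w'H w'a w'n]] := helP i (w i.+1 - w i) (2^-1 ^+ i / 32 + 2^-1 ^+ i / 32).
  - by rewrite addr_gt0.
  - apply: (le_trans (ler_normB _ _)); apply: lerD; last by have [] := wP i.
    have [_ _ _ wi _] := wP i.+1; apply: (le_trans wi).
    rewrite ler_pM2r ?invr_gt0// exprS ler_piMl ?exprn_ge0// ?invf_le1// ler1n//.
  - exists w'; split => //; apply: (le_trans w'n); move: (2^-1 ^+ i : R) => q; lra.
pose v i := sval (cid (wex i)).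
have vP i : [/\ inH b (M i.+1) (v i), annih b (next (N i)) (w i.+1 - w i - v i) &
    `|v i| <= 2^-1 ^+ i / 8] := svalP (cid (wex i)).
pose d i := if i is j.+1 then s i - s j - v j else s 0%N.
have dsum n : \sum_(i < n.+1) d i = s n - \sum_(i < n) v i.
  elim: n => [|n IH]; first by rewrite big_ord1 big_ord0 subr0.
  by rewrite big_ord_recr IH [in RHS]big_ord_recr/= opprD addrACA [s n + _]addrC subrK.
have vsum n : `|\sum_(i < n) v i| <= 4^-1.
  apply: (le_trans (ler_norm_sum _ _ _)).
  apply: (@le_trans _ _ (\sum_(i < n) 2^-1 ^+ i / 8)).
    by apply: ler_sum => i _; have [] := vP i.
  by rewrite -mulr_suml; have := @geometric_half R n; move: (\sum_(_ < _) _) => q; lra.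
have hM i : (M i <= h i < N i)%N by have [] := wP i.
have hN i : (next (h i) <= next (N i))%N by apply: nxm; have := hM i; lia.
exists d, h; split.
- exact: hM.
- move=> n; split.
  + move=> [|i] _; first by have [] := wP 0%N.
    have [_ sH _ _ _] := wP i.+1; have [_ sH' _ _ _] := wP i; have [vH _ _] := vP i.
    have k1 := hM i; have k2 := hM i.+1; have k3 := NM i; have k4 := nx (N i).
    apply: (inHB (inHB sH _)).
      by apply: (inH_mono bi _ sH'); lia.
    by apply: (inH_mono bi _ vH); lia.
  + by move=> i _; have k1 := hM i; have k2 := hM i.+1; have k3 := NM i; have k4 := nx (N i); lia.
  + move=> i _; have [_ _ _ _ a1] := wP i.+1; have [_ _ _ _ a0] := wP i; have [_ av _] := vP i.
    have hh : (next (h i) <= next (h i.+1))%N.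
      by apply: nxm; have k1 := hM i; have k2 := hM i.+1; have k3 := NM i; have k4 := nx (N i); lia.
    move=> k km; have := a1 k (leq_trans km hh); have := a0 k km.
    have := av k (leq_trans km (hN i)).
    rewrite /d !mcoordB; move: (mcoord _ (s i) k) (mcoord _ (s i.+1) k) (mcoord _ (w i) k) (mcoord _ (w i.+1) k).
    by move: (mcoord _ (v i) k) (mcoord _ y k); move=> *; lra.
- case=> [|n]; first by rewrite big_ord0 normr0.
  rewrite dsum; apply: (le_trans (ler_normB _ _)).
  have [_ _ sn _ _] := wP n; have := vsum n; move: sn.
  by move: (`|s n|) (`|\sum_(_ < _) _|) => p q; lra.
- move=> x e e_gt0.
  have rb n : `|s n - y - w n| <= 4.
    have [_ _ sn wn _] := wP n; have := ler_normB (s n - y) (w n); have := ler_normB (s n) y.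
    have : (2^-1 ^+ n : R) <= 1 by rewrite exprn_ile1// ?invf_le1// ler1n.
    have y1' := y1; move: sn wn y1'; move: (`|s n - y - w n|) (`|s n - y|) (`|s n|) (`|y|) (`|w n|) (2^-1 ^+ n : R).
    by move=> *; lra.
  have [u' [uu' _]] := wscvg_ex rb.
  have Mi i : (i <= M i)%N.
    by elim: i => [//|i IH]; have := NM i; have := nx (N i); have := MN i; lia.
  have u0 : u' = 0.
    apply: (wscvg_annih dX _ uu') => n; have [_ _ _ _] := wP n; apply: annih_mono.
    by have := hM n; have := nx (h n); have := Mi n; lia.
  have [n ne] := filter_ex (ucvgr_near (uu' x) e_gt0).
  exists n.+1; rewrite dsum; have [_ _ _ wn _] := wP n.
  have -> : y - (s n - \sum_(i < n) v i) = - (s n - y - w n) + (\sum_(i < n) v i - w n).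
    by rewrite [- (s n - y - w n)]opprB [RHS]addrC subrKA !opprB addrCA.
  rewrite -[X in `|X|]/(- (s n - y - w n) x + (\sum_(i < n) v i - w n) x : R) addrC.
  apply: (le_trans (ler_normD _ _)); apply: lerD; last first.
    by rewrite normrN; move: ne; rewrite /= u0 -[(0 : Y) x]/(0 : R) sub0r normrN => /ltW.
  apply: (le_trans (dual_ub _ _)); rewrite mulrC ler_wpM2l//.
  apply: (le_trans (ler_normB _ _)); have := vsum n; move: wn.
  have : (2^-1 ^+ n : R) <= 1 by rewrite exprn_ile1// ?invf_le1// ler1n.
  by move: (2^-1 ^+ n : R) (`|w n|) (`|\sum_(_ < _) _|) => p q r; lra.
Qed.

Hypothesis Xr : forall phi : dual Y, exists x : X, forall f : Y, phi f = f x.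

(** The number of blocks in the upper estimate and the exponent in the lower one are the same
    [P.+2], because a single parameter indexes both in a frame. *)
Lemma block_structure :
  (forall eps, 0 < eps -> exists n, wdern n eps (dball (Z := X)) = set0) ->
  (forall eps, 0 < eps -> exists n, wdern n eps (dball (Z := Y)) = set0) ->
  exists (P : nat) (lo hi : nat -> nat) (C : R), [/\ 0 <= C,
    forall a n q, (forall i, inF lo hi i (q i)) -> (n <= P.+2)%N ->
      (forall j, (j < n)%N -> (a j <= a j.+1)%N) ->
      (forall j, (j < n)%N -> `|\sum_(a j <= i < a j.+1) q i| <= 1) ->
      `|\sum_(a 0 <= i < a n) q i| <= P.+2%:R / 8 &
    forall y : Y, `|y| <= 1 -> exists d : nat -> Y, [/\ forall i, inF lo hi i (d i),
      forall a n, (forall j, (j < n)%N -> (a j <= a j.+1)%N) ->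
        \sum_(j < n) `|\sum_(a j <= i < a j.+1) d i| ^+ P.+2 <= C &
      forall x e, 0 < e -> exists n, `|(y - \sum_(i < n) d i) x| <= `|x| / 2 + e]].
Proof.
move=> HX HY; have h2 : 0 < (2^-1 : R) by rewrite invr_gt0.
(* With [eps = 1/64] and [n = P.+2], [upper_groups] gives [P.+2 / 16 + 6 * MU + 2]; the summand
   [96 * MU + 32] of [P] brings this below [P.+2 / 8], and [4 * ML] serves the exponent of the lower
   estimate. *)
have [ML ML0] := HX _ h2; have e64 : 0 < (64^-1 : R) by rewrite invr_gt0.
have [MU MU0] := HY _ e64; pose P := (96 * MU + 32 + 4 * ML)%N.
have [|next [nx nxm up ln]] := next_ex dX Xr P.+2%:R MU ML e64; first by rewrite invf_le1// ler1n.
have [M [N [MN NM cutP helP]]] := block_sequence nx nxm.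
have Ms i : (M i <= M i.+1)%N by have := MN i; have := NM i; have := nx (N i); lia.
have Mm : {homo M : i j / (i <= j)%N} by apply: homo_leq => //; exact: leq_trans.
have Ns i : (N i <= N i.+1)%N by have := MN i.+1; have := NM i; have := nx (N i); lia.
have Nm : {homo N : i j / (i <= j)%N} by apply: homo_leq => //; exact: leq_trans.
have Mi i : (i <= M i)%N.
  by elim: i => [//|i IH]; have := NM i; have := nx (N i); have := MN i; lia.
pose lo i := if i is j.+1 then M j else 0%N.
have bb : block_bounds next lo N.
  by split => //; move=> [|i] [|j]//=; rewrite ltnS; exact: Mm.
exists P, lo, N, (6 ^+ P.+2 * (4 ^+ P.+2 * ((ML + 1)%:R * 2))); split.
- by rewrite mulr_ge0 ?exprn_ge0// mulr_ge0 ?exprn_ge0.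
- move=> a n q qF nP am a1.
  have ug := upper_groups e64 MU0 up bb qF nP am a1.
  apply: (le_trans ug).
  apply: (@le_trans _ _ ((P.+2%:R * (64^-1 + 64^-1) + 3 * MU%:R + 1) * 2)).
    by rewrite ler_pM2r// !lerD2r ler_wpM2r ?ler_nat.
  have -> : P.+2%:R = 96 * MU%:R + 34 + 4 * ML%:R :> R.
    have -> : P.+2 = (96 * MU + 34 + 4 * ML)%N by rewrite /P; lia.
    by rewrite 2!natrD 2!natrM.
  have : 0 <= ML%:R :> R by [].
  by move: (MU%:R : R) (ML%:R : R) => p r; lra.
- move=> y y1.
  have [d [h [hM sk d3 dy]]] := lift_ex nx nxm MN NM cutP helP y1.
  have hs i : (h i <= h i.+1)%N.
    by have := hM i; have := hM i.+1; have := NM i; have := nx (N i); lia.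
  have hm : {homo h : i j / (i <= j)%N} by apply: homo_leq => //; exact: leq_trans.
  have hi i : (i <= h i)%N by have := hM i; have := Mi i; lia.
  have dH i : inH b (h i) (d i) by have [/(_ i (ltnSn i))] := sk i.+1.
  have dA i : annih b (next (h i)) (d i.+1) by have [_ _ /(_ i (ltnSn i.+1))] := sk i.+2.
  exists d; split => //.
  + move=> i; split; first by apply: (inH_mono bi _ (dH i)); have := hM i; lia.
    case: i => [//|i]; apply: annih_mono (dA i); rewrite /lo.
    by have := hM i; have := nx (h i); lia.
  + move=> a n am.
    have [n' [c [n'n c0 cn cs [_ cF]]]] := strict_cuts am.
    rewrite (cF (fun x y => `|\sum_(x <= i < y) d i| ^+ P.+2)); last first.
      by move=> x; rewrite big_geq// normr0 expr0n.
    have cj j : (j < n')%N -> (j <= (c j.+1).-1)%N.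
      by elim: j => [//|j IH] jn; have := IH (ltnW jn); have := cs _ jn; have := cs _ (ltnW jn); lia.
    (* A sum over an interval is a difference of two partial sums of norm at most 3. Consecutive
       groups of the [d i] are already skipped, so no splitting by parity occurs here. *)
    pose u j := 6^-1 *: \sum_(c j <= i < c j.+1) d i.
    have sk' : skipped b next n' (fun j => h (c j.+1).-1) u.
      split.
      * move=> j jn; apply: inHZ; rewrite big_seq; apply: inH_sum => i.
        rewrite mem_index_iota => /andP[_ ic].
        by apply: (inH_mono bi _ (dH i)); apply: hm; lia.
      * by move=> j jn; apply: hm; have := cs _ jn; lia.
      * move=> j jn k kn; rewrite mcoordZ.
        have -> : mcoord b (\sum_(c j.+1 <= i < c j.+2) d i) k = 0; last by rewrite mulr0.
        move: k kn; rewrite -/(annih b _ _) big_seq; apply: annih_sum => i.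
        rewrite mem_index_iota => /andP[ci _]; case: i ci => [|i] ci.
          by have := cs _ (ltnW jn); lia.
        by apply: annih_mono (dA i); apply: nxm; apply: hm; lia.
    have := @lower_estimate _ _ _ bi ML next n' _ u P.+2 _ isT ML0 ln sk'.
    have -> : \sum_(i < n') u i = 6^-1 *: \sum_(i < n') \sum_(c i <= j < c i.+1) d j.
      by rewrite scaler_sumr.
    have [c0n ->] := @sum_cuts _ d c n' (fun j jn => ltnW (cs j jn)).
    have -> : \sum_(c 0 <= i < c n') d i = \sum_(i < c n') d i - \sum_(i < c 0%N) d i.
      rewrite -!(big_mkord xpredT d) (@big_cat_nat _ _ _ (c 0%N) 0 (c n'))//=.
      by rewrite addrAC subrr add0r.
    rewrite normrZ ger0_norm ?invr_ge0// => LE.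
    have {}LE := LE _ _ _.
    rewrite -ler_pdivrMl ?exprn_gt0// mulr_sumr.
    apply: le_trans (LE _ _ _).
    * apply: ler_sum => i _; rewrite /u normrZ exprMn ger0_norm ?invr_ge0//.
      by rewrite exprVn.
    * apply: (@leq_trans P); first by rewrite /P; lia.
      by apply: (leq_trans (ltnW (ltn_expl P (ltnSn 1)))); rewrite leq_exp2l//; lia.
    * by move=> i iN; apply: leq_trans (cj i iN) (hi _).
    * rewrite mulrC ler_pdivrMr// mul1r; apply: (le_trans (ler_normB _ _)).
      by rewrite [leRHS](_ : _ = 3 + 3)// ?lerD// -natrD.
Qed.

End Blocks.

(** * Norms defined by cuts *)

Section PowerSums.
Context {R : realType}.

Lemma root_ex p (x : R) : (0 < p)%N -> 0 <= x -> exists y, 0 <= y /\ y ^+ p = x.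
Proof.
move=> p0 x0; have x1 : 0 <= 1 + x by rewrite addr_ge0.
have [] := @poly_ivt R ('X^p - x%:P)%R 0 (1 + x) x1.
  rewrite !hornerE expr0n gtn_eqF// sub0r oppr_le0 x0/= subr_ge0.
  apply: (@le_trans _ _ (1 + x)); first by rewrite lerDr.
  by apply: ler_eXnr => //; rewrite lerDl.
move=> y /andP[y0 _] /rootP; rewrite !hornerE => /eqP.
by rewrite subr_eq0 => /eqP <-; exists y.
Qed.

Definition proot p (x : R) : R := xget 0 [set y | 0 <= y /\ y ^+ p = x].

Lemma prootP p (x : R) : (0 < p)%N -> 0 <= x -> 0 <= proot p x /\ proot p x ^+ p = x.
Proof.
move=> p0 x0; have [y yP] := root_ex p0 x0; rewrite /proot.
by case: xgetP => [z _ //|/(_ y)].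
Qed.

Lemma proot_le p (x t : R) : (0 < p)%N -> 0 <= x -> 0 <= t -> (proot p x <= t) = (x <= t ^+ p).
Proof.
move=> p0 x0 t0; have [r0 rE] := prootP p0 x0.
by rewrite -{2}rE ler_pXn2r.
Qed.

(** Induction on [p]: the defect gained at each step is [a * b * (x - y) * (x ^+ p - y ^+ p)], whose
    last two factors have the same sign. *)
Lemma convex_pow p (a b x y : R) : 0 <= a -> 0 <= b -> a + b = 1 -> 0 <= x -> 0 <= y ->
  (a * x + b * y) ^+ p <= a * x ^+ p + b * y ^+ p.
Proof.
move=> a0 b0 ab x0 y0; elim: p => [|p IH]; first by rewrite !expr0 !mulr1 ab.
rewrite exprS; apply: (@le_trans _ _ ((a * x + b * y) * (a * x ^+ p + b * y ^+ p))).
  by rewrite ler_wpM2l// addr_ge0// mulr_ge0.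
rewrite -subr_ge0 !exprS.
have -> : a * (x * x ^+ p) + b * (y * y ^+ p) - (a * x + b * y) * (a * x ^+ p + b * y ^+ p) =
   a * b * ((x - y) * (x ^+ p - y ^+ p)).
  have -> : b = 1 - a by rewrite -ab addrAC subrr add0r.
  ring.
rewrite mulr_ge0 ?(mulr_ge0 a0 b0)//; have [xy|/ltW xy] := leVlt x y.
  by rewrite mulr_le0// subr_le0// lerXn2r.
by rewrite mulr_ge0// subr_ge0// lerXn2r.
Qed.

(** Convexity with the weights [s / (s + t)] and [t / (s + t)]. Bounds [s], [t] replace the norms
    themselves, so that no roots occur. *)
Lemma minkowski p n (a c : nat -> R) (s t : R) : (0 < p)%N -> 0 <= s -> 0 <= t ->
  (forall i, 0 <= a i) -> (forall i, 0 <= c i) ->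
  \sum_(i < n) a i ^+ p <= s ^+ p -> \sum_(i < n) c i ^+ p <= t ^+ p ->
  \sum_(i < n) (a i + c i) ^+ p <= (s + t) ^+ p.
Proof.
move=> p0 s0 t0 a0 c0 sa tc.
have zero (d : nat -> R) (r : R) : (forall i, 0 <= d i) -> r = 0 -> \sum_(i < n) d i ^+ p <= r ^+ p ->
    forall i : 'I_n, d i = 0.
  move=> d0 ->; rewrite expr0n gtn_eqF//= => h i.
  have : d i ^+ p <= 0.
    apply: le_trans h; rewrite (bigD1 i)//= lerDl sumr_ge0// => j _; exact: exprn_ge0.
  move=> h'; have : d i ^+ p == 0 by rewrite eq_le h' exprn_ge0.
  by rewrite expf_eq0 => /andP[_ /eqP].
have [s00|s00] := eqVneq s 0.
  rewrite s00 add0r; apply: le_trans tc; apply: ler_sum => i _.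
  by rewrite (zero a s)// add0r.
have [t00|t00] := eqVneq t 0.
  rewrite t00 addr0; apply: le_trans sa; apply: ler_sum => i _.
  by rewrite (zero c t)// addr0.
have sp : 0 < s by rewrite lt_def s00.
have tp : 0 < t by rewrite lt_def t00.
have st : 0 < s + t by rewrite addr_gt0.
apply: (@le_trans _ _ (\sum_(i < n) (s + t) ^+ p *
   (s / (s + t) * (a i / s) ^+ p + t / (s + t) * (c i / t) ^+ p))).
  apply: ler_sum => i _.
  have -> : a i + c i = (s + t) * (s / (s + t) * (a i / s) + t / (s + t) * (c i / t)).
    by field; rewrite !gt_eqF.
  rewrite exprMn ler_wpM2l ?exprn_ge0 ?(ltW st)//.
  apply: convex_pow; rewrite ?divr_ge0// ?(ltW st)//.
  by rewrite -mulrDl divff ?gt_eqF.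
rewrite -mulr_sumr big_split/= -!mulr_sumr.
rewrite -[leRHS]mulr1 ler_wpM2l ?exprn_ge0 ?(ltW st)//.
have h (d : nat -> R) (r : R) : 0 < r -> \sum_(i < n) d i ^+ p <= r ^+ p ->
    \sum_(i < n) (d i / r) ^+ p <= 1.
  move=> r0 dr; under eq_bigr do rewrite exprMn.
  by rewrite -mulr_suml exprVn ler_pdivrMr ?exprn_gt0// mul1r.
apply: (@le_trans _ _ (s / (s + t) * 1 + t / (s + t) * 1)).
  by apply: lerD; rewrite ler_wpM2l ?h// divr_ge0// ltW.
by rewrite !mulr1 -mulrDl divff ?gt_eqF.
Qed.

Lemma sum_pow_le p n (a : nat -> R) : (0 < p)%N -> (forall i, 0 <= a i) ->
  \sum_(i < n) a i ^+ p <= (\sum_(i < n) a i) ^+ p.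
Proof.
move=> p0 a0; elim: n => [|n IH]; first by rewrite !big_ord0 expr0n gtn_eqF.
rewrite !big_ord_recr/=; have s0 : 0 <= \sum_(i < n) a i by rewrite sumr_ge0.
apply: (@le_trans _ _ ((\sum_(i < n) a i) ^+ p + a n ^+ p)); first by rewrite lerD2r.
move: p0; case: p {IH} => [//|p] _.
rewrite [leRHS]exprS mulrDl !exprS lerD// ler_wpM2l// lerXn2r ?nnegrE ?addr_ge0// ?lerDl ?lerDr//.
Qed.

(* a <= lambda + a^p / lambda^(p-1), summed: a substitute for Hoelder's inequality *)
Lemma sum_le_pow p n (a : nat -> R) (lambda : R) : 0 < lambda -> (forall i, 0 <= a i) ->
  \sum_(i < n) a i <= n%:R * lambda + (\sum_(i < n) a i ^+ p.+1) / lambda ^+ p.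
Proof.
move=> l0 a0; rewrite mulr_suml mulr_natl -[X in _ *+ X]card_ord -sumr_const -big_split/=.
apply: ler_sum => i _; have [al|/ltW la] := leVlt (a i) lambda.
  by rewrite -[leLHS]addr0 lerD// divr_ge0// exprn_ge0// ltW.
rewrite -[leLHS]add0r lerD// ?(ltW l0)// ler_pdivlMr ?exprn_gt0// exprS ler_wpM2l//.
by rewrite lerXn2r ?nnegrE// ltW.
Qed.

End PowerSums.

(** * The p-variation norm of a family of functionals and its block estimates *)

Section LowerNorm.
Context {R : realType}.
Local Notation U := (nat -> nat -> R^o).
Variables (e : nat -> nat) (p : nat) (Phi : set (U -> R^o)).

Definition rst (a c : nat) (u : U) : U := fun t l => if (a <= t < c)%N then u t l else 0.
Definition mass (u : U) t : R := \sum_(l < e t) `|u t l : R|.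
Definition ndec (b : nat -> nat) n := forall j, (j < n)%N -> (b j <= b j.+1)%N.

Hypothesis p1 : (1 < p)%N.
Hypothesis Philin : forall psi, Phi psi -> linear psi.
Hypothesis Phib : forall psi, Phi psi -> forall u a c,
  `|psi (rst a c u) : R| <= \sum_(a <= t < c) mass u t.
Hypothesis Phi3 : forall psi u b, Phi psi -> ndec b p ->
  (forall j a c, (j < p)%N -> (b j <= a)%N -> (c <= b j.+1)%N ->
    forall psi', Phi psi' -> `|psi' (rst a c u) : R| <= 1) ->
  `|psi (rst (b 0%N) (b p) u) : R| <= p%:R / 2.

Let p0 : (0 < p)%N. Proof. exact: ltnW. Qed.

Lemma rst_rst a c a' c' u : rst a c (rst a' c' u) = rst (maxn a a') (minn c c') u.
Proof.
apply/funext => t; apply/funext => l; rewrite /rst.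
have -> : (maxn a a' <= t < minn c c')%N = (a <= t < c)%N && (a' <= t < c')%N by lia.
by case: (a <= t < c)%N.
Qed.

Lemma rst_add a c u v : rst a c (u + v) = rst a c u + rst a c v.
Proof.
apply/funext => t; apply/funext => l; rewrite /rst.
by rewrite -[RHS]/((if _ then _ else _) + (if _ then _ else _) : R); case: ifP => //; rewrite addr0.
Qed.

Lemma rst_scale k a c u : rst a c (k *: u) = k *: rst a c u.
Proof.
apply/funext => t; apply/funext => l; rewrite /rst.
by rewrite -[RHS]/(k * (if _ then _ else _) : R); case: ifP => //; rewrite mulr0.
Qed.

Lemma rst_cat a m c u : (a <= m)%N -> (m <= c)%N -> rst a c u = rst a m u + rst m c u.
Proof.
move=> am mc; apply/funext => t; apply/funext => l; rewrite /rst.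
rewrite -[RHS]/((if _ then _ else _) + (if _ then _ else _) : R).
by case: ifP => h1; case: ifP => h2; case: ifP => h3; rewrite ?addr0 ?add0r//; exfalso; lia.
Qed.

Lemma mass_ge0 u t : 0 <= mass u t. Proof. exact: sumr_ge0. Qed.

(** The value 0 is added so that the supremum behaves well for an empty family. *)
Definition NI a c u : R := sup [set x | x = 0 \/ exists2 psi, Phi psi & x = `|psi (rst a c u) : R|].

Lemma NI_has_sup a c u :
  has_sup [set x | x = 0 \/ exists2 psi, Phi psi & x = `|psi (rst a c u) : R|].
Proof.
split; first by exists 0; left.
exists (\sum_(a <= t < c) mass u t) => _ [->|[psi P ->]]; last exact: Phib.
by apply: sumr_ge0 => t _; exact: mass_ge0.
Qed.

Lemma NI_ge0 a c u : 0 <= NI a c u.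
Proof. by apply: (sup_upper_bound (NI_has_sup a c u)); left. Qed.

Lemma NI_ge a c u psi : Phi psi -> `|psi (rst a c u) : R| <= NI a c u.
Proof. by move=> P; apply: (sup_upper_bound (NI_has_sup a c u)); right; exists psi. Qed.

Lemma NI_le a c u (C : R) : 0 <= C -> (forall psi, Phi psi -> `|psi (rst a c u) : R| <= C) ->
  NI a c u <= C.
Proof.
by move=> C0 PC; apply: ge_sup; [exact: (NI_has_sup a c u).1|move=> _ [->//|[psi /PC h ->]]].
Qed.

Lemma NI_mass a c u : NI a c u <= \sum_(a <= t < c) mass u t.
Proof.
by apply: NI_le => [|psi P]; [apply: sumr_ge0 => t _; exact: mass_ge0|exact: Phib].
Qed.

Lemma NI_empty a c u : (c <= a)%N -> NI a c u = 0.
Proof.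
move=> ca; apply/eqP; rewrite eq_le NI_ge0 andbT; apply: (le_trans (NI_mass a c u)).
by rewrite big_geq.
Qed.

Lemma NI_rst a c a' c' u : NI a c (rst a' c' u) = NI (maxn a a') (minn c c') u.
Proof. by rewrite /NI rst_rst. Qed.

Lemma NI_add a c u v : NI a c (u + v) <= NI a c u + NI a c v.
Proof.
apply: NI_le => [|psi P]; first by rewrite addr_ge0 ?NI_ge0.
have := Philin P 1 (rst a c u) (rst a c v); rewrite !scale1r rst_add => ->.
by apply: (le_trans (ler_normD _ _)); apply: lerD; exact: NI_ge.
Qed.

Lemma NI_scale_le k a c u : NI a c (k *: u) <= `|k| * NI a c u.
Proof.
apply: NI_le => [|psi P]; first by rewrite mulr_ge0 ?NI_ge0.
have psi0 : psi 0 = 0.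
  by have := Philin P (-1) 0 0; rewrite scaler0 addr0 scaleN1r addNr.
have := Philin P k (rst a c u) 0; rewrite psi0 !addr0 rst_scale => ->.
by rewrite normrM ler_wpM2l//; exact: NI_ge.
Qed.

Definition pcut u n (c : nat -> nat) : R := \sum_(k < n) NI (c k) (c k.+1) u ^+ p.

Lemma pcut_ge0 u n c : 0 <= pcut u n c.
Proof. by apply: sumr_ge0 => k _; rewrite exprn_ge0// NI_ge0. Qed.

Definition cuts : set (nat * (nat -> nat)) := [set nc | ndec nc.2 nc.1].

(** A p-variation: taking the supremum over all cuts builds the lower p-estimate [nrm_superadd] into
    the norm. *)
Definition nrm u : R := sup [set proot p (pcut u nc.1 nc.2) | nc in cuts].

Definition summable (u : U) := exists M : R, forall n, \sum_(t < n) mass u t <= M.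

Lemma nrm_has_sup u : summable u -> has_sup [set proot p (pcut u nc.1 nc.2) | nc in cuts].
Proof.
move=> [M uM]; have M0 : 0 <= M by have := uM 0%N; rewrite big_ord0.
split; first by exists (proot p (pcut u 0 id)), (0%N, id).
exists M => _ [[n c] /= nc <-]; rewrite proot_le// ?pcut_ge0//.
apply: (@le_trans _ _ ((\sum_(k < n) NI (c k) (c k.+1) u) ^+ p)).
  by apply: (@sum_pow_le _ _ _ (fun k => NI (c k) (c k.+1) u)) => // i; exact: NI_ge0.
apply: lerXn2r; rewrite ?nnegrE// ?sumr_ge0//; first by move=> k _; exact: NI_ge0.
apply: (@le_trans _ _ (\sum_(k < n) \sum_(c k <= t < c k.+1) mass u t)).
  by apply: ler_sum => k _; exact: NI_mass.
have [c0n ->] := @sum_cuts _ (mass u) c n nc.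
apply: le_trans (uM (c n)); rewrite -(big_mkord xpredT (mass u)).
by rewrite (@big_cat_nat _ _ _ (c 0%N) 0 (c n))//= lerDr sumr_ge0// => t _; exact: mass_ge0.
Qed.

Lemma nrm_ge u n c : summable u -> ndec c n -> pcut u n c <= nrm u ^+ p.
Proof.
move=> us nc; have [r0 {1}<-] := prootP p0 (pcut_ge0 u n c).
have le : proot p (pcut u n c) <= nrm u.
  by apply: (sup_upper_bound (nrm_has_sup us)); exists (n, c).
by apply: lerXn2r; rewrite ?nnegrE// (le_trans r0).
Qed.

Lemma nrm_ge0 u : summable u -> 0 <= nrm u.
Proof.
move=> us; have [r0 _] := prootP p0 (pcut_ge0 u 0 id); apply: (le_trans r0).
by apply: (sup_upper_bound (nrm_has_sup us)); exists (0%N, id).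
Qed.

Lemma nrm_le u (t : R) : 0 <= t -> (forall n c, ndec c n -> pcut u n c <= t ^+ p) -> nrm u <= t.
Proof.
move=> t0 h; apply: ge_sup; first by exists (proot p (pcut u 0 id)), (0%N, id).
by move=> _ [[n c] /= nc <-]; rewrite proot_le ?pcut_ge0 ?h.
Qed.

Lemma nrm_pow_le u (x : R) : summable u -> 0 <= x -> (forall n c, ndec c n -> pcut u n c <= x) ->
  nrm u ^+ p <= x.
Proof.
move=> us x0 h; have [r0 rE] := prootP p0 x0; rewrite -rE lerXn2r ?nnegrE ?nrm_ge0//.
by apply: nrm_le => // n c nc; rewrite rE; exact: h.
Qed.

Lemma mass_rst a c u t : mass (rst a c u) t <= mass u t.
Proof. by apply: ler_sum => l _; rewrite /rst; case: ifP => //; rewrite normr0. Qed.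

Lemma summable_rst a c u : summable u -> summable (rst a c u).
Proof.
move=> [M uM]; exists M => n; apply: le_trans (uM n); apply: ler_sum => t _; exact: mass_rst.
Qed.

Lemma nrm_add u v : summable u -> summable v -> nrm (u + v) <= nrm u + nrm v.
Proof.
move=> us vs; apply: nrm_le => [|n c nc]; first by rewrite addr_ge0 ?nrm_ge0.
apply: (@le_trans _ _ (\sum_(k < n) (NI (c k) (c k.+1) u + NI (c k) (c k.+1) v) ^+ p)).
  by apply: ler_sum => k _; rewrite lerXn2r ?nnegrE ?addr_ge0 ?NI_ge0// NI_add.
apply: (@minkowski _ p n (fun k => NI (c k) (c k.+1) u) (fun k => NI (c k) (c k.+1) v)) => //;
  by [exact: nrm_ge0|move=> i; exact: NI_ge0|exact: nrm_ge].
Qed.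

Lemma nrm_scale_le k u : summable u -> nrm (k *: u) <= `|k| * nrm u.
Proof.
move=> us; apply: nrm_le => [|n c nc]; first by rewrite mulr_ge0 ?nrm_ge0.
rewrite exprMn; apply: le_trans (ler_wpM2l (exprn_ge0 _ (normr_ge0 k)) (nrm_ge us nc)).
rewrite mulr_sumr; apply: ler_sum => i _; rewrite -exprMn.
by rewrite lerXn2r ?nnegrE ?mulr_ge0 ?NI_ge0// NI_scale_le.
Qed.

Lemma pcut_rst u n c a a' : pcut (rst a a' u) n c =
  \sum_(k < n) NI (maxn (c k) a) (minn (c k.+1) a') u ^+ p.
Proof. by apply: eq_bigr => k _; rewrite NI_rst. Qed.

(** Restricting the array amounts to clipping the cut; intervals outside become empty and contribute
    0. *)
Lemma pcut_rst_clip u n c a a' : (a <= a')%N -> ndec c n ->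
  pcut (rst a a' u) n c = pcut u n (fun k => minn a' (maxn a (c k))).
Proof.
move=> aa' nc; rewrite pcut_rst; apply: eq_bigr => k _; congr (_ ^+ p).
have := nc k (ltn_ord k) => ck.
have [h|h] := leqP (minn a' (maxn a (c k.+1))) (minn a' (maxn a (c k))).
  by rewrite !NI_empty//; lia.
by congr NI; lia.
Qed.

Lemma nrm_rst a c u : summable u -> nrm (rst a c u) <= nrm u.
Proof.
move=> us; apply: nrm_le => [|n b nb]; first exact: nrm_ge0.
have [ac|ca] := leqP a c; last first.
  rewrite /pcut big1 ?exprn_ge0 ?nrm_ge0// => k _.
  by rewrite NI_rst NI_empty ?expr0n ?gtn_eqF//; lia.
rewrite pcut_rst_clip//; apply: nrm_ge => // j jn; have := nb j jn; lia.
Qed.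

Lemma NI_nrm a c u : summable u -> NI a c u <= nrm u.
Proof.
move=> us; have [ac|/ltnW ca] := leqP a c; last by rewrite NI_empty ?nrm_ge0.
have := @nrm_ge u 1 (fun k => if k is 0%N then a else c) us.
rewrite /pcut big_ord1/= => h; rewrite -(ler_pXn2r p0) ?nnegrE ?NI_ge0 ?nrm_ge0//.
by apply: h => -[].
Qed.

(** Cuts of the two halves are concatenated. The one extra interval between them, of index [n1], can
    only increase the sum. *)
Lemma nrm_superadd2 a m c u : summable u -> (a <= m)%N -> (m <= c)%N ->
  nrm (rst a m u) ^+ p + nrm (rst m c u) ^+ p <= nrm (rst a c u) ^+ p.
Proof.
move=> us am mc; set X := nrm (rst a c u) ^+ p.
have key n1 c1 n2 c2 : ndec c1 n1 -> ndec c2 n2 ->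
    pcut (rst a m u) n1 c1 + pcut (rst m c u) n2 c2 <= X.
  move=> nc1 nc2; rewrite !pcut_rst_clip//.
  pose d k := if (k <= n1)%N then minn m (maxn a (c1 k)) else minn c (maxn m (c2 (k - n1.+1)%N)).
  have nd : ndec d (n1.+1 + n2).
    move=> j jn; rewrite /d; case: ifP => h1; case: ifP => h2.
    - by have := nc1 j h2; lia.
    - lia.
    - lia.
    - have -> : (j.+1 - n1.+1)%N = (j - n1.+1).+1 by lia.
      by have := nc2 (j - n1.+1)%N (_ : _ < n2)%N; lia.
  have := nrm_ge (summable_rst a c us) nd; rewrite -/X; apply: le_trans.
  rewrite pcut_rst_clip; [|lia|exact: nd].
  rewrite [leRHS]/pcut big_split_ord/= big_ord_recr/= -addrA; apply: lerD.
    apply: ler_sum => k _; have kn := ltn_ord k; rewrite /d !(ltnW kn) kn.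
    by have -> // : forall x y x' y', x = x' -> y = y' -> NI x y u ^+ p <= NI x' y' u ^+ p;
      [move=> > -> ->|lia|lia].
  rewrite -[leLHS]add0r; apply: lerD; first by rewrite exprn_ge0// NI_ge0.
  apply: ler_sum => k _; rewrite /d.
  have -> : (n1.+1 + k <= n1)%N = false by lia.
  have -> : (n1.+1 + k < n1)%N = false by lia.
  have -> : (n1.+1 + k - n1.+1)%N = k by lia.
  have -> : ((n1.+1 + k).+1 - n1.+1)%N = k.+1 by lia.
  by have -> // : forall x y x' y', x = x' -> y = y' -> NI x y u ^+ p <= NI x' y' u ^+ p;
      [move=> > -> ->|lia|lia].
have us1 := summable_rst a m us; have us2 := summable_rst m c us.
have c0 u' : 0 = pcut u' 0 id by rewrite /pcut big_ord0.
rewrite -lerBrDr; apply: nrm_pow_le => //.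
  rewrite subr_ge0; apply: nrm_pow_le => // [|n2 c2 nc2].
    by rewrite exprn_ge0// nrm_ge0//; exact: summable_rst.
  by have := key 0%N id n2 c2; rewrite -c0 add0r; apply.
move=> n1 c1 nc1; rewrite lerBrDr -lerBrDl; apply: nrm_pow_le => // [|n2 c2 nc2].
  by rewrite subr_ge0; have := key n1 c1 0%N id; rewrite -c0 addr0; apply.
by rewrite lerBrDl; exact: key.
Qed.

Lemma nrm_superadd u n b : summable u -> ndec b n ->
  \sum_(j < n) nrm (rst (b j) (b j.+1) u) ^+ p <= nrm (rst (b 0%N) (b n) u) ^+ p.
Proof.
move=> us; elim: n => [|n IH] nb.
  by rewrite big_ord0 exprn_ge0// nrm_ge0//; exact: summable_rst.
have nb' : ndec b n by move=> j jn; apply: nb; exact: ltnW.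
rewrite big_ord_recr/=; apply: (le_trans (lerD (IH nb') (lexx _))).
apply: nrm_superadd2 => //; last exact: nb.
by have [] := @sum_cuts _ (fun=> 0%N) b n nb'.
Qed.

(** The hypothesis concerns all subintervals of the blocks, so that it survives clipping and the
    property can be iterated. *)
Definition bprop n (tau : R) := forall u b, ndec b n ->
  (forall j a c, (j < n)%N -> (b j <= a)%N -> (c <= b j.+1)%N -> NI a c u <= 1) ->
  NI (b 0%N) (b n) u <= tau.

Lemma bprop_p : bprop p (p%:R / 2).
Proof.
move=> u b nb h; apply: NI_le => [|psi P]; first by rewrite divr_ge0.
apply: (Phi3 P nb) => j a c jp ba cb psi' P'.
by apply: (le_trans (NI_ge _ _ _ P')); exact: h cb.
Qed.

Lemma bprop_clip n (tau : R) u b a c : bprop n tau -> 0 <= tau -> ndec b n ->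
  (forall j a c, (j < n)%N -> (b j <= a)%N -> (c <= b j.+1)%N -> NI a c u <= 1) ->
  (b 0 <= a)%N -> (c <= b n)%N -> NI a c u <= tau.
Proof.
move=> bn tau0 nb h b0a cbn; have [ca|ac] := leqP c a; first by rewrite NI_empty.
pose b' j := minn c (maxn a (b j)).
have -> : NI a c u = NI (b' 0%N) (b' n) u by congr NI; rewrite /b'; lia.
apply: bn => [j jn|j a' c' jn ba cb]; first by rewrite /b'; have := nb j jn; lia.
have [ca'|ac'] := leqP c' a'; first by rewrite NI_empty.
by apply: (h j) => //; move: ba cb; rewrite /b'; lia.
Qed.

(** The blocks are grouped by [n]: each group is bounded by [tau], so after division by [tau] the
    groups are [m] blocks bounded by 1. *)
Lemma bprop_mul n m (tau sigma : R) : 0 < tau -> 0 <= sigma ->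
  bprop n tau -> bprop m sigma -> bprop (m * n) (sigma * tau).
Proof.
move=> tau0 s0 bn bm u b nb h.
have := bm (tau^-1 *: u) (fun j => b (j * n)%N).
have scale a c : NI a c (tau^-1 *: u) <= tau^-1 * NI a c u.
  by apply: (le_trans (NI_scale_le _ _ _ _)); rewrite gtr0_norm ?invr_gt0.
have scale' a c : NI a c u <= tau * NI a c (tau^-1 *: u).
  have := NI_scale_le tau a c (tau^-1 *: u).
  by rewrite scalerA divff ?gt_eqF// scale1r gtr0_norm.
rewrite mul0n => hm; apply: (le_trans (scale' _ _)); rewrite mulrC ler_pM2r//.
apply: hm => [j jm|j a c jm ba cb].
  have := @sum_cuts _ (fun=> 0%N) (fun i => b (j * n + i)%N) n.
  have nb' : forall i, (i < n)%N -> (b (j * n + i) <= b (j * n + i.+1))%N.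
    by move=> i iN; rewrite addnS; apply: nb; nia.
  by move=> /(_ nb') [+ _]; rewrite addn0 mulSn addnC.
apply: (le_trans (scale _ _)); rewrite mulrC ler_pdivrMr// mul1r.
apply: (@bprop_clip n tau u (fun i => b (j * n + i)%N)) => //.
- exact: ltW.
- by move=> i iN; rewrite addnS; apply: nb; nia.
- by move=> i a' c' iN ba' ca'; apply: (h (j * n + i)%N) => //; [nia|rewrite -addnS].
- by rewrite addn0.
- by rewrite addnC -mulSn.
Qed.

(** Self-improvement of the block condition: [n = p ^ k] blocks have a sum of at most
    [n / 2 ^ k]. *)
Lemma bprop_pow k : bprop (p ^ k) ((p%:R / 2) ^+ k).
Proof.
elim: k => [|k IH]; first by move=> u b nb h; apply: (h 0%N).
rewrite expnS exprS; apply: bprop_mul IH bprop_p; rewrite ?exprn_gt0 ?divr_ge0//.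
by rewrite divr_gt0// ltr0n.
Qed.

Lemma NI_split a m c u : (a <= m)%N -> (m <= c)%N -> NI a c u <= NI a m u + NI m c u.
Proof.
move=> am mc; apply: NI_le => [|psi P]; first by rewrite addr_ge0 ?NI_ge0.
rewrite (rst_cat u am mc).
have := Philin P 1 (rst a m u) (rst m c u); rewrite !scale1r => ->.
by apply: (le_trans (ler_normD _ _)); apply: lerD; exact: NI_ge.
Qed.

Lemma NI_count n u b : ndec b n ->
  (forall j a c, (j < n)%N -> (b j <= a)%N -> (c <= b j.+1)%N -> NI a c u <= 1) ->
  forall d j a c, (b j <= a)%N -> (c <= b (j + d))%N -> (j + d <= n)%N -> NI a c u <= d%:R.
Proof.
move=> nb h; elim=> [|d IH] j a c ba cb jd.
  by rewrite NI_empty//; move: cb; rewrite addn0; lia.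
have [ca|ac] := leqP c a; first by rewrite NI_empty.
have [bd|db] := leqP (b (j + d)) a.
  apply: (@le_trans _ _ 1); last by rewrite ler1n.
  by apply: (h (j + d)%N) => //; [lia|rewrite -addnS].
have [cd|dc] := leqP c (b (j + d)).
  by apply: (@le_trans _ _ d%:R); [apply: IH cd _ => //; lia|rewrite ler_nat].
apply: (le_trans (NI_split u (ltnW db) (ltnW dc))); rewrite -natr1; apply: lerD.
  by apply: IH (leqnn _) _ => //; lia.
by apply: (h (j + d)%N) => //; [lia|rewrite -addnS].
Qed.

Lemma ndec_find b n x : ndec b n -> (0 < n)%N -> (b 0 <= x)%N -> (x <= b n)%N ->
  exists2 j, (j < n)%N & (b j <= x <= b j.+1)%N.
Proof.
move=> nb n0 bx xb; elim: n n0 nb xb => [//|n IH] _ nb xb.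
have [xn|nx] := leqP x (b n); last by exists n => //; rewrite (ltnW nx).
case: n IH nb xb xn => [|n] IH nb xb xn; first by exists 0%N => //; rewrite bx.
have [//|j jn|//|j jn jx] := IH; first by apply: nb; exact: ltnW.
by exists j => //; exact: ltnW.
Qed.

(** A charging argument. Cut intervals inside one block are paid by the norm of that block, by
    superadditivity. An interval crossing [i.+1] block ends meets [i + 2] blocks, so its [NI] is at
    most [tau] and at most [i + 2]; its p-th power is at most [i.+1] times [2 * tau ^+ p.-1],
    charged to the ends crossed. *)
Lemma nrm_cut_bound n u b (tau : R) : bprop n tau -> 1 <= tau -> (0 < n)%N -> summable u -> ndec b n ->
  (forall j, (j < n)%N -> nrm (rst (b j) (b j.+1) u) <= 1) ->
  nrm (rst (b 0%N) (b n) u) ^+ p <= n%:R * (1 + 2 * tau ^+ p.-1).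
Proof.
move=> bn tau1 n0 us nb h.
have tau0 : 0 <= tau by apply: le_trans tau1.
have tp0 : 0 <= 1 + 2 * tau ^+ p.-1 by rewrite addr_ge0// mulr_ge0// exprn_ge0.
have hN j a c : (j < n)%N -> (b j <= a)%N -> (c <= b j.+1)%N -> NI a c u <= 1.
  move=> jn ba cb; have := NI_nrm a c (summable_rst (b j) (b j.+1) us).
  rewrite NI_rst => hh; apply: le_trans (h j jn); apply: le_trans hh.
  have [ca|ac] := leqP c a; first by rewrite NI_empty// NI_ge0.
  by have -> : NI (maxn a (b j)) (minn c (b j.+1)) u = NI a c u by congr NI; lia.
have [b0n _] := @sum_cuts _ (fun=> 0%N) b n nb.
have nr1 j c : (j < n)%N -> (c <= b j.+1)%N -> nrm (rst (b j) c u) ^+ p <= 1.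
  move=> jn cb; rewrite exprn_ile1// ?nrm_ge0//; first exact: summable_rst.
  apply: le_trans (h j jn).
  have -> : rst (b j) c u = rst (b j) c (rst (b j) (b j.+1) u).
    by rewrite rst_rst; congr rst; lia.
  by apply: nrm_rst; exact: summable_rst.
apply: nrm_pow_le => [||m c0 nc0]; [exact: summable_rst|by rewrite mulr_ge0|].
rewrite pcut_rst_clip//; set c := fun k => _.
have nc : ndec c m by move=> j jm; rewrite /c; have := nc0 j jm; lia.
have cb k : (b 0 <= c k)%N && (c k <= b n)%N by rewrite /c; lia.
have claim : exists2 j, (j < n)%N & (b j <= c m <= b j.+1)%N /\
    pcut u m c <= j%:R * (1 + 2 * tau ^+ p.-1) + nrm (rst (b j) (c m) u) ^+ p.
  elim: m nc {nc0} => [|m IH] nc.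
    have /andP[c1 c2] := cb 0%N; have [j jn jc] := ndec_find nb n0 c1 c2.
    exists j => //; split => //; rewrite /pcut big_ord0 addr_ge0// ?mulr_ge0//.
    by rewrite exprn_ge0// nrm_ge0//; exact: summable_rst.
  have [j jn [/andP[jc1 jc2] jb]] := IH (fun j jm => nc j (ltnW jm)).
  have cm := nc m (ltnSn m).
  rewrite /pcut big_ord_recr/= -/(pcut u m c).
  have [cj|jc] := leqP (c m.+1) (b j.+1).
    exists j; [exact: jn|split; first by rewrite cj andbT (leq_trans jc1 cm)].
    apply: (le_trans (lerD jb (lexx _))); rewrite -addrA lerD2l.
    apply: le_trans (nrm_superadd2 us jc1 cm); rewrite lerD2l.
    rewrite lerXn2r ?nnegrE ?NI_ge0 ?nrm_ge0//; first exact: summable_rst.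
    have := NI_nrm (c m) (c m.+1) (summable_rst (c m) (c m.+1) us).
    by rewrite NI_rst maxnn minnn.
  have /andP[c1 c2] := cb m.+1.
  have nbs : ndec (fun i => b (j.+1 + i)%N) (n - j.+1).
    by move=> i iN; rewrite addnS; apply: nb; lia.
  have [|||i iN /andP[ic1 ic2]] := @ndec_find _ _ (c m.+1) nbs.
  - rewrite subn_gt0 ltnNge; apply/negP => nj; have : n = j.+1 by lia.
    by move=> nE; move: c2; rewrite nE; lia.
  - by rewrite addn0 ltnW.
  - by rewrite subnKC.
  exists (j.+1 + i)%N; first by lia.
  split; first by rewrite ic1 -addnS.
  have NIt : NI (c m) (c m.+1) u <= tau.
    by apply: (bprop_clip bn tau0 nb hN) => //; have /andP[] := cb m.
  have NIc : NI (c m) (c m.+1) u <= (i + 2)%:R.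
    by apply: (NI_count nb hN jc1) => //; [have -> : (j + (i + 2) = j.+1 + i.+1)%N by lia|lia].
  have NIp : NI (c m) (c m.+1) u ^+ p <= (i.+1)%:R * (2 * tau ^+ p.-1).
    rewrite -(prednK p0) exprS/= mulrA; apply: ler_pM; rewrite ?NI_ge0 ?exprn_ge0 ?NI_ge0//.
      by apply: (le_trans NIc); rewrite -natrM ler_nat; lia.
    by rewrite lerXn2r ?nnegrE ?NI_ge0.
  have r0 : 0 <= nrm (rst (b (j.+1 + i)%N) (c m.+1) u) ^+ p.
    by rewrite exprn_ge0// nrm_ge0//; exact: summable_rst.
  apply: (le_trans (lerD jb NIp)).
  have := nr1 j (c m) jn jc2; have i0 : 0 <= i%:R :> R by [].
  rewrite natrD -!natr1; move: r0 tp0; move: (nrm _ ^+ p) (nrm _ ^+ p) (j%:R : R) (i%:R : R) (tau ^+ p.-1) i0.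
  by move=> x y q r z r1 y0 z0 x1; nra.
have [j jn [/andP[jc1 jc2] jb]] := claim; apply: (le_trans jb).
have := nr1 j _ jn jc2; have : j.+1%:R <= n%:R :> R by rewrite ler_nat.
have t0 : 0 <= tau ^+ p.-1 by rewrite exprn_ge0.
rewrite -natr1; move: (nrm _ ^+ p) (n%:R : R) (j%:R : R) (tau ^+ p.-1) t0 => x q r z z0; nra.
Qed.

(** For [n = p ^ k] one has [tau = n / 2 ^ k], and since [p >= 2] the bound of [nrm_cut_bound] is at
    most [4 * n ^ p / 2 ^ k]; [k] is chosen so that [4 / 2 ^ k < eps ^+ p]. *)
Lemma block_small (eps : R) : 0 < eps -> exists2 n, (0 < n)%N & forall u b, summable u -> ndec b n ->
  (forall j, (j < n)%N -> nrm (rst (b j) (b j.+1) u) <= 1) ->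
  nrm (rst (b 0%N) (b n) u) <= eps * n%:R.
Proof.
move=> eps0; have ep : 0 < eps ^+ p / 4 by rewrite divr_gt0// exprn_gt0.
have [k _ /(_ k (leqnn k))] := near_infty_natSinv_expn_lt (PosNum ep).
rewrite /= => kP; pose n := (p ^ k)%N; have n0 : (0 < n)%N by rewrite expn_gt0 p0.
exists n => // u b us nb h.
have nr0 : 0 < n%:R :> R by rewrite ltr0n.
have tauE : (p%:R / 2) ^+ k = n%:R / 2 ^+ k :> R by rewrite exprMn exprVn natrX.
have tau1 : 1 <= (p%:R / 2 : R) ^+ k.
  by rewrite exprn_ege1// ler_pdivlMr// mul1r ler_nat.
have B := nrm_cut_bound (@bprop_pow k) tau1 n0 us nb h.
rewrite -(ler_pXn2r p0) ?nnegrE ?nrm_ge0 ?mulr_ge0 ?(ltW eps0)//; last exact: summable_rst.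
apply: (le_trans B).
have k2 : (2 ^ k <= n)%N.
  by case: (posnP k) => [->//|k0]; rewrite /n leq_exp2r.
have pp : p = p.-2.+2 by lia.
have npp : (n%:R : R) ^+ p = n%:R * (n%:R ^+ p.-1) by rewrite -exprS prednK.
have tp : (p%:R / 2 : R) ^+ k ^+ p.-1 <= n%:R ^+ p.-1 / 2 ^+ k.
  rewrite tauE exprMn ler_wpM2l ?exprn_ge0// exprVn lef_pV2 ?posrE ?exprn_gt0//.
  by rewrite -exprM -!natrX ler_nat leq_exp2l//; nia.
have n1 : 1 <= n%:R ^+ p.-1 / 2 ^+ k :> R.
  rewrite ler_pdivlMr ?exprn_gt0// mul1r -!natrX ler_nat (leq_trans k2)//.
  by rewrite pp/= expnS leq_pmulr// expn_gt0 n0.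
rewrite -/n [leRHS]exprMn npp mulrCA ler_pM2l//.
apply: (@le_trans _ _ (4 * (n%:R ^+ p.-1 / 2 ^+ k))).
  by move: tp n1; move: (_ ^+ p.-1) (_ / 2 ^+ k) => x y; lra.
rewrite mulrCA [leRHS]mulrC ler_wpM2l ?exprn_ge0//.
by move: (ltW kP); rewrite div1r ler_pdivlMr// mulrC.
Qed.

End LowerNorm.

(** * Reflexive duals of spaces of finitely supported arrays *)

Section Tails.
Context {R : realType}.

Lemma ite_sub (b c : bool) (x : R) : (c -> b) ->
  (if b then x else 0) - (if c then x else 0) = if b && ~~ c then x else 0.
Proof. by case: b c => [] [] h; rewrite ?subrr ?subr0//; have := h isT. Qed.

(** Says that the compositions of [G] with the [S n] become arbitrarily small in the dual norm,
    without forming them. *)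
Definition tailsmall (V : normedModType R) (G : V -> R) (S : nat -> V -> V) :=
  forall eps : R, 0 < eps -> exists n, forall x, `|G (S n x)| <= eps * `|x|.

(* A gliding hump: otherwise infinitely many successive blocks of norm at most 1 on
   which f is bounded below would have sums of norm o(n). *)
Lemma tail_small (V : normedModType R) (S : nat -> V -> V) :
  (forall n, linear (S n)) -> (forall n x, `|S n x| <= `|x|) ->
  (forall m n x, S m (S n x) = S (maxn m n) x) ->
  (forall x e, 0 < e -> exists n, `|S n x| <= e) ->
  (forall eps : R, 0 < eps -> exists2 n, (0 < n)%N & forall (x : nat -> V) a, ndec a n ->
    (forall j, (j < n)%N -> [/\ `|x j| <= 1, S (a j) (x j) = x j & S (a j.+1) (x j) = 0]) ->
    `|\sum_(j < n) x j| <= eps * n%:R) ->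
  forall f : dual V, tailsmall f S.
Proof.
move=> Sl Sle SS S0 blk f eps eps0; apply: contrapT => /forallNP H.
have SD n x y : S n (x + y) = S n x + S n y by have := Sl n 1 x y; rewrite !scale1r.
have S00 n : S n 0 = 0 by have := Sl n (-1) 0 0; rewrite scaler0 addr0 scaleN1r addNr.
have SZ n a x : S n (a *: x) = a *: S n x by have := Sl n a x 0; rewrite S00 !addr0.
have f1 : 0 < `|f| + 1 by rewrite ltr_wpDl.
(* A bad [x] is cut off at a far [m], normalised, and given the sign that makes [f] positive. One
   factor 2 pays for the cut-off error, the other for the norm [2 * |x|] of the difference. *)
have claim n : exists ym : V * nat, [/\ (n <= ym.2)%N, `|ym.1| <= 1, S n ym.1 = ym.1,
    S ym.2 ym.1 = 0 & eps / 4 <= f ym.1].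
  have /existsNP[x /negP] := H n; rewrite -ltNge => xP.
  have x0 : 0 < `|x|.
    rewrite lt_def normr_ge0 andbT; apply/negP => /eqP x0; move: xP.
    by rewrite (normr0_eq0 x0) S00 linear0 !normr0 mulr0 ltxx.
  have d0 : 0 < eps * `|x| / (2 * (`|f| + 1)) by rewrite divr_gt0 ?mulr_gt0.
  have [m' hm'] := S0 (S n x) _ d0; pose m := maxn n m'.
  have hm : `|S m (S n x)| <= eps * `|x| / (2 * (`|f| + 1)).
    by rewrite /m -SS; apply: le_trans (Sle _ _) hm'.
  pose z := S n x - S m (S n x).
  have nz : `|z| <= 2 * `|x|.
    apply: (le_trans (ler_normB _ _)); have := Sle m (S n x); have := Sle n x.
    by move: (`|S n x|) (`|S m _|) (`|x|) => a b c; lra.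
  have SN k y : S k (- y) = - S k y by rewrite -scaleN1r SZ scaleN1r.
  have Snz : S n z = z by rewrite /z SD SN !SS maxnn; congr (_ - S _ _); rewrite /m; lia.
  have Smz : S m z = 0.
    by rewrite /z SD SN !SS; apply/eqP; rewrite subr_eq0; apply/eqP; congr (S _ _); rewrite /m; lia.
  have fz : eps * `|x| / 2 <= `|f z : R|.
    have h1 : `|f (S m (S n x)) : R| <= eps * `|x| / 2.
      apply: (le_trans (dual_ub f _)); apply: (@le_trans _ _ ((`|f| + 1) * (eps * `|x| / (2 * (`|f| + 1))))).
        by rewrite ler_pM// lerDl.
      have -> // : (`|f| + 1) * (eps * `|x| / (2 * (`|f| + 1))) = eps * `|x| / 2.
        by field; rewrite gt_eqF.
    have : `|f (S n x) : R| <= `|f z : R| + `|f (S m (S n x)) : R|.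
      by apply: le_trans (ler_normD _ _); rewrite /z linearB/= subrK.
    move: (ltW xP) h1; rewrite -/R.
    by move: (`|f (S n x) : R|) (`|f z : R|) (`|f (S m (S n x)) : R|) (eps * `|x|) => a b c d; lra.
  exists (((Num.sg (f z : R)) / (2 * `|x|)) *: z, m) => /=; split.
  - exact: leq_maxl.
  - rewrite normrZ normrM normfV normrM normr_id (ger0_norm (ler0n _ 2)).
    rewrite mulrAC ler_pdivrMr ?mulr_gt0// mul1r; apply: le_trans nz.
    by rewrite normr_sg; case: (_ == _); rewrite ?mul0r ?mul1r.
  - by rewrite SZ Snz.
  - by rewrite SZ Smz scaler0.
  - rewrite linearZ/=; change (eps / 4 <= Num.sg (f z : R) / (2 * `|x|) * (f z : R)).
    rewrite mulrAC mulrC -normrEsg mulrC ler_pdivlMr ?mulr_gt0//; apply: le_trans fz.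
    by move: (eps) (`|x|) => a b; lra.
have [ym ymP] := choice claim.
pose a j := iter j (fun n => (ym n).2) 0%N.
have e0 : 0 < eps / (8 * (`|f| + 1)) by rewrite divr_gt0 ?mulr_gt0.
have [n n0 blkn] := blk _ e0.
have sn : `|\sum_(j < n) (ym (a j)).1| <= eps / (8 * (`|f| + 1)) * n%:R.
  apply: (blkn (fun j => (ym (a j)).1) a) => j _; first by have [] := ymP (a j).
  by have [h1 h2 h3 h4 _] := ymP (a j); split.
have := dual_ub f (\sum_(j < n) (ym (a j)).1).
have : n%:R * (eps / 4) <= `|f (\sum_(j < n) (ym (a j)).1) : R|.
  rewrite linear_sum/=; apply: le_trans (ler_norm _).
  rewrite mulr_natl -[X in _ *+ X]card_ord -sumr_const; apply: ler_sum => j _.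
  by have [] := ymP (a j).
move=> h1 h2; have h3 : `|f| * `|\sum_(j < n) (ym (a j)).1| <= eps * n%:R / 8.
  apply: (@le_trans _ _ ((`|f| + 1) * (eps / (8 * (`|f| + 1)) * n%:R))).
    by rewrite ler_pM// lerDl.
  have -> : (`|f| + 1) * (eps / (8 * (`|f| + 1)) * n%:R) = eps * n%:R / 8.
    by field; rewrite gt_eqF.
  by [].
have : 0 < eps * n%:R by rewrite mulr_gt0// ltr0n.
move: (le_trans h1 (le_trans h2 h3)); rewrite mulrA [n%:R * _]mulrC.
by move: (eps * n%:R) => x; lra.
Qed.

(** The adjoint of [S], defined by choice so that the term carries no proof of linearity or
    boundedness. *)
Definition dcomp (V : normedModType R) (S : V -> V) (f : dual V) : dual V :=
  xget 0 [set g : dual V | forall x, g x = f (S x)].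

Lemma dcompE (V : normedModType R) (S : V -> V) (f : dual V) :
  linear S -> (forall x, `|S x| <= `|x|) -> forall x, dcomp S f x = f (S x).
Proof.
move=> Sl Sle; have [||g [gE _]] := @dual_ex R V (fun x => f (S x)) `|f|.
- by move=> a u v /=; rewrite Sl linearP.
- move=> z; apply: (le_trans (dual_ub f _)); exact: ler_wpM2l.
by rewrite /dcomp; case: xgetP => [h -> //|/(_ g)].
Qed.

(** A lower estimate dualises to an upper one: successive functionals see [x] through the
    differences of its tails, whose powers sum to at most [|x| ^+ q.+2], and [sum_le_pow] bounds a
    sum of [n] of them by [n * l + 1 / l ^+ q.+1]; with [l = eps / 2] this is below [eps * n] for
    large [n]. *)
Lemma dual_tail_small (V : normedModType R) (S : nat -> V -> V) q :
  (forall n, linear (S n)) -> (forall n x, `|S n x| <= `|x|) ->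
  (forall m n x, S m (S n x) = S (maxn m n) x) ->
  (forall f : dual V, tailsmall f S) ->
  (forall x a n, ndec a n -> \sum_(j < n) `|S (a j) x - S (a j.+1) x| ^+ q.+2 <= `|x| ^+ q.+2) ->
  forall G : dual (dual V), tailsmall G (fun n => dcomp (S n)).
Proof.
move=> Sl Sle SS tails low.
have dE n f x : dcomp (S n) f x = f (S n x) by exact: dcompE.
apply: tail_small.
- move=> n a f g; apply: dual_ext => x; rewrite dE.
  by rewrite -[RHS]/(a * (dcomp (S n) f x : R) + (dcomp (S n) g x : R)) !dE.
- move=> n f; apply: dual_norm_le => x x1; rewrite dE; apply: (le_trans (dual_ub f _)).
  by rewrite ler_piMr// (le_trans (Sle _ _)).
- by move=> m n f; apply: dual_ext => x; rewrite !dE SS maxnC.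
- move=> f e e0; have [n nP] := tails f e e0; exists n; apply: dual_norm_le => x x1.
  by rewrite dE; apply: (le_trans (nP x)); rewrite ler_piMr// ltW.
move=> eps eps0; pose l := eps / 2; have l0 : 0 < l by rewrite divr_gt0.
have [n n0 nP] : exists2 n, (0 < n)%N & n%:R * l + 1 / l ^+ q.+1 <= eps * n%:R.
  exists (Num.truncn (1 / l ^+ q.+1 / l)).+1 => //.
  have E : eps = l + l by rewrite /l -splitr.
  rewrite [X in _ <= X * _]E mulrDl [l * _]mulrC lerD2l -ler_pdivrMr//.
  by apply/ltW/truncnS_gt.
exists n => // f a na fP; apply: dual_norm_le => x x1.
apply: le_trans nP.
have -> : (\sum_(j < n) f j) x = \sum_(j < n) (f j (S (a j) x - S (a j.+1) x) : R).
  rewrite dual_sumE; apply: eq_bigr => j _; have [_ h1 h2] := fP j (ltn_ord j).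
  by rewrite linearB/= -!dE h1 h2 subr0.
apply: (le_trans (ler_norm_sum _ _ _)).
apply: (@le_trans _ _ (\sum_(j < n) `|S (a j) x - S (a j.+1) x|)).
  apply: ler_sum => j _; have [h _ _] := fP j (ltn_ord j).
  by apply: (le_trans (dual_ub (f j) _)); rewrite ler_piMl.
apply: (le_trans (@sum_le_pow R q.+1 n (fun j => `|S (a j) x - S (a j.+1) x|) l l0 _)) => //.
rewrite lerD2l ler_wpM2r ?invr_ge0 ?exprn_ge0 ?(ltW l0)//.
by apply: (le_trans (low x a n na)); rewrite exprn_ile1.
Qed.

End Tails.

(** What the reflexivity proof uses, for all exponents [P.+2] at once. [ffam_block] is the source of
    the upper estimates; [ffam_coord] makes the coordinates continuous and hence the norm
    definite. *)
Record frame (R : realType) := Frame {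
  fdim : nat -> nat;
  ffam : nat -> set ((nat -> nat -> R^o) -> R^o);
  ffam_lin : forall P psi, ffam P psi -> linear psi;
  ffam_mass : forall P psi, ffam P psi -> forall u a c,
    `|psi (rst a c u) : R| <= \sum_(a <= t < c) mass fdim u t;
  ffam_block : forall P psi u b, ffam P psi -> ndec b P.+2 ->
    (forall j a c, (j < P.+2)%N -> (b j <= a)%N -> (c <= b j.+1)%N ->
      forall psi', ffam P psi' -> `|psi' (rst a c u) : R| <= 1) ->
    `|psi (rst (b 0%N) (b P.+2) u) : R| <= P.+2%:R / 2;
  ffam_coord : forall P t l, (l < fdim t)%N ->
    ffam P (fun u => (2^-1 ^+ fdim t : R) * (u t l : R)) }.

(** * The space of a frame: its norm, small tails, and the reflexivity of its dual *)

Section FSpace.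
Context {R : realType} (F : frame R).
Local Notation e := (fdim F).
Local Notation W := (nat -> nat -> nat -> R^o).

Definition fsupp (w : W) B :=
  forall P t l, (B <= P)%N || (B <= t)%N || (e t <= l)%N -> w P t l = 0.

Lemma fsupp_le w B C : fsupp w B -> (B <= C)%N -> fsupp w C.
Proof.
move=> wB BC P t l; move=> /orP[/orP[h|h]|h]; apply: wB.
- by rewrite (leq_trans BC h).
- by rewrite (leq_trans BC h) orbT.
- by rewrite h orbT.
Qed.

Definition is_fin : {pred W} := fun w => `[< exists B, fsupp w B >].

Record fspace := FSp { fval :> W; _ : is_fin fval }.
HB.instance Definition _ := [isSub for fval].
HB.instance Definition _ := [Choice of fspace by <:].

Lemma is_fin_submod : submod_closed is_fin.
Proof.
split; first by apply/asboolP; exists 0%N.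
move=> a v w /asboolP[B vB] /asboolP[C wC]; apply/asboolP; exists (maxn B C) => P t l h.
rewrite -[LHS]/(a * (v P t l : R) + (w P t l : R)).
by rewrite (fsupp_le vB (leq_maxl B C) h) (fsupp_le wC (leq_maxr B C) h) mulr0 addr0.
Qed.

HB.instance Definition _ := GRing.isSubmodClosed.Build R W is_fin is_fin_submod.
HB.instance Definition _ := [SubChoice_isSubLmodule of fspace by <:].

Lemma fspaceP (w : fspace) : exists B, fsupp w B.
Proof. by case: w => w /= /asboolP. Qed.

Lemma fspace_ext (v w : fspace) : (forall P t l, v P t l = w P t l) -> v = w.
Proof.
by move=> h; apply/val_inj/funext => P; apply/funext => t; apply/funext => l; exact: h.
Qed.

Lemma fspaceDE (v w : fspace) P t l : (v + w) P t l = (v P t l : R) + w P t l.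
Proof. by []. Qed.

Lemma fspace_sumE I (r : seq I) (f : I -> fspace) P t l :
  (\sum_(i <- r) f i) P t l = \sum_(i <- r) (f i P t l : R).
Proof. by elim: r => [|i r IH]; rewrite ?big_nil// !big_cons fspaceDE IH. Qed.

Definition fnrm (w : W) P : R := nrm P.+2 (ffam F P) (w P).

Lemma summable_fin w B P : fsupp w B -> summable e (w P).
Proof.
move=> wB; exists (\sum_(t < B) mass e (w P) t) => n.
have z t : (B <= t)%N -> mass e (w P) t = 0.
  by move=> Bt; rewrite /mass big1// => l _; rewrite wB ?normr0// Bt orbT.
elim: n => [|n IH]; first by rewrite big_ord0 sumr_ge0// => t _; exact: mass_ge0.
rewrite big_ord_recr/=; have [nB|Bn] := ltnP n B; last by rewrite z// addr0.
rewrite -(big_ord_recr n (fun t => mass e (w P) t)) -!(big_mkord xpredT (mass e (w P))).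
by rewrite [leRHS](@big_cat_nat _ _ _ n.+1)//= lerDl sumr_ge0// => t _; exact: mass_ge0.
Qed.

Lemma fspace_summable (w : fspace) P : summable e (w P).
Proof. by have [B wB] := fspaceP w; exact: summable_fin wB. Qed.

Definition fbound (w : W) : nat := xget 0%N [set B | fsupp w B].

Definition fnorm (w : fspace) : R := proot 2 (\sum_(P < fbound w) fnrm w P ^+ 2).

Lemma fboundP (w : fspace) : fsupp w (fbound w).
Proof.
have [B wB] := fspaceP w; rewrite /fbound; case: xgetP => [C -> //|/(_ B)]; by case.
Qed.

Lemma fnrm_ge0 (w : fspace) P : 0 <= fnrm w P.
Proof.
exact: (nrm_ge0 (p := P.+2) isT (@ffam_mass R F P) (fspace_summable w P)).
Qed.

Lemma fnrm0 (w : W) P : (forall t l, w P t l = 0) -> fnrm w P = 0.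
Proof.
move=> w0; have wE : w P = 0 by apply/funext => t; apply/funext => l; exact: w0.
have s0 : summable e (w P).
  exists 0 => n; rewrite big1// => t _; rewrite /mass big1// => l _.
  by rewrite wE normr0.
apply/eqP; rewrite eq_le; apply/andP; split; last first.
  exact: (nrm_ge0 (p := P.+2) isT (@ffam_mass R F P) s0).
apply: (nrm_le (p := P.+2) isT (@ffam_mass R F P)) => //.
move=> n c nc; rewrite expr0n/= /pcut big1// => k _.
rewrite (_ : NI _ _ _ _ = 0) ?expr0n//; apply/eqP; rewrite eq_le.
rewrite (NI_ge0 (@ffam_mass R F P)) andbT.
apply: (le_trans (NI_mass (@ffam_mass R F P) _ _ _)).
by rewrite big1// => t _; rewrite /mass big1// => l _; rewrite wE normr0.
Qed.

Lemma fnormE (w : fspace) B : fsupp w B -> 0 <= fnorm w /\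
  fnorm w ^+ 2 = \sum_(P < B) fnrm w P ^+ 2.
Proof.
move=> wB; have h C D : fsupp w C -> (C <= D)%N ->
    \sum_(P < D) fnrm w P ^+ 2 = \sum_(P < C) fnrm w P ^+ 2.
  move=> wC CD; rewrite -!(big_mkord xpredT (fun P => fnrm w P ^+ 2)).
  rewrite (@big_cat_nat _ _ _ C)//= [X in _ + X]big1_seq ?addr0// => P /andP[_].
  by rewrite mem_index_iota => /andP[CP _]; rewrite fnrm0 ?expr0n// => t l; rewrite wC ?CP.
have [] := @prootP R 2 (\sum_(P < fbound w) fnrm w P ^+ 2) isT.
  by rewrite sumr_ge0// => P _; exact: sqr_ge0.
rewrite -/(fnorm w) => n0 nE; split=> //; rewrite nE.
rewrite -(h _ (maxn B (fbound w)) (@fboundP w)) ?leq_maxr//.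
by rewrite (h _ _ wB) ?leq_maxl.
Qed.

Lemma fnorm_ge0 w : 0 <= fnorm w.
Proof. by have [] := fnormE (@fboundP w). Qed.

Lemma fnorm_le (v : fspace) B t : 0 <= t -> fsupp v B ->
  \sum_(P < B) fnrm v P ^+ 2 <= t ^+ 2 -> fnorm v <= t.
Proof.
by move=> t0 vB; have [n0 <-] := fnormE vB; rewrite ler_pXn2r.
Qed.

Lemma fnrm_le (w : fspace) P : fnrm w P <= fnorm w.
Proof.
have [B wB] := fspaceP w; have wC := fsupp_le wB (leq_maxl B P.+1).
have [n0 nE] := fnormE wC; rewrite -(@ler_pXn2r _ 2) ?nnegrE ?fnrm_ge0// nE.
have PB : (P < maxn B P.+1)%N by lia.
by rewrite (bigD1 (Ordinal PB))//= lerDl sumr_ge0// => i _; exact: sqr_ge0.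
Qed.

Lemma fnormD v w : fnorm (v + w) <= fnorm v + fnorm w.
Proof.
have [B vB] := fspaceP v; have [C wC] := fspaceP w; have [D vwD] := fspaceP (v + w).
pose M := maxn D (maxn B C).
apply: (@fnorm_le _ M); first by rewrite addr_ge0 ?fnorm_ge0.
  by apply: fsupp_le vwD _; rewrite leq_maxl.
apply: (@le_trans _ _ (\sum_(P < M) (fnrm v P + fnrm w P) ^+ 2)).
  apply: ler_sum => P _; rewrite lerXn2r ?nnegrE ?addr_ge0 ?fnrm_ge0//.
  exact: (nrm_add (p := P.+2) isT (@ffam_lin R F P) (@ffam_mass R F P) (fspace_summable v P) (fspace_summable w P)).
have sv : \sum_(P < M) fnrm v P ^+ 2 <= fnorm v ^+ 2.
  by have [|_ ->] := @fnormE v M; [apply: fsupp_le vB _; rewrite /M; lia|].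
have sw : \sum_(P < M) fnrm w P ^+ 2 <= fnorm w ^+ 2.
  by have [|_ ->] := @fnormE w M; [apply: fsupp_le wC _; rewrite /M; lia|].
exact: (@minkowski _ 2 M (fnrm v) (fnrm w) _ _ isT (fnorm_ge0 v) (fnorm_ge0 w)
  (fnrm_ge0 v) (fnrm_ge0 w) sv sw).
Qed.

Lemma fnormZ a w : fnorm (a *: w) = `|a| * fnorm w.
Proof.
have le b v : fnorm (b *: v) <= `|b| * fnorm v.
  have [B vB] := fspaceP v; have [D vD] := fspaceP (b *: v).
  have vB' := fsupp_le vB (leq_maxl B D).
  apply: (@fnorm_le _ (maxn B D)); first by rewrite mulr_ge0 ?fnorm_ge0.
    by apply: fsupp_le vD _; rewrite leq_maxr.
  rewrite exprMn; have [_ ->] := fnormE vB'; rewrite mulr_sumr; apply: ler_sum => P _.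
  rewrite -exprMn lerXn2r ?nnegrE ?mulr_ge0 ?fnrm_ge0//.
  exact: (nrm_scale_le (p := P.+2) isT (@ffam_lin R F P) (@ffam_mass R F P) b (fspace_summable v P)).
apply/eqP; rewrite eq_le le /=.
have [->|a0] := eqVneq a 0; first by rewrite normr0 mul0r fnorm_ge0.
by rewrite -ler_pdivlMl ?normr_gt0// -normfV -{1}[w](scalerK a0) le.
Qed.

Lemma coord_le (w : fspace) P t l : (l < e t)%N -> 2^-1 ^+ e t * `|w P t l : R| <= fnorm w.
Proof.
move=> le; apply: le_trans (fnrm_le w P).
have := NI_nrm (p := P.+2) isT (@ffam_mass R F P) t t.+1 (fspace_summable w P).
apply: le_trans; have := NI_ge (@ffam_mass R F P) t t.+1 (w P) (ffam_coord P le).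
by rewrite /rst leqnn ltnSn/= normrM ger0_norm// exprn_ge0.
Qed.

Lemma fnorm0_eq0 w : fnorm w = 0 -> w = 0.
Proof.
move=> w0; apply: fspace_ext => P t l; have [B wB] := fspaceP w.
have [le|le] := ltnP l (e t); last by rewrite wB// le orbT.
have := coord_le w P le; rewrite w0 pmulr_rle0 ?exprn_gt0//.
by rewrite normr_le0 => /eqP.
Qed.

HB.instance Definition _ := Lmodule_isNormed.Build R fspace fnormD fnormZ fnorm0_eq0.

Lemma fspace_normE (w : fspace) : `|w| = fnorm w. Proof. by []. Qed.

Lemma res_fin (A : nat -> nat -> bool) (w : fspace) :
  is_fin (fun P t l => if A P t then w P t l else 0).
Proof.
have [B wB] := fspaceP w; apply/asboolP; exists B => P t l h.
by case: ifP => // _; exact: wB.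
Qed.

Definition fres A w : fspace := FSp (res_fin A w).

(** Index sets that meet each row [P] in an interval: restriction to them is [rst] row by row, and
    so does not increase the norm. *)
Definition iconv (A : nat -> nat -> bool) := forall P a t c,
  (a <= t)%N -> (t <= c)%N -> A P a -> A P c -> A P t.

Lemma iconv_rst (A : nat -> nat -> bool) P B : iconv A ->
  exists a c, forall t, (t < B)%N -> A P t = (a <= t < c)%N.
Proof.
move=> Ac; elim: B => [|B [a [c ac]]]; first by exists 0%N, 0%N.
have [AB|AB] := boolP (A P B); last first.
  exists a, (minn c B) => t; rewrite ltnS leq_eqVlt => /orP[/eqP ->|tB].
    by rewrite (negbTE AB); lia.
  by rewrite ac//; lia.
have [aB|Ba] := ltnP a (minn c B); last first.
  exists B, B.+1 => t; rewrite ltnS leq_eqVlt => /orP[/eqP ->|tB].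
    by rewrite AB; lia.
  by rewrite ac//; lia.
exists a, B.+1 => t tB; have [ta|at_] := ltnP t a; first by rewrite ac//; lia.
have -> : A P t; last by lia.
by apply: (Ac P a t B) => //; rewrite ac; lia.
Qed.

Lemma fres_rst A (w : fspace) P : iconv A -> exists a c, fres A w P = rst a c (w P).
Proof.
move=> Ac; have [B wB] := fspaceP w; have [a [c ac]] := iconv_rst P B Ac.
exists a, c; apply/funext => t; apply/funext => l; rewrite /= /rst.
have [tB|Bt] := ltnP t B; first by rewrite ac.
by rewrite wB ?Bt ?orbT//; do 2 case: ifP.
Qed.

Lemma fres_le A w : iconv A -> `|fres A w| <= `|w|.
Proof.
move=> Ac; have [B wB] := fspaceP w; have [C rC] := fspaceP (fres A w).
apply: (@fnorm_le _ (maxn C B)); [exact: fnorm_ge0|by apply: fsupp_le rC _; exact: leq_maxl|].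
have [_ ->] := fnormE (fsupp_le wB (leq_maxr C B)); apply: ler_sum => P _.
rewrite lerXn2r ?nnegrE ?fnrm_ge0//; have [a [c E]] := fres_rst w P Ac.
rewrite /fnrm E; exact: (nrm_rst (p := P.+2) isT (@ffam_mass R F P) a c (fspace_summable w P)).
Qed.

Lemma fres_linear A : linear (fres A).
Proof.
move=> a v w; apply: fspace_ext => P t l.
rewrite -[RHS]/(a * (if _ then _ else _ : R) + (if _ then _ else _ : R)) /=.
by case: ifP => // _; rewrite mulr0 addr0.
Qed.

Lemma fres_res A A' w : fres A (fres A' w) = fres (fun P t => A P t && A' P t) w.
Proof. by apply: fspace_ext => P t l /=; case: (A P t). Qed.

Lemma fnorm_single (w : fspace) P0 : (forall P t l, P != P0 -> w P t l = 0) ->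
  fnorm w = fnrm w P0.
Proof.
move=> w0; apply/eqP; rewrite eq_le fnrm_le andbT.
have [B wB] := fspaceP w; have wC := fsupp_le wB (leq_maxl B P0.+1).
apply: (fnorm_le (fnrm_ge0 _ _) wC).
have PB : (P0 < maxn B P0.+1)%N by lia.
rewrite (bigD1 (Ordinal PB))//= big1 ?addr0// => i iP.
by rewrite fnrm0 ?expr0n// => t l; apply: w0; apply: contra iP => /eqP iP; apply/eqP/val_inj.
Qed.

Definition tailP n := fres (fun P _ => (n <= P)%N).
Definition tailt P0 n := fres (fun P t => (P == P0) && (n <= t)%N).

Lemma iconvP n : iconv (fun P _ => (n <= P)%N). Proof. by []. Qed.
Lemma iconvt P0 n : iconv (fun P t => (P == P0) && (n <= t)%N).
Proof.
by move=> P a t c at_ _ /andP[-> na] _; rewrite (leq_trans na at_).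
Qed.

(** Rows are combined in l_2, so the squared norm of [n] blocks on disjoint sets of rows is at most
    [n], which is below [(eps * n) ^ 2] once [n >= 1 / eps ^+ 2]. *)
Lemma tailP_blocks (eps : R) : 0 < eps -> exists2 n, (0 < n)%N &
  forall (x : nat -> fspace) a, ndec a n ->
    (forall j, (j < n)%N -> [/\ `|x j| <= 1, tailP (a j) (x j) = x j & tailP (a j.+1) (x j) = 0]) ->
    `|\sum_(j < n) x j| <= eps * n%:R.
Proof.
move=> eps0; pose n := (Num.truncn (1 / eps ^+ 2)).+1; exists n => // x a na xP.
have nP : 1 / eps ^+ 2 <= n%:R by apply/ltW/truncnS_gt.
have xz j P t l : (j < n)%N -> ~~ (a j <= P < a j.+1)%N -> x j P t l = 0.
  move=> jn /nandP[h|h]; have [_ h1 h2] := xP j jn.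
    by rewrite -h1 /= (negbTE h).
  by have := congr1 (fun w : fspace => w P t l) h2; rewrite /= leqNgt h.
have [B wB] := fspaceP (\sum_(j < n) x j).
pose C := (maxn B (\max_(j < n) fbound (x j)))%N.
have xC j : (j < n)%N -> fsupp (x j) C.
  move=> jn; apply: fsupp_le (@fboundP (x j)) _; rewrite /C leq_max; apply/orP; right.
  exact: (leq_bigmax (Ordinal jn)).
apply: (@fnorm_le _ C); [by rewrite mulr_ge0// ltW|by apply: fsupp_le wB _; exact: leq_maxl|].
apply: (@le_trans _ _ (\sum_(P < C) \sum_(j < n) fnrm (x j) P ^+ 2)).
  apply: ler_sum => P _.
  have s0 : 0 <= \sum_(j < n) fnrm (x j) P ^+ 2 by apply: sumr_ge0 => j _; exact: sqr_ge0.
  have [[j0 jP]|/forallNP no] := pselect (exists j0 : 'I_n, (a j0 <= P < a j0.+1)%N).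
    rewrite [leRHS](bigD1 j0)//= -[leLHS]addr0 lerD//; last by apply: sumr_ge0 => j _; exact: sqr_ge0.
    rewrite lerXn2r ?nnegrE ?fnrm_ge0// le_eqVlt; apply/orP; left; apply/eqP.
    congr nrm; apply/funext => t; apply/funext => l; rewrite fspace_sumE (bigD1 j0)//= big1 ?addr0//.
    move=> j jj; apply: xz => //; apply/negP => jP'; case/negP: jj; apply/eqP/val_inj => /=.
    have mono i k : (i <= k)%N -> (k <= n)%N -> (a i <= a k)%N.
      move=> ik; elim: k ik => [|k IH]; first by rewrite leqn0 => /eqP ->.
      rewrite leq_eqVlt => /orP[/eqP -> //|ik] kn.
      by apply: leq_trans (na k kn); apply: IH => //; exact: ltnW.
    have [h|h|//] := ltngtP j j0.
      by have := mono j.+1 j0 h (ltnW (ltn_ord j0)); lia.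
    by have := mono j0.+1 j h (ltnW (ltn_ord j)); lia.
  rewrite fnrm0 ?expr0n// => t l; rewrite fspace_sumE big1// => j _.
  by apply: xz => //; apply/negP/no.
rewrite exchange_big/=; apply: (@le_trans _ _ (\sum_(j < n) 1)).
  apply: ler_sum => j _; have [_ <-] := fnormE (xC j (ltn_ord j)).
  by rewrite exprn_ile1// ?fnorm_ge0//; have [] := xP j (ltn_ord j).
rewrite sumr_const card_ord exprMn [n%:R ^+ 2]expr2 mulrA ler_peMl//.
by rewrite mulrC -ler_pdivrMr ?exprn_gt0.
Qed.

Lemma tailt_blocks P0 (eps : R) : 0 < eps -> exists2 n, (0 < n)%N &
  forall (x : nat -> fspace) a, ndec a n ->
    (forall j, (j < n)%N ->
      [/\ `|x j| <= 1, tailt P0 (a j) (x j) = x j & tailt P0 (a j.+1) (x j) = 0]) ->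
    `|\sum_(j < n) x j| <= eps * n%:R.
Proof.
move=> eps0.
have [n n0 nP] := block_small (p := P0.+2) isT (@ffam_lin R F P0)
  (@ffam_mass R F P0) (@ffam_block R F P0) eps0.
exists n => // x a na xP.
have xz j P t l : (j < n)%N -> ~~ ((P == P0) && (a j <= t < a j.+1)%N) -> x j P t l = 0.
  move=> jn h; have [_ h1 h2] := xP j jn.
  have := congr1 (fun w : fspace => w P t l) h2; rewrite -h1 /=.
  case: eqP h => //= _ /nandP[h _|]; first by rewrite (negbTE h).
  by rewrite -leqNgt => ->.
have mono i k : (i <= k)%N -> (k <= n)%N -> (a i <= a k)%N.
  move=> ik; elim: k ik => [|k IH]; first by rewrite leqn0 => /eqP ->.
  rewrite leq_eqVlt => /orP[/eqP -> //|ik] kn.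
  by apply: leq_trans (na k kn); apply: IH => //; exact: ltnW.
set w := \sum_(j < n) x j.
have wE (j : 'I_n) : rst (a j) (a j.+1) (w P0) = x j P0.
  apply/funext => t; apply/funext => l; rewrite /rst; case: ifP => h; last first.
    by rewrite xz// h andbF.
  rewrite fspace_sumE (bigD1 j)//= big1 ?addr0// => i ij; apply: xz => //.
  apply/negP => /andP[_ h']; case/negP: ij; apply/eqP/val_inj => /=.
  have [ij|ij|//] := ltngtP i j.
    by have := mono i.+1 j ij (ltnW (ltn_ord j)); lia.
  by have := mono j.+1 i ij (ltnW (ltn_ord i)); lia.
have wr : rst (a 0%N) (a n) (w P0) = w P0.
  apply/funext => t; apply/funext => l; rewrite /rst; case: ifP => // h.
  rewrite fspace_sumE big1// => i _; apply: xz => //; apply/negP => /andP[_ h'].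
  have := mono 0%N i isT (ltnW (ltn_ord i)); have := mono i.+1 n (ltn_ord i) (leqnn n); lia.
rewrite fspace_normE (@fnorm_single _ P0); last first.
  by move=> P t l PP; rewrite fspace_sumE big1// => i _; rewrite xz// (negbTE PP).
rewrite /fnrm -wr; apply: nP => //; first exact: fspace_summable.
move=> j jn; rewrite (wE (Ordinal jn))/=; have [h _ _] := xP j jn.
exact: le_trans (fnrm_le _ _) h.
Qed.

Lemma tailP_small (f : dual fspace) : tailsmall f tailP.
Proof.
apply: (@tail_small R fspace tailP) => //.
- by move=> n; exact: fres_linear.
- by move=> n x; apply: fres_le; exact: iconvP.
- move=> m n x; rewrite /tailP fres_res; apply: fspace_ext => P t l /=.
  by rewrite geq_max.
- move=> x d d0; have [B xB] := fspaceP x; exists B.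
  have -> : tailP B x = 0; last by rewrite normr0 ltW.
  by apply: fspace_ext => P t l /=; case: ifP => // h; rewrite xB// h.
- exact: tailP_blocks.
Qed.

Lemma tailt_comp P m n x : tailt P m (tailt P n x) = tailt P (maxn m n) x.
Proof.
rewrite /tailt fres_res; apply: fspace_ext => P' t l /=.
by rewrite geq_max; case: (P' == P).
Qed.

Lemma tailt_small P (f : dual fspace) : tailsmall f (tailt P).
Proof.
apply: (@tail_small R fspace (tailt P)) => //.
- by move=> n; exact: fres_linear.
- by move=> n x; apply: fres_le; exact: iconvt.
- exact: tailt_comp.
- move=> x d d0; have [B xB] := fspaceP x; exists B.
  have -> : tailt P B x = 0; last by rewrite normr0 ltW.
  by apply: fspace_ext => P' t l /=; case: ifP => // /andP[_ h]; rewrite xB// h orbT.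
- exact: tailt_blocks.
Qed.

Lemma dtailP_small (G : dual (dual fspace)) : tailsmall G (fun n => dcomp (tailP n)).
Proof.
apply: (@dual_tail_small R fspace tailP 0) => //.
- by move=> n; exact: fres_linear.
- by move=> n x; apply: fres_le; exact: iconvP.
- by move=> m n x; rewrite /tailP fres_res; apply: fspace_ext => P t l /=; rewrite geq_max.
- exact: tailP_small.
move=> x a n na; have [B xB] := fspaceP x.
have dE j P t l : (j < n)%N -> (tailP (a j) x - tailP (a j.+1) x) P t l =
    if (a j <= P < a j.+1)%N then x P t l else 0.
  move=> jn; have := na j jn => aj.
  rewrite -[LHS]/((if _ then _ else _ : R) - (if _ then _ else _ : R)).
  by apply: etrans (ite_sub _ _) _; [lia|rewrite -ltnNge].
have dB j : (j < n)%N -> fsupp (tailP (a j) x - tailP (a j.+1) x) B.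
  by move=> jn P t l h; rewrite dE//; case: ifP => // _; exact: xB.
have [_ ->] := fnormE xB.
have -> : \sum_(j < n) `|tailP (a j) x - tailP (a j.+1) x| ^+ 2 =
    \sum_(j < n) \sum_(P < B) fnrm (tailP (a j) x - tailP (a j.+1) x) P ^+ 2.
  by apply: eq_bigr => j _; have [_ ->] := fnormE (dB j (ltn_ord j)).
rewrite exchange_big/=; apply: ler_sum => P _.
have h (y : nat -> fspace) : (forall j P t l, (j < n)%N ->
      y j P t l = if (a j <= P < a j.+1)%N then x P t l else 0) ->
    forall k, (k <= n)%N -> \sum_(j < k) fnrm (y j) P ^+ 2 <=
      if (P < a k)%N then fnrm x P ^+ 2 else 0.
  move=> yE; elim=> [|k IH] kn; first by rewrite big_ord0; case: ifP => // _; exact: sqr_ge0.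
  rewrite big_ord_recr/=; have ak := na k kn; have {IH} := IH (ltnW kn).
  have [Pk|kP] := ltnP P (a k) => IH.
    rewrite (leq_trans Pk ak) [X in _ + X ^+ 2]fnrm0 ?expr0n ?addr0// => t l.
    by rewrite yE// leqNgt Pk.
  have [Pk'|kP'] := ltnP P (a k.+1); last first.
    rewrite [X in _ + X ^+ 2]fnrm0 ?expr0n ?addr0// => t l.
    by rewrite yE// [(P < _)%N]ltnNge kP' andbF.
  rewrite -[leRHS]add0r lerD// le_eqVlt; apply/orP; left; apply/eqP; congr (nrm _ _ _ ^+ 2).
  by apply/funext => t; apply/funext => l; rewrite yE// kP Pk'.
by apply: (le_trans (h _ dE n (leqnn n))); case: ifP => // _; exact: sqr_ge0.
Qed.

Lemma dtailt_small P (G : dual (dual fspace)) : tailsmall G (fun n => dcomp (tailt P n)).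
Proof.
apply: (@dual_tail_small R fspace (tailt P) P) => //.
- by move=> n; exact: fres_linear.
- by move=> n x; apply: fres_le; exact: iconvt.
- exact: tailt_comp.
- exact: tailt_small.
move=> x a n na.
have dE j P' t l : (j < n)%N -> (tailt P (a j) x - tailt P (a j.+1) x) P' t l =
    if (P' == P) && (a j <= t < a j.+1)%N then x P' t l else 0.
  move=> jn; have := na j jn => aj.
  rewrite -[LHS]/((if _ then _ else _ : R) - (if _ then _ else _ : R)).
  case: (P' == P) => /=; last by rewrite subr0.
  by apply: etrans (ite_sub _ _) _; [lia|rewrite -ltnNge].
have xs := fspace_summable x P.
apply: (@le_trans _ _ (\sum_(j < n) nrm P.+2 (ffam F P) (rst (a j) (a j.+1) (x P)) ^+ P.+2)).
  apply: ler_sum => j _; rewrite fspace_normE (@fnorm_single _ P).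
    rewrite le_eqVlt; apply/orP; left; apply/eqP; congr (nrm _ _ _ ^+ _).
    by apply/funext => t; apply/funext => l; rewrite dE// eqxx.
  by move=> P' t l PP; rewrite dE// (negbTE PP).
apply: (le_trans (nrm_superadd (p := P.+2) isT (@ffam_mass R F P) xs na)).
rewrite lerXn2r ?nnegrE ?fnorm_ge0//.
  exact: (nrm_ge0 (p := P.+2) isT (@ffam_mass R F P) (summable_rst _ _ xs)).
apply: le_trans (fnrm_le x P).
exact: (nrm_rst (p := P.+2) isT (@ffam_mass R F P) _ _ xs).
Qed.

Definition corner N n P t := (P < N)%N && (t < n)%N.

Lemma iconvc N n : iconv (corner N n).
Proof.
by move=> P a t c _ tc _ /andP[PN cn]; rewrite /corner PN (leq_ltn_trans tc cn).
Qed.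

Lemma corner_decomp N n w :
  w = tailP N w + \sum_(P < N) tailt P n w + fres (corner N n) w.
Proof.
apply: fspace_ext => P t l; rewrite !fspaceDE fspace_sumE /= /corner.
have [NP|PN] := leqP N P.
  rewrite addr0 big1 ?addr0// => i _; case: eqP => //= h.
  by have := ltn_ord i; rewrite -h ltnNge NP.
rewrite add0r (bigD1 (Ordinal PN))//= eqxx/= big1 ?addr0; last first.
  by move=> i iP; case: eqP => //= h; case/negP: iP; apply/eqP/val_inj.
by case: leqP; rewrite ?addr0 ?add0r.
Qed.

(** [T] is the identity for functionals on the space and the adjoint for functionals on its dual, so
    one argument serves both: finitely many rows matter, and in each of them finitely many nodes. *)
Lemma corner_approx (V : normedModType R) (T : (fspace -> fspace) -> V -> V) (G : {linear V -> R^o}) :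
  (forall N n x, x = T (tailP N) x + \sum_(P < N) T (tailt P n) x + T (fres (corner N n)) x) ->
  (forall P n x, `|T (tailt P n) x| <= `|x|) ->
  (forall P m n x, T (tailt P m) (T (tailt P n) x) = T (tailt P (maxn m n)) x) ->
  tailsmall (G : V -> R) (fun n => T (tailP n)) ->
  (forall P, tailsmall (G : V -> R) (fun n => T (tailt P n))) ->
  forall eps : R, 0 < eps -> exists N n, forall x,
    `|(G x : R) - G (T (fres (corner N n)) x)| <= eps * `|x|.
Proof.
move=> dec le comp GP Gt eps eps0.
have e2 : 0 < eps / 2 by rewrite divr_gt0.
have [N NP] := GP _ e2; pose d := eps / 2 / N.+1%:R; have d0 : 0 < d by rewrite divr_gt0.
have [n nP] : exists n, forall P, (P < N)%N -> forall x, `|G (T (tailt P n) x) : R| <= d * `|x|.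
  elim: (N) => [|M [n nP]]; first by exists 0%N.
  have [m mP] := Gt M d d0; exists (maxn m n) => P; rewrite ltnS leq_eqVlt.
  move=> /orP[/eqP ->|PM] x.
    by rewrite -comp; apply: (le_trans (mP _)); rewrite ler_wpM2l// ltW.
  by rewrite maxnC -comp; apply: (le_trans (nP _ PM _)); rewrite ler_wpM2l// ltW.
exists N, n => x; rewrite {1}(dec N n x) linearD/= -[X in `|X|]/((_ + _ : R) - _) addrK.
rewrite linearD/= linear_sum/=; apply: (le_trans (ler_normD _ _)).
rewrite (splitr eps) mulrDl lerD//; apply: (le_trans (ler_norm_sum _ _ _)).
apply: (@le_trans _ _ (\sum_(P < N) d * `|x|)).
  by apply: ler_sum => P _; apply: nP.
rewrite sumr_const card_ord -[X in X <= _]mulr_natl mulrA ler_wpM2r// /d mulrCA ler_piMr ?(ltW e2)//.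
by rewrite ler_pdivrMr// mul1r ler_nat.
Qed.

Definition fcoord (x : nat * nat * nat) : dual fspace :=
  xget 0 [set g : dual fspace | forall w : fspace, g w = w x.1.1 x.1.2 x.2].

Lemma fcoordE P t l (w : fspace) : (l < e t)%N -> fcoord (P, t, l) w = w P t l.
Proof.
move=> le; have [||g [gE _]] := @dual_ex R fspace (fun w : fspace => w P t l) (2 ^+ e t).
- by move=> a u v.
- move=> z; have := coord_le z P le.
  by rewrite exprVn mulrC ler_pdivrMr ?exprn_gt0// mulrC.
by rewrite /fcoord; case: xgetP => [h -> //|/(_ g)].
Qed.

Lemma delta_fin P t l : (l < e t)%N ->
  is_fin (fun P' t' l' => if [&& P' == P, t' == t & l' == l] then 1 else 0 : R^o).
Proof.
move=> le; apply/asboolP; exists (maxn P t).+1 => P' t' l' h.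
by case: ifP => // /and3P[/eqP E1 /eqP E2 /eqP E3]; move: h; rewrite E1 E2 E3; lia.
Qed.

Definition fdelta (x : nat * nat * nat) : fspace :=
  xget 0 [set w : fspace | forall P t l, w P t l = if (P, t, l) == x then 1 else 0 : R^o].

Lemma fdeltaE P' t' l' P t l : (l < e t)%N ->
  fdelta (P, t, l) P' t' l' = (if (P', t', l') == (P, t, l) then 1 else 0 : R^o).
Proof.
move=> le; rewrite /fdelta; case: xgetP => [w _ -> //|/(_ (FSp (delta_fin P le)))/=].
by case=> P2 t2 l2 /=; rewrite !xpair_eqE andbA.
Qed.

Definition cindex N n : seq (nat * nat * nat) :=
  undup [seq (y, l) | y <- [seq (P, t) | P <- iota 0 N, t <- iota 0 n], l <- iota 0 (e y.2)].

Lemma mem_cindex N n P t l : ((P, t, l) \in cindex N n) = [&& (P < N)%N, (t < n)%N & (l < e t)%N].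
Proof.
rewrite mem_undup; apply/allpairsPdep/idP => /=.
  move=> [y [l' [/allpairsPdep[P' [t' []]]]]]; rewrite !mem_iota !add0n /=.
  by move=> PN tn -> le [-> -> ->]; rewrite PN tn.
move=> /and3P[PN tn le]; exists (P, t), l; rewrite mem_iota le; split=> //.
by apply/allpairsPdep; exists P, t; rewrite !mem_iota.
Qed.

Lemma fres_corner N n w :
  fres (corner N n) w = \sum_(x <- cindex N n) fcoord x w *: fdelta x.
Proof.
apply: fspace_ext => P t l; rewrite fspace_sumE /=.
have [B wB] := fspaceP w.
have [h|h] := boolP ((P, t, l) \in cindex N n).
  rewrite (bigD1_seq _ h) ?undup_uniq//= big1_seq ?addr0.
    move: h; rewrite mem_cindex /corner => /and3P[-> -> le] /=.
    by rewrite -[RHS]/((fcoord _ w : R) * (fdelta _ P t l : R)) fdeltaE// eqxx mulr1 fcoordE.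
  move=> [[P' t'] l'] /andP[xP]; rewrite mem_cindex => /and3P[_ _ le].
  by rewrite -[LHS]/((fcoord _ w : R) * (fdelta _ P t l : R)) fdeltaE// eq_sym (negbTE xP) mulr0.
rewrite big1_seq; last first.
  move=> [[P' t'] l'] /andP[_ xin]; move: (xin); rewrite mem_cindex => /and3P[_ _ le].
  by rewrite -[LHS]/((fcoord _ w : R) * (fdelta _ P t l : R)) fdeltaE//; case: eqP => [E|]; [rewrite E xin in h|rewrite mulr0].
move: h; rewrite mem_cindex /corner; case: ifP => [/andP[-> ->]/=|//]; rewrite -leqNgt => h.
by rewrite wB// h orbT.
Qed.

Lemma fdual_approx (f : dual fspace) (eps : R) : 0 < eps -> exists N n,
  `|f - \sum_(x <- cindex N n) f (fdelta x) *: fcoord x| <= eps.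
Proof.
move=> eps0; have [|||N [n h]] := @corner_approx fspace id f _ _ _ (tailP_small f)
  (fun P => tailt_small P f) eps eps0.
- by move=> N n x; exact: corner_decomp.
- by move=> P n x; apply: fres_le; exact: iconvt.
- exact: tailt_comp.
exists N, n; apply: dual_norm_le => w w1; apply: le_trans (_ : eps * `|w| <= _); last first.
  by rewrite ler_piMr// ltW.
apply: le_trans (h w); rewrite le_eqVlt; apply/orP; left; apply/eqP; congr `|_|.
rewrite -[LHS]/((f w : R) - (\sum_(x <- cindex N n) f (fdelta x) *: fcoord x : dual fspace) w).
congr (_ - _); rewrite fres_corner [RHS]linear_sum/=.
elim: (cindex N n) => [|x s IH]; first by rewrite !big_nil.
rewrite !big_cons linearZ/= -IH -[LHS]/((f (fdelta x) : R) * (fcoord x w : R) + _).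
by rewrite mulrC.
Qed.

Lemma fspace_dual_separable : separable (dual fspace).
Proof.
apply: (@span_separable R (dual fspace) (nat * nat * nat)%type fcoord) => f d d0.
have d2 : 0 < d / 2 by rewrite divr_gt0.
have [N [n h]] := fdual_approx f d2.
exists [seq (f (fdelta x) : R, x) | x <- cindex N n].
rewrite /lincomb big_map/=; apply: le_lt_trans h _.
by rewrite ltr_pdivrMr// ltr_pMr// ltr1n.
Qed.

(** Smallness on tails puts any [H] of the bidual of the space within [eps / K] of the evaluation at
    a finite array. Evaluations [J w] are thus dense there, and [G] is determined by its values on
    them, which define [f]. *)
Lemma fspace_dual_reflexive : reflexive_space (dual fspace).
Proof.
move=> G.
have [J JP] := choice (fun w : fspace => @eval_dual R fspace w).
have JE w f : J w f = f w by have [] := JP w.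
have [||f [fE _]] := @dual_ex R fspace (fun w => G (J w)) `|G|.
- move=> a u v /=; rewrite -linearP; congr (G _); apply: dual_ext => f.
  by rewrite JE linearP -[RHS]/(a *: (J u f : R^o) + J v f) !JE.
- move=> w; apply: (le_trans (dual_ub G _)); rewrite ler_wpM2l//.
  by have [] := JP w.
exists f => H; apply/eqP; rewrite -subr_eq0 -normr_le0; apply/ler_addgt0Pr => eps eps0.
rewrite add0r; pose K := `|G| + `|f| + 1.
have K0 : 0 < K by rewrite ltr_wpDl// addr_ge0.
have eK : 0 < eps / K by rewrite divr_gt0.
have cE (A : nat -> nat -> bool) (g : dual fspace) w : iconv A -> dcomp (fres A) g w = g (fres A w).
  by move=> cA; apply: dcompE; [exact: fres_linear|move=> x; exact: fres_le].
have [|||N [n h]] := @corner_approx (dual fspace) (@dcomp R fspace) H _ _ _ (dtailP_small H)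
  (fun P => dtailt_small P H) (eps / K) eK.
- move=> N n g; apply: dual_ext => w.
  rewrite -[RHS]/((dcomp (tailP N) g w : R) + (\sum_(P < N) dcomp (tailt P n) g) w +
    (dcomp (fres (corner N n)) g w : R)).
  rewrite dual_sumE !cE//; last exact: iconvc.
  rewrite [X in _ + X + _](eq_bigr (fun P : 'I_N => g (tailt P n w) : R)); last first.
    by move=> P _; rewrite cE//; exact: iconvt.
  by rewrite {1}(corner_decomp N n w) !linearD/= linear_sum.
- move=> P n g; apply: dual_norm_le => x x1; rewrite cE; last exact: iconvt.
  apply: (le_trans (dual_ub g _)); rewrite ler_piMr//.
  by apply: le_trans x1; apply: fres_le; exact: iconvt.
- move=> P m n g; apply: dual_ext => x; rewrite !cE; do ?exact: iconvt.
  by congr (g _); rewrite -/(tailt P n _) -/(tailt P m _) -/(tailt P _ _) tailt_comp maxnC.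
pose w := \sum_(x <- cindex N n) H (fcoord x) *: fdelta x.
have HJ (g : dual fspace) : H (dcomp (fres (corner N n)) g) = J w g.
  have -> : dcomp (fres (corner N n)) g = \sum_(x <- cindex N n) g (fdelta x) *: fcoord x.
    apply: dual_ext => v; rewrite cE; last exact: iconvc.
    rewrite fres_corner linear_sum/=.
    elim: (cindex N n) => [|x s IH]; first by rewrite !big_nil.
    rewrite !big_cons linearZ/= IH -[RHS]/((g (fdelta x) : R) * (fcoord x v : R) + _).
    by rewrite mulrC.
  rewrite JE !linear_sum; apply: eq_bigr => x _.
  by rewrite !linearZ/= -[LHS]/(_ * _ : R) mulrC.
have HJn : `|H - J w| <= eps / K.
  apply: dual_norm_le => g g1; rewrite -[X in `|X|]/((H g : R) - J w g) -HJ.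
  by apply: (le_trans (h g)); rewrite ler_piMr// ltW.
have -> : (G H : R) - H f = G (H - J w) - (H - J w) f.
  rewrite linearB/= -[RHS]/(((G H : R) - G (J w)) - ((H f : R) - J w f)) JE fE.
  by rewrite opprB addrA subrK.
apply: (le_trans (ler_normB _ _)).
apply: (@le_trans _ _ (`|G| * (eps / K) + eps / K * `|f|)).
  by apply: lerD; [apply: le_trans (dual_ub G _) _; exact: ler_wpM2l
                  |apply: le_trans (dual_ub (H - J w) _) _; exact: ler_wpM2r].
rewrite [eps / K * _]mulrC -mulrDl mulrCA ler_piMr ?(ltW eps0)//.
by rewrite ler_pdivrMr// mul1r lerDl.
Qed.

End FSpace.

(** * The universal frame *)

Section Tree.
Context {R : realType}.
Local Notation U := (nat -> nat -> R^o).

(* A label encodes the number of coordinates attached to a node together with the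
   finite list of the admissible coefficient histories up to that node. *)
Definition label (x : nat) : nat * seq (seq (seq rat)) := odflt (0%N, [::]) (unpickle x).
Definition tdim (t : nat) := (label (head 0%N (CodeSeq.decode t))).1.
Definition hists (s : seq nat) := (label (head 0%N s)).2.

(* A node is the list of the labels on its branch, the most recent label first;
   [al] lists the coefficient rows along the branch in the same order. *)
Fixpoint ev (s : seq nat) (al : seq (seq rat)) (u : U) : R^o :=
  if s is x :: s' then
    (\sum_(l < (label x).1) ratr (nth 0 (head [::] al) l) * (u (CodeSeq.code s) l : R) : R) +
    ev s' (behead al) u
  else 0.

Fixpoint coherent (s : seq nat) : Prop :=
  if s is x :: s' then
    coherent s' /\ (s' = [::] \/ forall al, al \in hists s -> behead al \in hists s')
  else True.

Definition tame (al : seq (seq rat)) := all (all (fun q => -1 <= q <= 1)) al.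

(* This condition on the histories of a single node makes the whole family
   [tree_fam] satisfy the block condition of a frame. *)
Definition block_good P (s : seq nat) := forall (u : U) b, ndec b P.+2 ->
  (forall j a c, (j < P.+2)%N -> (b j <= a)%N -> (c <= b j.+1)%N ->
    forall al, al \in hists s -> `|ev s al (rst a c u) : R| <= 1) ->
  forall al, al \in hists s -> `|ev s al (rst (b 0%N) (b P.+2) u) : R| <= P.+2%:R / 2.

Definition good P s := [/\ coherent s, forall al, al \in hists s -> tame al & block_good P s].

(** Every good node contributes with all its histories, and no space X is mentioned. The scaled
    coordinates make the norm definite also at nodes that no good history charges. *)
Definition tree_fam P : set (U -> R^o) := [set psi |
  (exists s al, [/\ good P s, al \in hists s & psi = ev s al]) \/
  (exists t l, (l < tdim t)%N /\ psi = fun u => (2^-1 ^+ tdim t : R) * (u t l : R))].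

(** A node has a larger code than its ancestors, so intervals of codes cut a branch into
    intervals. *)
Lemma code_lt x s : (CodeSeq.code s < CodeSeq.code (x :: s))%N.
Proof. by rewrite /=; have : (0 < 2 ^ x)%N by [rewrite expn_gt0]; nia. Qed.

Lemma tdim_code x s : tdim (CodeSeq.code (x :: s)) = (label x).1.
Proof. by rewrite /tdim CodeSeq.codeK. Qed.

Lemma ev_linear s al : linear (ev s al).
Proof.
move=> a u v; elim: s al => [|x s IH] al /=; first by rewrite scaler0 addr0.
rewrite IH -[RHS]/(a * (_ + (ev s (behead al) u : R)) + (_ + (ev s (behead al) v : R))).
rewrite -[X in _ + X = _]/(a * (ev s (behead al) u : R) + (ev s (behead al) v : R)).
rewrite mulrDr addrACA; congr (_ + _); rewrite mulr_sumr -big_split/=; apply: eq_bigr => l _.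
by rewrite -[(a *: u + v) _ l]/(a * (u _ l : R) + (v _ l : R)) mulrDr mulrCA.
Qed.

Lemma ev_mass s al u : tame al ->
  `|ev s al u : R| <= \sum_(t < (CodeSeq.code s).+1) mass tdim u t.
Proof.
elim: s al => [|x s IH] al tal.
  by rewrite normr0 sumr_ge0// => t _; exact: mass_ge0.
have tb : tame (behead al) by case: al tal => //= r al /andP[].
rewrite [ev _ _ _]/=; apply: (le_trans (ler_normD _ _)); rewrite big_ord_recr addrC.
apply: lerD.
  apply: (le_trans (IH _ tb)); rewrite -!(big_mkord xpredT (mass tdim u)).
  rewrite [leRHS](@big_cat_nat _ _ _ (CodeSeq.code s).+1) ?code_lt//=.
  by rewrite lerDl sumr_ge0// => t _; exact: mass_ge0.
rewrite [mass _ _ _]/mass tdim_code; apply: (le_trans (ler_norm_sum _ _ _)).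
apply: ler_sum => l _; rewrite normrM ler_piMl// ler_norml.
have : -1 <= nth 0 (head [::] al) l <= 1.
  case: al tal {tb} => [|r al] /=; first by rewrite nth_nil.
  move=> /andP[/allP h _]; have [lr|rl] := ltnP l (size r); last by rewrite nth_default.
  by apply: h; exact: mem_nth.
by rewrite -(ler_rat R) -[_ <= 1](ler_rat R) rmorphN !rmorph1.
Qed.

Lemma mass_rst_sum (e : nat -> nat) a c (u : U) n :
  \sum_(t < n) mass e (rst a c u) t <= \sum_(a <= t < c) mass e u t.
Proof.
have z t : ~~ (a <= t < c)%N -> mass e (rst a c u) t = 0.
  by move=> h; rewrite /mass big1// => l _; rewrite /rst (negbTE h) normr0.
elim: n => [|n IH]; first by rewrite big_ord0 sumr_ge0// => t _; exact: mass_ge0.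
have [h|h] := boolP (a <= n < c)%N; last by rewrite big_ord_recr/= z ?addr0.
have [an nc] := andP h; rewrite (@big_cat_nat _ _ _ n.+1 a c)//=; last exact: leqW.
apply: (@le_trans _ _ (\sum_(a <= t < n.+1) mass e u t)); last first.
  by rewrite lerDl sumr_ge0// => t _; exact: mass_ge0.
rewrite -(big_mkord xpredT (mass e (rst a c u))) (@big_cat_nat _ _ _ a 0 n.+1)//=; last exact: leqW.
rewrite big1_seq ?add0r; last first.
  move=> t /andP[_]; rewrite mem_index_iota => /andP[_ ta].
  by apply: z; rewrite leqNgt ta.
by apply: ler_sum => t _; exact: mass_rst.
Qed.

Lemma tree_fam_lin P psi : tree_fam P psi -> linear psi.
Proof.
case=> [[s [al [_ _ ->]]]|[t [l [_ ->]]]]; first exact: ev_linear.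
move=> a u v; rewrite -[RHS]/(a * (2^-1 ^+ tdim t * (u t l : R)) + 2^-1 ^+ tdim t * (v t l : R)).
by rewrite -[(a *: u + v) _ l]/(a * (u _ l : R) + (v _ l : R)) mulrDr mulrCA.
Qed.

Lemma tree_fam_mass P psi : tree_fam P psi -> forall u a c,
  `|psi (rst a c u) : R| <= \sum_(a <= t < c) mass tdim u t.
Proof.
case=> [[s [al [[_ tal _] ials ->]]]|[t [l [lt ->]]]] u a c.
  by apply: (le_trans (ev_mass _ _ (tal _ ials))); exact: mass_rst_sum.
apply: le_trans (mass_rst_sum tdim a c u t.+1); rewrite big_ord_recr/=.
rewrite -[leLHS]add0r lerD ?sumr_ge0//; first by move=> i _; exact: mass_ge0.
rewrite /mass (bigD1 (Ordinal lt))//= normrM -[leLHS]addr0 lerD ?sumr_ge0//.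
by rewrite ler_piMl// ger0_norm ?exprn_ge0// exprn_ile1// invf_le1// ler1n.
Qed.

(** For a node functional, the hypothesis on the family contains the one on the histories of that
    node. A coordinate lives at a single node, hence in one block, and is bounded by 1. *)
Lemma tree_fam_block P psi u b : tree_fam P psi -> ndec b P.+2 ->
  (forall j a c, (j < P.+2)%N -> (b j <= a)%N -> (c <= b j.+1)%N ->
    forall psi', tree_fam P psi' -> `|psi' (rst a c u) : R| <= 1) ->
  `|psi (rst (b 0%N) (b P.+2) u) : R| <= P.+2%:R / 2.
Proof.
move=> + nb h; case=> [[s [al [gs ials ->]]]|[t [l [lt ->]]]].
  have [cs ts bs] := gs; apply: bs => // j a c jP ba cb al' ial'.
  by apply: (h j) => //; left; exists s, al'.
apply: (@le_trans _ _ 1); last by rewrite ler_pdivlMr// mul1r ler_nat.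
have [/andP[b0 tb]|nt] := boolP (b 0%N <= t < b P.+2)%N; last first.
  by rewrite /rst (negbTE nt) mulr0 normr0.
have [i2 /andP[i2P /andP[bi2 i2b]]] : exists i, (i < P.+2)%N && (b i <= t < b i.+1)%N.
  apply: contrapT => /forallNP no; suff : forall k, (k <= P.+2)%N -> (b k <= t)%N.
    by move=> /(_ P.+2 (leqnn _)); rewrite leqNgt tb.
  elim=> [//|k IH] kP; rewrite leqNgt; apply/negP => tk; apply: (no k).
  by rewrite kP tk IH// ltnW.
have := h i2 (b i2) (b i2.+1) i2P (leqnn _) (leqnn _) (fun u => (2^-1 ^+ tdim t : R) * (u t l : R)).
by rewrite /rst b0 tb bi2 i2b; apply; right; exists t, l.
Qed.

Lemma tree_fam_coord P t l : (l < tdim t)%N ->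
  tree_fam P (fun u => (2^-1 ^+ tdim t : R) * (u t l : R)).
Proof. by move=> lt; right; exists t, l. Qed.

Definition tree_frame : frame R :=
  Frame tree_fam_lin tree_fam_mass tree_fam_block tree_fam_coord.

End Tree.

Section ClosedEmbedding.
Context {R : realType} (X Z : completeNormedModType R).

Lemma bounded_below_embeds (T : {linear X -> Z}) (c C : R) : 0 < c ->
  (forall x, `|T x| <= C * `|x|) -> (forall x, c * `|x| <= `|T x|) ->
  embeds_as_closed_subspace X Z.
Proof.
move=> c0 TC Tc.
pose S z := xget 0 [set x | T x = z].
have Tinj x x' : T x = T x' -> x = x'.
  move=> E; apply/eqP; rewrite -subr_eq0 -normr_le0 -(pmulr_rle0 _ c0).
  by apply: (le_trans (Tc _)); rewrite linearB/= E subrr normr0.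
have TK : cancel T S.
  by move=> x; apply: Tinj; exact: (@xgetI _ _ [set y | T y = T x] x erefl).
have dS z z' : range T z -> range T z' -> `|S z - S z'| <= c^-1 * `|z - z'|.
  move=> [x _ <-] [x' _ <-]; rewrite !TK ler_pdivlMl//.
  by apply: (le_trans (Tc _)); rewrite linearB.
have Tcont : continuous T.
  apply: (@bounded_linear_continuous _ _ _ T); apply/linear_boundedP.
  by near=> r => x; apply: (le_trans (TC x)); rewrite ler_wpM2r//; near: r;
    apply: nbhs_pinfty_ge; exact: num_real.
exists T, S; split => //; last first.
  apply/subspace_continuousP => z zr; apply/cvgrPdist_le => e e0.
  rewrite near_withinE; near=> z' => z'r; apply: (le_trans (dS _ _ zr z'r)).
  rewrite ler_pdivrMl//; near: z'.
  by apply: (@cvgr_dist_le _ _ _ (nbhs z) _ id z cvg_id); rewrite mulr_gt0.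
move=> z zc.
have ex n : exists x, `|z - T x| < n.+1%:R^-1.
  have n0 : 0 < n.+1%:R^-1 :> R by rewrite invr_gt0.
  have [_ [[x _ <-] h]] := zc _ (nbhsx_ballx z _ n0); exists x.
  by move: h; rewrite -ball_normE.
have [u uP] := choice ex.
have ud n m : `|u n - u m| <= c^-1 * (n.+1%:R^-1 + m.+1%:R^-1).
  rewrite ler_pdivlMl//; apply: (le_trans (Tc _)); rewrite linearB/=.
  apply: (le_trans (dist_triangle _ _ z)); by apply: lerD; rewrite distrC ltW.
have uc : cvg (u @ \oo).
  apply: cauchy_cvg; apply: cauchy_exP => eps eps0.
  have [N NP] : exists N, c^-1 * (N.+1%:R^-1 + N.+1%:R^-1) < eps.
    exists (Num.truncn (2 / (c * eps))); set m := _.+1.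
    have := truncnS_gt (2 / (c * eps)); rewrite -/m ltr_pdivrMr ?mulr_gt0// => h.
    have m0 : 0 < m%:R :> R by rewrite ltr0n.
    by rewrite ltr_pdivrMl// -[m%:R^-1]mul1r -mulrDl ltr_pdivrMr// [_ * m%:R]mulrC.
  exists (u N); exists N => // n /= Nn; rewrite /= -ball_normE /=.
  apply: le_lt_trans (ud _ _) _; apply: le_lt_trans NP.
  by rewrite ler_pM2l ?invr_gt0// lerD2l lef_pV2 ?posrE// ler_nat ltnS.
exists (lim (u @ \oo)) => //.
have h1 : (fun n => T (u n)) @ \oo --> T (lim (u @ \oo)).
  exact: (cvg_comp _ _ uc (Tcont (lim (u @ \oo)))).
have h2 : (fun n => T (u n)) @ \oo --> z.
  apply/cvgrPdist_lt => e e0; exists (Num.truncn (e^-1)) => // n /= en.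
  apply: lt_trans (uP n) _; rewrite invf_plt ?posrE//.
  by apply: lt_le_trans (truncnS_gt _) _; rewrite ler_nat ltnS.
exact: cvg_unique h1 h2.
Unshelve. all: by end_near. Qed.

End ClosedEmbedding.

(** * The embedding *)

Section Indices.

Definition incr (t : nat -> nat) := forall i, (t i < t i.+1)%N.

Lemma incr_lt t : incr t -> {mono t : i j / (i < j)%N}.
Proof.
move=> ti; have h i j : (i < j)%N -> (t i < t j)%N.
  elim: j => [//|j IH]; rewrite ltnS leq_eqVlt => /orP[/eqP -> //|/IH h].
  exact: ltn_trans h (ti j).
move=> i j; have [ij|ji|->] := ltngtP i j; [exact: h| |by rewrite ltnn].
by apply/negbTE; rewrite -leqNgt ltnW// h.
Qed.

Lemma incr_ge t i : incr t -> (i <= t i)%N.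
Proof. by move=> ti; elim: i => [//|i IH]; exact: leq_ltn_trans IH (ti i). Qed.

Lemma incr_inj t i j : incr t -> t i = t j -> i = j.
Proof.
by move=> ti E; have [ij|ij|//] := ltngtP i j; move: ij; rewrite -(incr_lt ti) E ltnn.
Qed.

(** Turns a cut of node codes into a cut of indices along a branch: [a] counts the [i < n] with
    [t i < c]. *)
Lemma index_ex t n c : incr t -> exists a, (a <= n)%N /\
  forall i, (i < n)%N -> (t i < c)%N = (i < a)%N.
Proof.
move=> ti; elim: n => [|n [a [an ac]]]; first by exists 0%N.
have [nc|cn] := ltnP (t n) c.
  exists n.+1; split=> // i iN; rewrite iN; apply: leq_ltn_trans nc.
  by rewrite leqNgt (incr_lt ti) -leqNgt.
exists a; split; first exact: leqW.
move=> i; rewrite ltnS leq_eqVlt => /orP[/eqP ->|iN]; last exact: ac.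
by rewrite ltnNge cn/= ltnNge an.
Qed.

Lemma sum_ite (V : nmodType) (F : nat -> V) a c n : (c <= n)%N ->
  \sum_(i < n) (if (a <= i < c)%N then F i else 0) = \sum_(a <= i < c) F i.
Proof.
by move=> cn; rewrite -big_mkcond (big_nat_widenl a 0)// (big_nat_widen 0 c n)//= big_mkord.
Qed.

End Indices.

Section Embedding.
Context {R : realType} (X : normedModType R).
Local Notation Y := (dual X).
Variables (b : nat -> Y * X) (lo hi : nat -> nat) (P0 : nat) (C : R).
Hypothesis bi : forall n, biorth b n.
Hypothesis C0 : 0 <= C.
Hypothesis HU : forall a n (q : nat -> Y), (forall i, inF b lo hi i (q i)) ->
  (n <= P0.+2)%N -> (forall j, (j < n)%N -> (a j <= a j.+1)%N) ->
  (forall j, (j < n)%N -> `|\sum_(a j <= i < a j.+1) q i| <= 1) ->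
  `|\sum_(a 0%N <= i < a n) q i| <= P0.+2%:R / 8.
Hypothesis HL : forall y : Y, `|y| <= 1 -> exists d : nat -> Y,
  [/\ forall i, inF b lo hi i (d i),
      forall a n, (forall j, (j < n)%N -> (a j <= a j.+1)%N) ->
        \sum_(j < n) `|\sum_(a j <= i < a j.+1) d i| ^+ P0.+2 <= C &
      forall x (e : R), 0 < e -> exists n, `|(y - \sum_(i < n) d i) x| <= `|x| / 2 + e].

Local Notation U := (nat -> nat -> R^o).

(** Normalises the basis functionals so that their values on the unit ball of X lie between -1 and
    1, as [tame] demands. *)
Definition yscale l : R := (1 + `|(b l).1|)^-1.
Definition gvec i l : Y := if (lo i <= l < hi i)%N then yscale l *: (b l).1 else 0.
(** Bounds the coefficient of a normalised basis functional by the norm of the block containing it,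
    see [qv_coord]. *)
Definition kap l : R := (1 + `|(b l).1|) * `|(b l).2|.
Definition kapsum i : R := \sum_(l < hi i) kap l.
Definition prec i := (Num.truncn (kapsum i * 2 ^+ (i + 3))).+1.
(** The [prec i] coordinates beyond [hi i] have coefficient 0 along the branch; they make the weight
    [2^-1 ^+ width i] of the coordinate functionals small, see [kap_width]. *)
Definition width i := (hi i + prec i)%N.
Definition rndz i l (x : X) : int := Num.floor ((prec i)%:R * (gvec i l x : R)).
Definition rnd i l (x : X) : rat := (rndz i l x)%:~R / (prec i)%:R.
Definition row i x : seq rat := [seq rnd i l x | l <- iota 0 (hi i)].
Fixpoint hist i x : seq (seq rat) := if i is i'.+1 then row i' x :: hist i' x else [::].
Definition rval i l x : R := ratr (nth 0 (row i x) l).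

Lemma dual_ball (f : Y) x M : `|f| <= M -> `|x| <= 1 -> `|f x : R| <= M.
Proof. by move=> fM x1; apply: (le_trans (dual_ub f x)); apply: le_trans fM; rewrite ler_piMr. Qed.

Lemma yscale_gt0 l : 0 < yscale l.
Proof. by rewrite invr_gt0 ltr_pwDl. Qed.

Lemma kap_ge0 l : 0 <= kap l. Proof. by rewrite mulr_ge0// addr_ge0. Qed.

Lemma kapsum_ge0 i : 0 <= kapsum i. Proof. by rewrite sumr_ge0// => l _; exact: kap_ge0. Qed.

Lemma prec_gt0 i : 0 < (prec i)%:R :> R. Proof. by rewrite ltr0n. Qed.

Lemma kap_prec i : kapsum i / (prec i)%:R <= 2^-1 ^+ (i + 3).
Proof.
rewrite ler_pdivrMr ?prec_gt0// exprVn mulrC ler_pdivlMr ?exprn_gt0//.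
exact/ltW/truncnS_gt.
Qed.

Lemma kap_width i : kapsum i * 2^-1 ^+ width i <= 2^-1 ^+ (i + 3).
Proof.
apply: le_trans (kap_prec i); rewrite ler_wpM2l ?kapsum_ge0// exprVn lef_pV2 ?posrE ?exprn_gt0//.
rewrite -natrX ler_nat; apply: leq_trans (ltnW (ltn_expl _ (ltnSn 1))).
exact: leq_addl.
Qed.

Lemma gvec_le1 i l x : `|x| <= 1 -> `|gvec i l x : R| <= 1.
Proof.
move=> x1; apply: (le_trans (dual_ub _ _)); rewrite -[leRHS]mulr1 ler_pM//.
rewrite /gvec; case: ifP => _; last by rewrite normr0.
rewrite normrZ gtr0_norm ?yscale_gt0// /yscale ler_pdivrMl ?ltr_pwDl// mulr1.
by rewrite lerDr.
Qed.

Lemma rvalE i l x : rval i l x = if (l < hi i)%N then (rndz i l x)%:~R / (prec i)%:R else 0.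
Proof.
rewrite /rval /row; case: ltnP => h; last first.
  by rewrite nth_default ?size_map ?size_iota// rmorph0.
rewrite (nth_map 0%N) ?size_iota// nth_iota// add0n /rnd.
by rewrite fmorph_div/= ratr_int ratr_nat.
Qed.

Lemma rval_zero i l x : gvec i l = 0 -> rval i l x = 0.
Proof. by move=> g0; rewrite rvalE /rndz g0; case: ifP => // _; rewrite mulr0 floor0 mul0r. Qed.

Lemma rval_near i l x : `|rval i l x - gvec i l x| <= (prec i)%:R^-1.
Proof.
rewrite rvalE; have p0 := prec_gt0 i; case: ltnP => h; last first.
  have -> : gvec i l = 0 by rewrite /gvec ltnNge h andbF.
  by rewrite subr0 normr0 invr_ge0 ltW.
have /andP[f1 f2] := floor_itv ((prec i)%:R * (gvec i l x : R)).
have -> : (rndz i l x)%:~R / (prec i)%:R - (gvec i l x : R) =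
    ((rndz i l x)%:~R - (prec i)%:R * (gvec i l x : R)) / (prec i)%:R.
  by rewrite mulrBl mulrAC divff ?gt_eqF// mul1r.
rewrite normrM [X in _ * X]gtr0_norm ?invr_gt0// ler_piMl ?invr_ge0 ?(ltW p0)//.
rewrite /rndz; rewrite intrD in f2; move: f1 f2; set z := _%:~R; set w := _ * _ => f1 f2.
by rewrite ler_norml; lra.
Qed.

Lemma rndz_bound i l x : `|x| <= 1 -> - (prec i)%:Z <= rndz i l x <= (prec i)%:Z.
Proof.
move=> x1; have := gvec_le1 i l x1; rewrite ler_norml => /andP[g1 g2].
have p0 := prec_gt0 i; apply/andP; split.
  by rewrite floor_ge_int mulrNz -pmulrn -mulrN1 ler_pM2l.
by rewrite -(ler_int R) -pmulrn; apply: le_trans (floor_le _) _; rewrite ler_piMr// ltW.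
Qed.

Lemma hist_tame i x : `|x| <= 1 -> tame (hist i x).
Proof.
move=> x1; elim: i => [//|i IH] /=; rewrite IH andbT; apply/allP => _ /mapP[l _ ->].
have p0 := prec_gt0 i; rewrite -(ler_rat R) -[_ <= 1](ler_rat R) rmorphN !rmorph1.
rewrite /rnd fmorph_div/= ratr_int ratr_nat ler_pdivlMr// ler_pdivrMr// mul1r mulN1r.
have /andP[h1 h2] := rndz_bound i l x1.
by rewrite (pmulrn 1 (prec i)) -mulrNz !ler_int h1.
Qed.

(** Rounded values on the unit ball belong to a finite grid; therefore the histories can be stored
    in a label. *)
Lemma finite_hist i : finite_set [set hist i x | x in [set x : X | `|x| <= 1]].
Proof.
have fz k l : finite_set [set rnd k l x | x in [set x : X | `|x| <= 1]].
  apply: (@sub_finite_set _ _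
    ((fun n : nat => (n%:Z - (prec k)%:Z)%:~R / (prec k)%:R) @` `I_((prec k).*2.+1))).
    move=> _ [x /= x1 <-]; have /andP[h1 h2] := rndz_bound k l x1.
    exists (absz (rndz k l x + (prec k)%:Z)) => /=; first by lia.
    by congr (_%:~R / _); lia.
  exact: finite_image (finite_II _).
have frow k : finite_set [set row k x | x in [set x : X | `|x| <= 1]].
  rewrite /row; elim: (iota 0 (hi k)) => [|l s IH] /=.
    by apply: (@sub_finite_set _ _ [set [::]]) => // _ [x _ <-].
  apply: (@sub_finite_set _ _ _ _ (finite_image2 cons (fz k l) IH)) => _ [x x1 <-] /=.
  by exists (rnd k l x); [exists x|exists [seq rnd k l x | l <- s] => //; exists x].
elim: i => [|i IH] /=.
  by apply: (@sub_finite_set _ _ [set [::]]) => // _ [x _ <-].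
apply: (@sub_finite_set _ _ _ _ (finite_image2 cons (frow i) IH)) => _ [x x1 <-] /=.
by exists (row i x); [exists x|exists (hist i x) => //; exists x].
Qed.

Definition hset i : seq (seq (seq rat)) :=
  xget [::] [set s : seq (seq (seq rat)) | [set hist i x | x in [set x : X | `|x| <= 1]] = [set` s]].

Lemma hsetP i al : al \in hset i <-> exists2 x : X, `|x| <= 1 & al = hist i x.
Proof.
have [s sP] := (finite_seqP _).1 (finite_hist i).
have h : [set hist i x | x in [set x : X | `|x| <= 1]] = [set` hset i].
  exact: (@xgetI _ _ [set s : seq (seq (seq rat)) | _ = [set` s]] s sP).
split=> [ia|[x x1 ->]].
  have : [set` hset i] al by [].
  by rewrite -h => -[x x1 <-]; exists x.
by have : [set` hset i] (hist i x) by rewrite -h; exists x.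
Qed.

Definition lab i := pickle (width i, hset i.+1).
Fixpoint branch i : seq nat := if i is i'.+1 then lab i' :: branch i' else [::].
Definition node i := CodeSeq.code (branch i.+1).

Lemma label_lab i : label (lab i) = (width i, hset i.+1).
Proof. by rewrite /label /lab pickleK. Qed.

Lemma hists_branch i : hists (branch i.+1) = hset i.+1.
Proof. by rewrite /hists [branch _]/= label_lab. Qed.

Lemma node_incr : incr node.
Proof. by move=> i; exact: code_lt. Qed.

Lemma tdim_node i : tdim (node i) = width i.
Proof. by rewrite /node [branch _]/= tdim_code label_lab. Qed.

(** [qv u i] is the i-th block in Y coded by the array [u] along the branch; [rs i x u] is its value
    at [x] computed with rounded coefficients, that is, what the norm of the array controls. *)
Definition rs i (x : X) (u : U) : R := \sum_(l < width i) rval i l x * (u (node i) l : R).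
Definition qv (u : U) i : Y := \sum_(l < width i) (u (node i) l : R) *: gvec i l.

Lemma ev_branch m x u : ev (branch m) (hist m x) u = \sum_(i < m) rs i x u.
Proof.
elim: m => [|m IH]; first by rewrite big_ord0.
rewrite big_ord_recr/= IH addrC; congr (_ + _); rewrite label_lab/=.
by apply: eq_bigr => l _.
Qed.

Lemma gvec_coord i l k : mcoord b (gvec i l) k =
  if (k == l) && (lo i <= l < hi i)%N then yscale l * mcoord b (b l).1 l else 0.
Proof.
rewrite /gvec; case: ifP => h; last by rewrite andbF mcoord0.
rewrite mcoordZ; case: eqP => [->//|/eqP kl] /=.
have [||h1 _] := @bi (maxn k l).+1 l k; rewrite ?ltnS ?leq_maxr ?leq_maxl//.
by rewrite /mcoord h1 ?mulr0// eq_sym.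
Qed.

Lemma gvec_inF i l : inF b lo hi i (gvec i l).
Proof.
split; last first.
  by move=> k kl; rewrite gvec_coord; case: ifP => // /andP[/eqP kE /andP[h _]]; lia.
rewrite /gvec; case: ifP => [/andP[_ lh]|_]; last exact: inH0.
apply: inHZ; have -> : (b l).1 = \sum_(k < hi i) (k == l :> nat)%:R *: (b k).1.
  rewrite (bigD1 (Ordinal lh))//= eqxx scale1r big1 ?addr0// => k kl.
  by case: eqP => h; [case/eqP: kl; apply: val_inj|rewrite scale0r].
exact: (@inH_comb _ _ _ bi (fun k => (k == l)%:R)).
Qed.

Lemma qv_inF u i : inF b lo hi i (qv u i).
Proof.
split; [apply: inH_sum => // l _; apply: inHZ|apply: annih_sum => l _ k kl; rewrite mcoordZ].
  by have [] := gvec_inF i l.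
by have [_ ->] := gvec_inF i l; rewrite ?mulr0.
Qed.

Lemma qv_coord (u : U) i (l : 'I_(width i)) : gvec i l != 0 ->
  `|u (node i) l : R| <= kap l * `|qv u i|.
Proof.
move=> g0; have lh : (lo i <= l < hi i)%N.
  by apply: contraNT g0 => h; rewrite /gvec (negbTE h).
have b0 : mcoord b (b l).1 l = 1.
  have [_ [//|[b0 _]]] := @bi l.+1 l l (ltnSn l) (ltnSn l).
  by move: g0; rewrite /gvec lh b0 scaler0 eqxx.
have E : mcoord b (qv u i) l = (u (node i) l : R) * yscale l.
  rewrite /qv /mcoord dual_sumE (bigD1 l)//= big1 ?addr0.
    by rewrite -[LHS]/((u (node i) l : R) * mcoord b (gvec i l) l) gvec_coord eqxx lh b0 mulr1.
  move=> k kl; rewrite -[LHS]/((u (node i) k : R) * mcoord b (gvec i k) l) gvec_coord.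
  by rewrite -[_ == _ :> nat]/(l == k) eq_sym (negbTE kl) mulr0.
have y0 := yscale_gt0 l.
have -> : (u (node i) l : R) = (1 + `|(b l).1|) * mcoord b (qv u i) l.
  by rewrite E mulrCA -[1 + _]invrK -/(yscale l) mulVf ?gt_eqF// mulr1.
rewrite normrM ger0_norm ?addr_ge0// /kap -mulrA ler_wpM2l ?addr_ge0// mulrC.
exact: dual_ub.
Qed.

(* The rounding precision [prec i] was chosen against the size of the coefficients
   of a vector of F_i of norm at most 1. *)
Lemma rs_near i x u : `|rs i x u - qv u i x| <= 2^-1 ^+ (i + 3) * `|qv u i|.
Proof.
rewrite /rs /qv dual_sumE -sumrB; apply: (le_trans (ler_norm_sum _ _ _)).
apply: (@le_trans _ _ (\sum_(l < width i) if (l < hi i)%N then kap l * `|qv u i| / (prec i)%:R else 0)).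
  apply: ler_sum => l _.
  have -> : rval i l x * (u (node i) l : R) - ((u (node i) l : R) *: gvec i l) x =
      (u (node i) l : R) * (rval i l x - gvec i l x).
    by rewrite -[X in _ - X]/((u (node i) l : R) * (gvec i l x : R)) mulrBr mulrC.
  have [g0|g0] := eqVneq (gvec i l) 0.
    rewrite rval_zero// g0 subr0 mulr0 normr0; case: ifP => // _.
    by rewrite !mulr_ge0 ?kap_ge0// invr_ge0.
  have lh : (lo i <= l < hi i)%N by apply: contraNT g0 => h; rewrite /gvec (negbTE h).
  have /andP[_ ->] := lh; rewrite normrM ler_pM ?qv_coord//; exact: rval_near.
rewrite -big_mkcond/= -(big_ord_widen _ (fun l => kap l * `|qv u i| / (prec i)%:R)) ?leq_addr//.
rewrite -!mulr_suml mulrAC -/(kapsum i) ler_wpM2r//; exact: kap_prec.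
Qed.

Lemma err_sum (M : R) a c : 0 <= M -> \sum_(a <= i < c) 2^-1 ^+ (i + 3) * M <= M / 4.
Proof.
move=> M0; apply: (@le_trans _ _ (\sum_(0 <= i < c) 2^-1 ^+ (i + 3) * M)).
  have [ac|ca] := leqP a c; last first.
    by rewrite big_geq ?(ltnW ca)// sumr_ge0// => i _; rewrite mulr_ge0// exprn_ge0.
  rewrite (@big_cat_nat _ _ _ a 0 c)//= lerDr sumr_ge0// => i _.
  by rewrite mulr_ge0// exprn_ge0.
rewrite -mulr_suml mulrC ler_wpM2l//.
have h n : \sum_(0 <= i < n) 2^-1 ^+ (i + 3) = 4^-1 - 2^-1 ^+ (n + 2) :> R.
  elim: n => [|n IH]; first by rewrite big_geq//= expr2; field.
  by rewrite big_nat_recr//= IH addSn [X in _ = _ - X]exprS !exprD; field.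
by rewrite h gerBl exprn_ge0.
Qed.

Lemma rs_sum_near x u a c (M : R) : 0 <= M -> `|x| <= 1 ->
  (forall i, (a <= i < c)%N -> `|qv u i| <= M) ->
  `|\sum_(a <= i < c) rs i x u - (\sum_(a <= i < c) qv u i) x| <= M / 4.
Proof.
move=> M0 x1 qM; rewrite dual_sumE -sumrB; apply: (le_trans (ler_norm_sum _ _ _)).
apply: le_trans (err_sum a c M0); rewrite big_nat_cond [leRHS]big_nat_cond.
apply: ler_sum => i; rewrite andbT => ic; apply: (le_trans (rs_near _ _ _)).
by rewrite ler_wpM2l ?exprn_ge0// qM.
Qed.

(** The rounding error is at most an eighth of [|qv u i|] and is absorbed into the left-hand
    side. *)
Lemma qv_bound u i (N : R) : 0 <= N -> (forall x, `|x| <= 1 -> `|rs i x u| <= N) ->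
  `|qv u i| <= 2 * N.
Proof.
move=> N0 h; have : `|qv u i| <= N + `|qv u i| / 8.
  apply: dual_norm_le => x x1; have := rs_near i x u; have := h x x1.
  have e8 : 2^-1 ^+ (i + 3) <= 8^-1 :> R.
    have -> : 8^-1 = 2^-1 ^+ 3 :> R by rewrite !exprS expr0; field.
    by rewrite exprD ler_piMl ?exprn_ge0// exprn_ile1// invf_le1// ler1n.
  have := ler_wpM2r (normr_ge0 (qv u i)) e8; rewrite [8^-1 * _]mulrC.
  have := ler_normB (rs i x u) (rs i x u - qv u i x); rewrite opprB addrC subrK.
  by move: `|qv u i x| `|rs i x u - _| `|rs i x u| `|qv u i| (_ * _) => a1 a2 a3 a4 a5; lra.
by move: `|qv u i| => z; lra.
Qed.

Lemma qv_sum_bound u a c (N : R) : 0 <= N ->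
  (forall i x, (a <= i < c)%N -> `|x| <= 1 -> `|rs i x u| <= N) ->
  (forall x, `|x| <= 1 -> `|\sum_(a <= i < c) rs i x u| <= N) ->
  `|\sum_(a <= i < c) qv u i| <= 2 * N.
Proof.
move=> N0 h1 h2; apply: dual_norm_le => x x1.
have := @rs_sum_near x u a c (2 * N) (mulr_ge0 (ler0n _ 2) N0) x1.
move=> /(_ (fun i ic => qv_bound N0 (fun x => @h1 i x ic))); have := h2 x x1.
set S := \sum_(_ <= _ < _) rs _ _ _; set T := functional _ _.
have := ler_normB S (S - T); rewrite opprB addrC subrK.
by move: `|T| `|S - T| `|S| => a1 a2 a3; lra.
Qed.

Lemma rs_rst i x u a c :
  rs i x (rst a c u) = if (a <= node i < c)%N then rs i x u else 0.
Proof.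
rewrite /rs /rst; case: ifP => h //.
by rewrite big1// => l _; rewrite mulr0.
Qed.

Lemma ev_rst n x u a c ia ic : (ic <= n)%N ->
  (forall i, (i < n)%N -> (node i < a)%N = (i < ia)%N) ->
  (forall i, (i < n)%N -> (node i < c)%N = (i < ic)%N) ->
  ev (branch n) (hist n x) (rst a c u) = \sum_(ia <= i < ic) rs i x u.
Proof.
move=> icn ha hc; rewrite ev_branch -(sum_ite (fun i => rs i x u) ia icn).
by apply: eq_bigr => i _; rewrite rs_rst leqNgt ha// hc// -leqNgt.
Qed.

(** Here 1/8 becomes 1/2. Rounded sums bounded by 1 give groups of norm at most 2, [HU] applied to
    their halves bounds the total by [P0.+2 / 4], and the final rounding error 1/2 is at most
    another [P0.+2 / 4]. *)
Lemma branch_block n : @block_good R P0 (branch n.+1).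
Proof.
move=> u c nc h al; rewrite hists_branch in h *.
move=> /hsetP[x x1 ->].
have [idx idxP] := choice (fun z => index_ex n.+1 z node_incr).
have idx_le k : (idx k <= n.+1)%N by have [] := idxP k.
have idxE k i : (i < n.+1)%N -> (node i < k)%N = (i < idx k)%N by have [_] := idxP k; apply.
have idx_mono k k' : (k <= k')%N -> (idx k <= idx k')%N.
  move=> kk; rewrite leqNgt; apply/negP => lt.
  have iN := leq_trans lt (idx_le k); have := idxE k _ iN; have := idxE k' _ iN.
  by rewrite ltnn lt => + h'; rewrite (leq_trans _ kk).
have h2 j x' : (j < P0.+2)%N -> `|x'| <= 1 ->
    `|\sum_(idx (c j) <= i < idx (c j.+1)) rs i x' u| <= 1.
  move=> jP x1'.
  rewrite -(@ev_rst n.+1 x' u (c j) (c j.+1))// => [|i iN|i iN]; rewrite ?idxE//.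
  by apply: (h j) => //; apply/hsetP; exists x'.
have h1 j i x' : (j < P0.+2)%N -> (idx (c j) <= i < idx (c j.+1))%N -> `|x'| <= 1 -> `|rs i x' u| <= 1.
  move=> jP /andP[ij ji] x1'; have iN : (i < n.+1)%N by rewrite (leq_trans ji).
  have -> : rs i x' u = \sum_(i <= k < i.+1) rs k x' u by rewrite big_nat1.
  rewrite -(@ev_rst n.+1 x' u (node i) (node i).+1)//.
  - apply: (h j) => //; last by apply/hsetP; exists x'.
      by rewrite leqNgt idxE// -leqNgt.
    by rewrite idxE.
  - by move=> k kn; rewrite (incr_lt node_incr).
  - by move=> k kn; rewrite !ltnS leqNgt (incr_lt node_incr) -leqNgt.
have mono : forall j, (j < P0.+2)%N -> (idx (c j) <= idx (c j.+1))%N.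
  by move=> j jP; apply: idx_mono; exact: nc.
have gr j : (j < P0.+2)%N -> `|\sum_(idx (c j) <= i < idx (c j.+1)) qv u i| <= 2.
  move=> jP; rewrite -[leRHS]mulr1; apply: qv_sum_bound => //; first by move=> i x' ij; exact: (h1 j).
  by move=> x' x1'; exact: h2.
have Q : `|\sum_(idx (c 0%N) <= i < idx (c P0.+2)) qv u i| <= P0.+2%:R / 4.
  have : `|\sum_(idx (c 0%N) <= i < idx (c P0.+2)) 2^-1 *: qv u i| <= P0.+2%:R / 8.
    apply: (@HU (fun j => idx (c j)) P0.+2) => // [i|j jP].
      have [q1 q2] := qv_inF u i; split; first exact: inHZ.
      by move=> k kl; rewrite mcoordZ q2// mulr0.
    by rewrite -scaler_sumr normrZ ger0_norm// ler_pdivrMl// mulr1 gr.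
  rewrite -scaler_sumr.
  by rewrite normrZ ger0_norm// ler_pdivrMl//; move: (P0.+2%:R : R) `|_| => p z; lra.
rewrite (@ev_rst n.+1 x u (c 0%N) (c P0.+2) (idx (c 0%N)) (idx (c P0.+2)))//; [|by move=> i; exact: idxE|by move=> i; exact: idxE].
have q2 i : (idx (c 0%N) <= i < idx (c P0.+2))%N -> `|qv u i| <= 2.
  move=> /andP[i0 iP].
  have [j jP /andP[ij ji]] : exists2 j, (j < P0.+2)%N & (idx (c j) <= i < idx (c j.+1))%N.
    apply: contrapT => no; suff : forall k, (k <= P0.+2)%N -> (idx (c k) <= i)%N.
      by move=> /(_ P0.+2 (leqnn _)); rewrite leqNgt iP.
    elim=> [//|k IH] kP; rewrite leqNgt; apply/negP => tk; apply: no; exists k => //.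
    by rewrite tk IH// ltnW.
  rewrite -[leRHS]mulr1; apply: qv_bound => // x' x1'.
  by apply: (h1 j) => //; rewrite ij ji.
have := @rs_sum_near x u _ _ 2 (ler0n _ 2) x1 q2.
have := dual_ball Q x1.
set S := \sum_(_ <= _ < _) rs _ _ _; set T := functional _ _.
have := ler_normD (S - T) T; rewrite subrK.
have : 2 <= P0.+2%:R :> R by rewrite ler_nat.
by move: `|T| `|S - T| `|S| (P0.+2%:R : R) => a1 a2 a3 p; lra.
Qed.

Lemma branch_good n : @good R P0 (branch n.+1).
Proof.
split; last exact: branch_block.
  elim: n => [|n IH]; first by split=> //; left.
  split; first exact: IH.
  right=> al; rewrite /hists /= !label_lab => /hsetP[x x1 ->] /=.
  by apply/hsetP; exists x.
by move=> al; rewrite /hists /= label_lab => /hsetP[x x1 ->]; exact: hist_tame.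
Qed.

Local Notation E := (fspace (@tree_frame R)).

Lemma branch_le (w : E) n x : `|x| <= 1 -> forall a c,
  `|\sum_(i < n.+1) rs i x (rst a c (w P0)) : R| <= `|w|.
Proof.
move=> x1 a c; rewrite -ev_branch; apply: le_trans (fnrm_le w P0).
apply: le_trans (NI_nrm (p := P0.+2) isT (@ffam_mass R tree_frame P0) a c (fspace_summable w P0)).
apply: (NI_ge (@ffam_mass R tree_frame P0)); left.
exists (branch n.+1), (hist n.+1 x); split=> //; first exact: branch_good.
by rewrite /hists /= label_lab; apply/hsetP; exists x.
Qed.

Lemma partial_bound (w : E) n : `|\sum_(i < n) qv (w P0) i| <= 2 * `|w|.
Proof.
case: n => [|n]; first by rewrite big_ord0 normr0 mulr_ge0.
have h1 i x : (i < n.+1)%N -> `|x| <= 1 -> `|rs i x (w P0)| <= `|w|.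
  move=> iN x1; have := branch_le w n x1 (node i) (node i).+1.
  rewrite (bigD1 (Ordinal iN))//= rs_rst leqnn ltnSn/= big1 ?addr0// => k ki.
  rewrite rs_rst; case: ifP => // h; case/negP: ki; apply/eqP/val_inj => /=.
  by apply: (incr_inj node_incr); lia.
rewrite -(big_mkord xpredT (qv (w P0))); apply: qv_sum_bound => // x x1.
rewrite big_mkord; have := branch_le w n x1 0 (node n).+1; congr (`|_| <= _).
apply: eq_bigr => i _; rewrite rs_rst leq0n/= ltnS leqNgt (incr_lt node_incr) -leqNgt.
by rewrite -ltnS ltn_ord.
Qed.

Lemma qv_zero (w : E) B i : fsupp tree_frame w B -> (B <= i)%N -> qv (w P0) i = 0.
Proof.
move=> wB Bi; rewrite /qv big1// => l _; rewrite wB ?scale0r//.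
by rewrite (leq_trans Bi (incr_ge i node_incr)) orbT.
Qed.

Definition qsum (w : E) : Y := \sum_(i < fbound tree_frame w) qv (w P0) i.

Lemma qsumE (w : E) n : (fbound tree_frame w <= n)%N -> qsum w = \sum_(i < n) qv (w P0) i.
Proof.
move=> bn; rewrite /qsum -!(big_mkord xpredT (qv (w P0))).
rewrite [RHS](@big_cat_nat _ _ _ (fbound tree_frame w))//= [X in _ + X]big1_seq ?addr0//.
move=> i /andP[_]; rewrite mem_index_iota => /andP[ib _].
exact: qv_zero (@fboundP _ _ w) ib.
Qed.

Lemma qsum_le w : `|qsum w| <= 2 * `|w|. Proof. exact: partial_bound. Qed.

Lemma qsum_linear : linear qsum.
Proof.
move=> a v w; pose n := maxn (fbound tree_frame (a *: v + w))
  (maxn (fbound tree_frame v) (fbound tree_frame w)).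
rewrite !(@qsumE _ n); do ?by rewrite /n; lia.
rewrite scaler_sumr -big_split/=; apply: eq_bigr => i _.
rewrite /qv scaler_sumr -big_split/=; apply: eq_bigr => l _.
by rewrite scalerA -scalerDl.
Qed.

Lemma embed_ex (x : X) : exists f : dual E, (forall w, f w = qsum w x) /\ `|f| <= 2 * `|x|.
Proof.
have [||f [fE fN]] := @dual_ex R E (fun w => qsum w x) (2 * `|x|).
- by move=> a v w /=; rewrite qsum_linear.
- move=> w; apply: (le_trans (dual_ub _ _)); rewrite mulrAC ler_wpM2r//; exact: qsum_le.
by exists f; split=> //; apply: fN; rewrite mulr_ge0.
Qed.

(* Coherence is used here: on the coordinates it shares with the branch, a
   functional of any other branch is a functional of the branch itself. *)
Lemma coherent_branch s al (v : U) : coherent s -> al \in hists s ->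
  (forall t l, (forall i, t <> node i) -> v t l = 0) ->
  exists m x, `|x| <= 1 /\ forall a c, ev s al (rst a c v) = \sum_(i < m) rs i x (rst a c v).
Proof.
move=> + + v0; elim: s al => [|y s IH] al cs ial.
  by exists 0%N, 0; rewrite normr0; split=> // a c; rewrite big_ord0.
have [[k sk]|ns] := pselect (exists k, y :: s = branch k.+1).
  move: ial; rewrite sk hists_branch => /hsetP[x x1 ->].
  by exists k.+1, x; split=> // a c; rewrite -ev_branch.
have z a c : (\sum_(l < (label y).1)
    ratr (nth 0 (head [::] al) l) * (rst a c v (CodeSeq.code (y :: s)) l : R) : R) = 0.
  rewrite big1// => l _; rewrite /rst; case: ifP => _; last by rewrite mulr0.
  rewrite v0 ?mulr0// => i tE; apply: ns; exists i.
  by rewrite -[LHS]CodeSeq.codeK tE CodeSeq.codeK.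
have [cs' [s0|bh]] := cs.
  exists 0%N, 0; rewrite normr0; split=> // a c; rewrite big_ord0.
  by rewrite [ev _ _ _]/= z add0r s0.
have [m [x [x1 xE]]] := IH (behead al) cs' (bh _ ial).
by exists m, x; split=> // a c; rewrite [ev _ _ _]/= z add0r.
Qed.

(** * Lifting a block decomposition from Y to an array on the branch *)

Section Lift.
Variables (d : nat -> Y) (n : nat).
Hypothesis dF : forall i, inF b lo hi i (d i).
Hypothesis dC : forall a m, (forall j, (j < m)%N -> (a j <= a j.+1)%N) ->
  \sum_(j < m) `|\sum_(a j <= i < a j.+1) d i| ^+ P0.+2 <= C.

(** Undoes the normalisation [yscale], so that the blocks of the lifted array are the [d i] for
    [i < n]. *)
Definition lcoef i l : R :=
  if (lo i <= l < hi i)%N then (1 + `|(b l).1|) * mcoord b (d i) l else 0.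

Definition lvec : U := fun t l => \sum_(i < n) if node i == t then lcoef i l else 0.

Lemma lvec_node i l : lvec (node i) l = if (i < n)%N then lcoef i l else 0.
Proof.
rewrite /lvec; case: ltnP => h.
  rewrite (bigD1 (Ordinal h))//= eqxx big1 ?addr0// => k ki; case: eqP => // E'.
  by case/eqP: ki; apply: val_inj; exact: incr_inj node_incr E'.
rewrite big1// => k _; case: eqP => // E'.
by have := ltn_ord k; rewrite (incr_inj node_incr E') ltnNge h.
Qed.

Lemma lvec_out t l : (forall i, t <> node i) -> lvec t l = 0.
Proof. by move=> h; rewrite /lvec big1// => i _; case: eqP => // E'; case: (h i). Qed.

Lemma qv_lvec i : qv lvec i = if (i < n)%N then d i else 0.
Proof.
rewrite /qv; under eq_bigr do rewrite lvec_node.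
case: ltnP => h; last by rewrite big1// => l _; rewrite scale0r.
have [dh dl] := dF i; rewrite -[RHS]dh /bproj.
rewrite (eq_bigr (fun l : 'I_(width i) => if (l < hi i)%N then mcoord b (d i) l *: (b l).1 else 0)).
  by rewrite -big_mkcond/= -(big_ord_widen _ (fun l => mcoord b (d i) l *: (b l).1)) ?leq_addr.
move=> l _; rewrite /lcoef /gvec; case: (ltnP l (hi i)) => lh; last by rewrite andbF scaler0.
rewrite !andbT; case: leqP => ll; last by rewrite dl// !scale0r.
by rewrite scalerA mulrAC divff ?mul1r// gt_eqF// ltr_pwDl.
Qed.

Lemma lift_fin : is_fin tree_frame (fun P t l => if P == P0 then lvec t l else 0).
Proof.
apply/asboolP; exists (maxn P0 (node n)).+1 => P t l h; case: eqP h => // -> h.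
have [[i tE]|no] := pselect (exists i, t = node i); last first.
  by rewrite lvec_out// => i tE; apply: no; exists i.
rewrite tE lvec_node; case: ltnP => // iN; rewrite /lcoef; case: ifP => // /andP[_ lh].
have : (node i < node n)%N by rewrite (incr_lt node_incr).
move: h; rewrite -[fdim _]/tdim tE tdim_node /width; lia.
Qed.

Definition lift : E := FSp lift_fin.

Lemma d_bound i : `|d i| <= C + 1.
Proof.
have := @dC (fun j => (i + j)%N) 1; rewrite big_ord1/= addn0 addn1 big_nat1 => h.
rewrite -(@ler_pXn2r _ P0.+2) ?nnegrE ?addr_ge0//.
apply: (le_trans (h _)); first by move=> j _; rewrite leq_add2l.
apply: (@le_trans _ _ (C + 1)); first by rewrite lerDl.
by apply: ler_eXnr => //; rewrite lerDr.
Qed.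

Lemma qsum_lift : qsum lift = \sum_(i < n) d i.
Proof.
rewrite (@qsumE lift (maxn (fbound tree_frame lift) n)) ?leq_maxl//.
rewrite (eq_bigr (fun i : 'I_(maxn (fbound tree_frame lift) n) => if (i < n)%N then d i else 0)).
  by rewrite -big_mkcond/= -(big_ord_widen _ d) ?leq_maxr.
by move=> i _; rewrite -qv_lvec; congr qv; apply/funext => t; apply/funext => l /=; rewrite eqxx.
Qed.

(** The supremum runs over all good nodes of the tree. By [coherent_branch] each acts on [lvec] like
    a node of the branch, possibly an early one, and so sees an initial piece of the interval; [m]
    marks the piece of largest norm. The error term covers rounding and the coordinate
    functionals. *)
Lemma NI_lift a c ia ic : (ic <= n)%N ->
  (forall i, (i < n)%N -> (node i < a)%N = (i < ia)%N) ->
  (forall i, (i < n)%N -> (node i < c)%N = (i < ic)%N) -> (ia <= ic)%N ->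
  exists2 m, (ia <= m <= ic)%N & NI (tree_fam P0) a c lvec <=
    `|\sum_(ia <= i < m) d i| + \sum_(ia <= i < ic) 2^-1 ^+ (i + 3) * (C + 1).
Proof.
move=> icn ha hc iaic.
have C1 : 0 <= C + 1 by rewrite addr_ge0.
have [m mP mmax] : exists2 m, (ia <= m <= ic)%N & forall k, (ia <= k <= ic)%N ->
    `|\sum_(ia <= i < k) d i| <= `|\sum_(ia <= i < m) d i|.
  clear ha hc; elim: ic iaic icn => [|ic IH] iaic icn.
    by exists ia => [|k kP]; rewrite ?leqnn//; have -> : k = ia by lia.
  have [E'|lt] := eqVneq ia ic.+1.
    by exists ia => [|k kP]; rewrite ?leqnn//; have -> : k = ia by lia.
  have [||m mP mmax] := IH; [lia|lia|].
  have [le|ge] := leVlt `|\sum_(ia <= i < ic.+1) d i| `|\sum_(ia <= i < m) d i|.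
    exists m; first lia.
    move=> k kP; have [->//|kic] := eqVneq k ic.+1; apply: mmax; lia.
  exists ic.+1; first lia.
  move=> k kP; have [->//|kic] := eqVneq k ic.+1.
  by apply: le_trans (ltW ge); apply: mmax; lia.
have S0 ia' ic' : 0 <= \sum_(ia' <= i < ic') 2^-1 ^+ (i + 3) * (C + 1).
  by apply: sumr_ge0 => i _; rewrite mulr_ge0// exprn_ge0.
exists m => //; apply: (NI_le (@ffam_mass R tree_frame P0)); first by rewrite addr_ge0.
move=> psi [[s [al [[cs _ _] ial ->]]]|[t [l [lt ->]]]].
  have [m' [x [x1 ->]]] := coherent_branch cs ial lvec_out.
  pose k := maxn ia (minn m' ic).
  have -> : \sum_(i < m') rs i x (rst a c lvec) = \sum_(ia <= i < k) rs i x lvec.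
    have rz i : (n <= i)%N -> rs i x lvec = 0.
      by move=> ni; rewrite /rs big1// => l _; rewrite lvec_node ltnNge ni mulr0.
    rewrite -(@sum_ite _ (fun i => rs i x lvec) ia k (maxn m' n)); last by rewrite /k; lia.
    rewrite (big_ord_widen (maxn m' n) (fun i => rs i x (rst a c lvec))) ?leq_maxl//.
    rewrite big_mkcond/=; apply: eq_bigr => i _; rewrite rs_rst.
    have [iN|ni] := ltnP i n; last by rewrite rz//; do ?case: ifP.
    rewrite [(a <= _)%N]leqNgt ha// hc// -leqNgt.
    have -> : (ia <= i < k)%N = (i < m')%N && (ia <= i < ic)%N by rewrite /k; lia.
    by case: (i < m')%N.
  apply: (@le_trans _ _ (`|(\sum_(ia <= i < k) qv lvec i) x| +
      \sum_(ia <= i < k) 2^-1 ^+ (i + 3) * (C + 1))).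
    have := ler_normD (\sum_(ia <= i < k) rs i x lvec - (\sum_(ia <= i < k) qv lvec i) x)
      ((\sum_(ia <= i < k) qv lvec i) x); rewrite subrK => /le_trans; apply.
    rewrite addrC lerD2l [X in _ - X]dual_sumE -sumrB; apply: (le_trans (ler_norm_sum _ _ _)).
    apply: ler_sum => i _; apply: (le_trans (rs_near _ _ _)).
    rewrite ler_wpM2l ?exprn_ge0// qv_lvec; case: ifP => _; [exact: d_bound|by rewrite normr0].
  apply: lerD.
    have h3 := dual_ball (lexx `|\sum_(ia <= i < k) qv lvec i|) x1.
    apply: (le_trans h3); apply: le_trans (mmax k _); last by rewrite /k; lia.
    rewrite big_nat_cond [X in _ <= `|X|]big_nat_cond le_eqVlt; apply/orP; left; apply/eqP.
    congr `|_|; apply: eq_bigr => i; rewrite andbT => /andP[_ ik]; rewrite qv_lvec.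
    have -> // : (i < n)%N by move: ik; rewrite /k; lia.
  have kic : (k <= ic)%N by rewrite /k; lia.
  rewrite [leRHS](@big_cat_nat _ _ _ k)//=; last by rewrite /k; lia.
  by rewrite lerDl.
rewrite normrM ger0_norm ?exprn_ge0// -[leLHS]add0r lerD// /rst; case: ifP => h; last first.
  by rewrite normr0 mulr0.
have [[i tE]|no] := pselect (exists i, t = node i); last first.
  by rewrite lvec_out ?normr0 ?mulr0// => i tE; apply: no; exists i.
rewrite tE lvec_node tdim_node; case: ltnP => iN; last by rewrite normr0 mulr0.
have ii : (ia <= i < ic)%N by move: h; rewrite tE leqNgt ha// hc// -leqNgt.
rewrite /lcoef; case: ifP => [/andP[_ lh]|_]; last by rewrite normr0 mulr0.
(* The padding in [width i] pays for the size of the coefficient [lcoef i l]. *)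
apply: (@le_trans _ _ (2^-1 ^+ (i + 3) * (C + 1))).
  apply: (@le_trans _ _ (2^-1 ^+ width i * (kapsum i * `|d i|))).
    rewrite ler_wpM2l ?exprn_ge0// normrM ger0_norm ?addr_ge0//.
    apply: (@le_trans _ _ (kap l * `|d i|)).
      by rewrite /kap -mulrA ler_wpM2l ?addr_ge0// mulrC; exact: dual_ub.
    rewrite ler_wpM2r// /kapsum (bigD1 (Ordinal lh))//= lerDl sumr_ge0// => k _.
    exact: kap_ge0.
  rewrite mulrA [_ * kapsum i]mulrC ler_pM ?mulr_ge0 ?kapsum_ge0 ?exprn_ge0//; last exact: d_bound.
  exact: kap_width.
have /andP[i1 i2] := ii; rewrite (@big_cat_nat _ _ _ i)//=; last exact: ltnW.
by rewrite (big_ltn i2) -[leLHS]add0r lerD// lerDl.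
Qed.

(** Minkowski's inequality separates the block sums [A] from the errors [B]. The points [k j] refine
    the cut to [m.*2] intervals, so the lower estimate [dC] bounds the power sum of [A]; the errors
    add up to at most [(C + 1) / 4]. *)
Lemma lift_norm : `|lift| <= 2 * (C + 1).
Proof.
have C1 : 0 <= C + 1 by rewrite addr_ge0.
rewrite fspace_normE (@fnorm_single _ _ _ P0); last by move=> P t l /= /negbTE ->.
have lE : lift P0 = lvec by apply/funext => t; apply/funext => l /=; rewrite eqxx.
rewrite /fnrm lE.
apply: (nrm_le (p := P0.+2) isT (@ffam_mass R tree_frame P0)) => [|m c nc].
  by rewrite mulr_ge0.
have [idx idxP] := choice (fun z => index_ex n z node_incr).
have idx_le k : (idx k <= n)%N by have [] := idxP k.
have idxE k i : (i < n)%N -> (node i < k)%N = (i < idx k)%N by have [_] := idxP k; apply.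
have idx_mono k k' : (k <= k')%N -> (idx k <= idx k')%N.
  move=> kk; rewrite leqNgt; apply/negP => lt.
  have iN := leq_trans lt (idx_le k); have := idxE k _ iN; have := idxE k' _ iN.
  by rewrite ltnn lt => + h'; rewrite (leq_trans _ kk).
have ex (j : nat) : exists k, (j < m)%N -> (idx (c j) <= k <= idx (c j.+1))%N /\
    NI (tree_fam P0) (c j) (c j.+1) lvec <= `|\sum_(idx (c j) <= i < k) d i| +
    \sum_(idx (c j) <= i < idx (c j.+1)) 2^-1 ^+ (i + 3) * (C + 1).
  have [jm|mj] := ltnP j m; last by exists 0%N.
  have [||||k kP kN] := @NI_lift (c j) (c j.+1) (idx (c j)) (idx (c j.+1)) => //.
  - by move=> i; exact: idxE.
  - by move=> i; exact: idxE.
  - by apply: idx_mono; exact: nc.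
  by exists k.
have [k kP] := choice ex.
pose B j := \sum_(idx (c j) <= i < idx (c j.+1)) 2^-1 ^+ (i + 3) * (C + 1).
pose A j := `|\sum_(idx (c j) <= i < k j) d i|.
have A0 j : 0 <= A j by exact: normr_ge0.
have B0 j : 0 <= B j by apply: sumr_ge0 => i _; rewrite mulr_ge0// exprn_ge0.
have -> : 2 * (C + 1) = (C + 1) + (C + 1) by rewrite mulr_natl mulr2n.
rewrite -[pcut _ _ _ _ _]/(pcut P0.+2 (@tree_fam R P0) lvec m c).
apply: (@le_trans _ _ (\sum_(j < m) (A j + B j) ^+ P0.+2)).
  apply: ler_sum => j _; rewrite lerXn2r ?nnegrE ?addr_ge0//.
    exact: (NI_ge0 (@ffam_mass R tree_frame P0)).
  by have [] := kP j (ltn_ord j).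
apply: (@minkowski _ P0.+2 m A B) => //.
  apply: (@le_trans _ _ C); last first.
    apply: (@le_trans _ _ (C + 1)); first by rewrite lerDl.
    by apply: ler_eXnr => //; rewrite lerDr.
  pose f i := if odd i then k i./2 else idx (c i./2).
  have := @dC f m.*2; rewrite (@sum_even_odd _ (fun j => `|\sum_(f j <= i < f j.+1) d i| ^+ P0.+2)).
  have -> : uphalf m.*2 = m by rewrite uphalf_double.
  move=> h; apply: le_trans (h _).
    rewrite -[leLHS]addr0 lerD ?sumr_ge0//.
    apply: ler_sum => j _; rewrite /f /= odd_double/= doubleK uphalf_double.
    by [].
  move=> j jm; rewrite /f /=; have jE := odd_double_half j.
  rewrite uphalf_half; case: (odd j) jE => /= jE.
    by have [|/andP[_]] := kP j./2; first by lia.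
  by rewrite add0n; have [|/andP[]] := kP j./2; first by lia.
apply: le_trans (sum_pow_le _ _ _) _ => //.
rewrite lerXn2r ?nnegrE ?sumr_ge0//.
have [|_ ->] := @sum_cuts _ (fun i => 2^-1 ^+ (i + 3) * (C + 1)) (fun j => idx (c j)) m.
  by move=> j jm; apply: idx_mono; exact: nc.
by apply: (le_trans (err_sum _ _ C1)); rewrite ler_piMr// invf_le1// ler1n.
Qed.

End Lift.

(** A functional [y] norming [x] is decomposed and lifted. The decomposition loses at most about
    half of [|x|], so the lift, of norm at most [2 * (C + 1)], still sees the other half. *)
Lemma embed_below (x : X) (f : dual E) : (forall w, f w = qsum w x) ->
  (4 * (C + 1))^-1 * `|x| <= `|f|.
Proof.
move=> fE; have C1 : 0 < C + 1 by rewrite ltr_wpDl.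
have [y [y1 yx]] := hahn_banach_norming x.
have [d [dF dC dl]] := HL y1.
rewrite ler_pdivrMl ?mulr_gt0//; apply/ler_addgt0Pr => e e0.
have e2 : 0 < e / 2 by rewrite divr_gt0.
have [n nP] := dl x _ e2.
have h1 : `|f (lift d n) : R| <= `|f| * (2 * (C + 1)).
  by apply: (le_trans (dual_ub _ _)); rewrite ler_wpM2l//; exact: lift_norm.
move: h1; rewrite fE qsum_lift// => h1.
have h2 : `|x| <= `|(\sum_(i < n) d i) x : R| + (`|x| / 2 + e / 2).
  have yx' : `|x| = `|y x : R| by rewrite yx normr_id.
  rewrite {1}yx'; have := ler_normD ((\sum_(i < n) d i) x : R) ((y - \sum_(i < n) d i) x).
  have -> : ((\sum_(i < n) d i) x : R) + (y - \sum_(i < n) d i) x = y x.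
    by rewrite -[X in _ + X]/((y x : R) - (\sum_(i < n) d i) x) addrC subrK.
  by move=> /le_trans; apply; rewrite lerD2l.
move: h1 h2; rewrite [`|f| * _]mulrC; move: `|f| `|x| `|(\sum_(i < n) d i) x : R|.
by move=> a1 a2 a3; move: (C + 1) => c1; rewrite -!mulrA; move: (c1 * a1) => z; lra.
Qed.

End Embedding.

(** * Superreflexive spaces *)

Section EmbeddingTheorem.
Context {R : realType}.

(** Common to spaces of Szlenk index [omega] and to superreflexive spaces: both enter through the
    termination of finite derivations. *)
Lemma derivation_embeds (X : completeNormedModType R) : separable X -> reflexive_space X ->
  (forall eps : R, 0 < eps -> exists n, wdern n eps (dball (Z := X)) = set0) ->
  (forall eps : R, 0 < eps -> exists n, wdern n eps (dball (Z := dual X)) = set0) ->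
  embeds_as_closed_subspace X (dual (fspace (@tree_frame R))).
Proof.
move=> sX rX HX HY; have [z zd] := separable_seq sX.
have [f fd] := separable_seq (separable_dual rX sX).
pose b := mbasis f z; have bi n : biorth b n by exact: mbasis_biorth.
have [P [lo [hi [C [C0 HU HL]]]]] := block_structure bi (mbasis_denseY z fd) (mbasis_denseX f zd) rX HX HY.
have [T TP] := choice (embed_ex bi C0 HU).
have TE x w : T x w = qsum b lo hi P w x by have [] := TP x.
have Tl : linear T.
  move=> a x y; apply: dual_ext => w; rewrite TE linearP -[RHS]/(a *: (T x w : R^o) + T y w).
  by rewrite !TE.
pose TL : {linear X -> dual (fspace (@tree_frame R))} :=
  HB.pack T (GRing.isLinear.Build R X (dual (fspace (@tree_frame R))) *:%R T Tl).
apply: (@bounded_below_embeds R X (dual (fspace (@tree_frame R))) TL (4 * (C + 1))^-1 2).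
- by rewrite invr_gt0 mulr_gt0// ltr_wpDl.
- by move=> x; have [] := TP x.
- by move=> x; exact: (@embed_below R X b lo hi P C bi C0 HL x (T x) (TE x)).
Qed.

End EmbeddingTheorem.

(** * James arrays from derivations that do not terminate *)

Section JamesArrays.
Context {R : realType}.

(* James's criterion: with one infinite array in place of arrays of all sizes n, the
   two iterated limits of f_k(x_i) would differ, which is impossible by reflexivity. *)
Definition james_array (Z : normedModType R) (th : R) n (f : nat -> dual Z) (x : nat -> Z) :=
  [/\ forall k, `|f k| <= 2, forall i, `|x i| <= 2,
      forall k i, (k < i)%N -> (i < n)%N -> `|f k (x i) : R| <= th / n.+1%:R &
      forall i k, (i <= k)%N -> (k < n)%N -> th <= f k (x i)].

(** Rounding finitely many bounded values leaves finitely many patterns; one point of the ball is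
    kept for each pattern. *)
Lemma ball_net (Z : normedModType R) (Phi : seq (dual Z)) (eta : R) : 0 < eta ->
  exists s : seq Z, forall x, `|x| <= 1 ->
    exists2 z, z \in s /\ `|z| <= 1 & forall f, f \in Phi -> `|f x - f z : R| <= eta.
Proof.
move=> eta0; pose D : R := (Num.truncn eta^-1).+1%:R.
have D0 : 0 < D by rewrite ltr0n.
have De : D^-1 <= eta by rewrite invf_ple ?posrE//; exact/ltW/truncnS_gt.
pose h (x : Z) := [seq Num.floor (D * (f x : R)) | f : dual Z <- Phi].
have fin (Psi : seq (dual Z)) : finite_set
    [set [seq Num.floor (D * (f x : R)) | f : dual Z <- Psi] | x in [set x : Z | `|x| <= 1]].
  elim: Psi => [|f Phi' IH] /=.
    by apply: (@sub_finite_set _ _ [set [::]]) => // _ [x _ <-].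
  have f1 : finite_set [set Num.floor (D * (f x : R)) | x in [set x : Z | `|x| <= 1]].
    pose K := (Num.truncn (D * `|f|)).+1.
    apply: (@sub_finite_set _ _ ((fun n : nat => n%:Z - K%:Z) @` `I_(K.*2.+1))); last first.
      exact: finite_image (finite_II _).
    move=> _ [x /= x1 <-].
    have : `|D * (f x : R)| <= K%:R.
      rewrite normrM gtr0_norm//; apply: le_trans (ltW (truncnS_gt _)).
      by rewrite ler_pM2l//; apply: (le_trans (dual_ub f x)); rewrite ler_piMr.
    rewrite ler_norml => /andP[g1 g2].
    have h1 : - K%:Z <= Num.floor (D * (f x : R)) by rewrite floor_ge_int mulrNz -pmulrn.
    have h2 : Num.floor (D * (f x : R)) <= K%:Z.
      by rewrite -(ler_int R) -pmulrn; exact: le_trans (floor_le _) g2.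
    by exists (absz (Num.floor (D * (f x : R)) + K%:Z)) => /=; lia.
  apply: (@sub_finite_set _ _ _ _ (finite_image2 cons f1 IH)) => _ [x x1 <-] /=.
  by exists (Num.floor (D * (f x : R))); [exists x|exists [seq Num.floor (D * (f x : R)) | f : dual Z <- Phi'] => //; exists x].
have [s sP] := (finite_seqP _).1 (fin Phi).
pose r v := xget 0 [set x : Z | `|x| <= 1 /\ h x = v].
exists [seq r v | v <- s] => x x1.
have xs : h x \in s by have : [set` s] (h x) by [rewrite -sP; exists x].
have [r1 rh] : `|r (h x)| <= 1 /\ h (r (h x)) = h x.
  exact: (@xgetI _ _ [set y | `|y| <= 1 /\ h y = h x] x (conj x1 erefl)).
exists (r (h x)); first by split=> //; exact: map_f.
move=> f fPhi; have /(_ _ fPhi) E := (eq_in_map _ _ _).2 rh.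
have /andP[a1 a2] := floor_itv (D * (f x : R)).
have /andP[a3 a4] := floor_itv (D * (f (r (h x)) : R)).
apply: le_trans De; rewrite -(ler_pM2l D0) divff ?gt_eqF// -[X in X * _]gtr0_norm// -normrM mulrBr.
move: a1 a2 a3 a4; rewrite E !intrD; set w := _%:~R; set u := D * _; set v := D * _.
by move=> a1 a2 a3 a4; rewrite ler_norml; lra.
Qed.

(** Take [x] in the ball with [(g - f) x >= eps / 2] and subtract a net point [z] with almost the
    same values on [Phi]. This kills [Phi] up to [eta], and the gap survives because [g] was chosen
    close to [f] on the whole net. *)
Lemma wder_step (Z : normedModType R) (K : set (dual Z)) f (Phi : seq (dual Z)) F (eps eta : R) :
  0 < eps -> 0 < eta -> wder (eps + eps) K f ->
  exists g x, [/\ K g, wnbhd F eta f g, `|x| <= 2,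
    forall h, h \in Phi -> `|h x : R| <= eta & eps / 2 - eta <= (g x : R) - f x].
Proof.
move=> eps0 eta0 Kf.
have e2 : 0 < eta / 2 by rewrite divr_gt0.
have [s sP] := @ball_net Z Phi eta eta0.
have [g [Kg gF gf]] := wder_half (F ++ s) Kf eta0.
have [x x1 xg] : exists2 x : Z, `|x| <= 1 & eps / 2 <= (g - f) x.
  apply: contrapT => no.
  have : `|g - f| <= eps / 2.
    apply: dual_norm_le => x x1; rewrite ler_norml; apply/andP; split.
      rewrite lerNl leNgt; apply/negP => h; apply: no; exists (- x); first by rewrite normrN.
      by rewrite linearN/= ltW.
    by rewrite leNgt; apply/negP => h; apply: no; exists x => //; exact: ltW.
  by move=> /(le_trans gf); lra.
have [z [zs z1] zP] := sP x x1.
exists g, (x - z); split=> //.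
- by move=> y yF; apply: gF; rewrite mem_cat yF.
- by apply: (le_trans (ler_normB _ _)); rewrite -[leRHS]/(1 + 1) lerD.
- by move=> h hP; rewrite linearB/=; exact: zP.
have := gF z; rewrite mem_cat zs orbT => /(_ isT); rewrite ltr_norml => /andP[_ gz].
have -> : (g (x - z) : R) - f (x - z) = ((g x : R) - g z) - ((f x : R) - f z).
  by congr (_ - _); rewrite linearB.
move: xg; rewrite -[(g - f) x]/((g x : R) - f x).
by move: gz; move: (g x : R) (g z : R) (f x : R) (f z : R) => a b c d; lra.
Qed.

(** Each step gives up one derivation and preserves the earlier values up to [eta]; the drift
    accumulates to [(k - i)%:R * eta]. The entry [x 0] is a placeholder, hence [0 < i]. *)
Lemma wdern_array (Z : normedModType R) (eps eta : R) f0 n : 0 < eps -> 0 < eta ->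
  wdern n (eps + eps) (dball (Z := Z)) f0 -> forall m, (m <= n)%N ->
  exists (g : nat -> dual Z) (x : nat -> Z), [/\
    wdern (n - m) (eps + eps) (dball (Z := Z)) (g m),
    forall k, `|g k| <= 1, forall i, `|x i| <= 2,
    forall k i, (k < i)%N -> (i <= m)%N -> `|g k (x i) : R| <= eta &
    forall i k, (0 < i)%N -> (i <= k)%N -> (k <= m)%N ->
      eps / 2 - 2 * eta - (k - i)%:R * eta <= g k (x i)].
Proof.
move=> eps0 eta0 f0P; elim=> [|m IH] mn.
  exists (fun=> f0), (fun=> 0); split=> // [|k|i|k i|i k].
  - by rewrite subn0.
  - exact: (wdern_sub f0P).
  - by rewrite normr0.
  - by rewrite leqn0 => + /eqP iE; rewrite iE.
  - by move=> i0 ik; rewrite leqn0 => /eqP kE; move: i0 ik; rewrite kE; case: i.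
have [g [x [gP g1 x1 small big]]] := IH (ltnW mn).
have {}gP : wder (eps + eps) (wdern (n - m.+1) (eps + eps) (dball (Z := Z))) (g m).
  by move: gP; rewrite -[(n - m)%N](@prednK) ?subn_gt0// -subnS.
have [h [y [hP hF y2 yPhi hy]]] := wder_step [seq g k | k <- iota 0 m.+1]
  [seq x i | i <- iota 0 m.+1] eps0 eta0 gP.
have h1 : `|h| <= 1 by exact: (wdern_sub hP).
exists (fun k => if (k <= m)%N then g k else h), (fun i => if (i <= m)%N then x i else y).
have memi k : (k <= m)%N -> k \in iota 0 m.+1 by rewrite mem_iota add0n ltnS.
have gy k : (k <= m)%N -> `|g k y : R| <= eta.
  by move=> km; apply: yPhi; apply/mapP; exists k => //; exact: memi.
split=> [|k|i|k i ki im|i k i0 ik km].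
- by rewrite ltnn.
- by case: ifP.
- by case: ifP.
- have km : (k <= m)%N by rewrite -ltnS (leq_trans ki).
  rewrite km; case: (leqP i m) => [im'|mi]; first exact: small.
  exact: gy.
have [km'|mk] := leqP k m; first by rewrite (leq_trans ik km'); exact: big.
have kE : k = m.+1 by lia.
have [im|mi] := leqP i m.
  have := big i m i0 im (leqnn m); have xF : x i \in [seq x i | i <- iota 0 m.+1].
    by apply/mapP; exists i => //; exact: memi.
  have := hF _ xF; rewrite ltr_norml => /andP[+ _]; rewrite kE subSn// -[(m - i).+1%:R]natr1 [((m - i)%:R + 1) * eta]mulrDl mul1r.
  by move: (h (x i) : R) (g m (x i) : R) ((m - i)%:R * eta) => a b c; lra.
have -> : (k - i)%N = 0%N by lia.
have := gy m (leqnn m); rewrite ler_norml => /andP[+ _]; move: hy.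
by move: (h y : R) (g m y : R) => a b; lra.
Qed.

(** [eta = eps / (4 * n.+2)] keeps the accumulated loss, at most [n.+2 * eta], below or equal to
    [eps / 4]; the shift of indices discards the placeholder. *)
Lemma wdern_james (Z : normedModType R) (eps : R) : 0 < eps ->
  (forall n, wdern n (eps + eps) (dball (Z := Z)) <> set0) ->
  forall n, exists f x, @james_array Z (eps / 4) n f x.
Proof.
move=> eps0 ne n; have /eqP/set0P[f0 f0P] := ne n.
have n0 : 0 < 4 * n.+2%:R :> R by rewrite mulr_gt0.
have eta0 : 0 < eps / (4 * n.+2%:R) by rewrite divr_gt0.
have [g [x [_ g1 x2 small big]]] := wdern_array eps0 eta0 f0P (leqnn n).
exists (fun k => g k.+1), (fun i => x i.+1); split.
- by move=> k; apply: (le_trans (g1 _)); rewrite ler1n.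
- by move=> i; exact: x2.
- move=> k i ki iN; apply: (le_trans (small k.+1 i.+1 ki iN)).
  rewrite -mulrA -invfM ler_wpM2l ?(ltW eps0)// lef_pV2 ?posrE ?mulr_gt0//.
  by rewrite ler_pM2l// ler_nat.
move=> i k ik kn; apply: le_trans (big i.+1 k.+1 isT ik kn).
have : (2 + (k.+1 - i.+1)%:R) * (eps / (4 * n.+2%:R)) <= eps / 4.
  rewrite mulrA ler_pdivrMr//.
  have -> : eps / 4 * (4 * n.+2%:R) = n.+2%:R * eps by field.
  by rewrite ler_wpM2r ?(ltW eps0)// -natrD ler_nat; lia.
by rewrite mulrDl; move: (_ * (eps / _)) (2 * _) => a b; lra.
Qed.

(* Exchanging the roles of points and functionals, in the reverse order. *)
Lemma james_array_dual (X : normedModType R) (th : R) n (F : nat -> dual (dual X)) (x : nat -> dual X) :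
  (forall phi : dual (dual X), exists x : X, forall f : dual X, phi f = f x) ->
  james_array th n F x -> exists f y, @james_array X th n f y.
Proof.
move=> rX [F2 x2 small big]; have [p pP] := choice (fun k => rX (F k)).
exists (fun k => x (n - k.+1)%N), (fun i => p (n - i.+1)%N); split.
- by move=> k; exact: x2.
- move=> i; have [g [g1 gp]] := hahn_banach_norming (p (n - i.+1)%N).
  rewrite -gp -pP; apply: (le_trans (ler_norm _)); apply: (le_trans (dual_ub _ _)).
  rewrite -[leRHS]mulr1; exact: ler_pM.
- by move=> k i ki iN; rewrite -pP; apply: small; lia.
- by move=> i k ik kn; rewrite -pP; apply: big; lia.
Qed.

End JamesArrays.

(** * Completion of a normed space inside its bidual *)

Section Completion.
Context {R : realType} (V : normedModType R).

Definition bidual (v : V) : dual (dual V) := sval (cid (@eval_dual R V v)).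

Lemma bidualE v f : bidual v f = f v.
Proof. by have [] := svalP (cid (@eval_dual R V v)). Qed.

Lemma bidual_norm v : `|bidual v| = `|v|.
Proof.
apply/eqP; rewrite eq_le; apply/andP; split; first by have [] := svalP (cid (@eval_dual R V v)).
have [f [f1 fv]] := hahn_banach_norming v; rewrite -fv -bidualE.
by apply: (le_trans (ler_norm _)); apply: (le_trans (dual_ub _ _)); rewrite ler_piMr.
Qed.

Lemma bidual_linear : linear bidual.
Proof.
by move=> a u v; apply: dual_ext => f; rewrite bidualE linearP
  -[RHS]/(a *: (bidual u f : R^o) + bidual v f) !bidualE.
Qed.

(** The norm closure of V in its bidual. The ultralimit space below is only normed, whereas
    [superreflexive] quantifies over Banach spaces. *)
Definition in_completion : {pred dual (dual V)} :=
  fun F => `[< forall e : R, 0 < e -> exists v, `|F - bidual v| <= e >].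

Record completion := Completion { completion_val :> dual (dual V); _ : in_completion completion_val }.
HB.instance Definition _ := [isSub for completion_val].
HB.instance Definition _ := [Choice of completion by <:].

Lemma in_completion_submod : submod_closed in_completion.
Proof.
have b0 : bidual 0 = 0.
  by have := bidual_linear (-1) 0 0; rewrite scaler0 addr0 scaleN1r addNr.
split; first by apply/asboolP => e e0; exists 0; rewrite b0 subrr normr0 ltW.
move=> a F G /asboolP FP /asboolP GP; apply/asboolP => e e0.
have a1 : 0 < `|a| + 1 by rewrite ltr_wpDl.
have e2 : 0 < e / 2 by rewrite divr_gt0.
have [v vP] := FP _ (divr_gt0 e2 a1); have [w wP] := GP _ e2.
exists (a *: v + w); rewrite bidual_linear opprD addrACA -scalerBr.
apply: (le_trans (ler_normD _ _)); rewrite (splitr e) lerD// normrZ.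
apply: (@le_trans _ _ ((`|a| + 1) * (e / 2 / (`|a| + 1)))); first by rewrite ler_pM// lerDl.
by rewrite mulrC divfK// gt_eqF.
Qed.

HB.instance Definition _ :=
  GRing.isSubmodClosed.Build R (dual (dual V)) in_completion in_completion_submod.
HB.instance Definition _ := [SubChoice_isSubLmodule of completion by <:].

Definition completion_norm (F : completion) : R := `|completion_val F|.

Lemma completion_normD F G : completion_norm (F + G) <= completion_norm F + completion_norm G.
Proof. exact: ler_normD. Qed.

Lemma completion_normZ a F : completion_norm (a *: F) = `|a| * completion_norm F.
Proof. exact: normrZ. Qed.

Lemma completion_norm0 F : completion_norm F = 0 -> F = 0.
Proof. by move=> /normr0_eq0 F0; exact: val_inj. Qed.

HB.instance Definition _ := Lmodule_isNormed.Build R completion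
  completion_normD completion_normZ completion_norm0.

Lemma completion_normE (F : completion) : `|F| = `|completion_val F|. Proof. by []. Qed.

Lemma completion_approx (F : completion) (e : R) : 0 < e -> exists v, `|completion_val F - bidual v| <= e.
Proof. by case: F => F /= /asboolP; apply. Qed.

Lemma completion_complete (F : set_system completion) : ProperFilter F -> cauchy F -> cvg F.
Proof.
move=> FF /cauchy_ballP Fc.
have Gc : cauchy (completion_val @ F).
  apply/cauchy_ballP => e e0; have [[A B] [/= FA FB] AB] := Fc e e0.
  exists (completion_val @` A, completion_val @` B) => /=.
    by split; [apply: filterS FA|apply: filterS FB] => y Ay; exists y.
  move=> [_ _] /= [[y Ay <-] [z Bz <-]]; have := AB (y, z) (conj Ay Bz).
  by rewrite -!ball_normE.
have /cvg_ex[G FG] : cvg (completion_val @ F) by apply: cauchy_cvg.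
have near e : 0 < e -> F [set y : completion | `|G - completion_val y| < e].
  by move=> e0; move/cvgrPdist_lt: FG => /(_ e e0).
have GS : in_completion G.
  apply/asboolP => e e0; have e2 : 0 < e / 2 by rewrite divr_gt0.
  have [y yG] := filter_ex (near _ e2); have [v vP] := completion_approx y e2.
  exists v; apply: (le_trans (dist_triangle _ _ (completion_val y))).
  by rewrite (splitr e); apply: lerD; [exact: ltW|rewrite distrC].
apply/cvg_ex; exists (Completion GS); apply/cvgrPdist_lt => e e0.
by apply: filterS (near e e0) => y.
Qed.

HB.instance Definition _ := Uniform_isComplete.Build completion completion_complete.

Lemma bidual_in v : in_completion (bidual v).
Proof. by apply/asboolP => e e0; exists v; rewrite subrr normr0 ltW. Qed.

Definition cinj v : completion := Completion (bidual_in v).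

End Completion.

(** * Bases and coefficient bounds in finite-dimensional spans *)

Section FiniteDimension.
Context {R : realType} (V : normedModType R).

Definition comb m (b : nat -> V) (c : nat -> R) : V := \sum_(j < m) c j *: b j.

Definition independent m (b : nat -> V) :=
  forall c, comb m b c = 0 -> forall j, (j < m)%N -> c j = 0.

Lemma comb_linear m b a c d : comb m b (fun j => a * c j + d j) = a *: comb m b c + comb m b d.
Proof.
by rewrite /comb scaler_sumr -big_split/=; apply: eq_bigr => j _; rewrite scalerDl scalerA.
Qed.

Lemma comb_norm m b c : `|comb m b c| <= \sum_(j < m) `|c j| * `|b j|.
Proof. by apply: (le_trans (ler_norm_sum _ _ _)); apply: ler_sum => j _; rewrite normrZ. Qed.

(** Finite representability tests families that may be dependent; a basis makes the coefficients
    unique. *)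
Lemma basis_ex n (e : nat -> V) : exists m b, independent m b /\
  forall c, exists d, comb n e c = comb m b d.
Proof.
elim: n => [|n [m [b [bi bs]]]].
  exists 0%N, (fun=> 0); split=> [c _ []//|c]; exists c; by rewrite /comb !big_ord0.
have [[d0 en]|no] := pselect (exists d, e n = comb m b d).
  exists m, b; split=> // c; have [d dE] := bs c.
  exists (fun j => c n * d0 j + d j).
  by rewrite comb_linear -en -dE /comb big_ord_recr/= addrC.
pose b' j := if (j < m)%N then b j else e n.
have b'E c : comb m.+1 b' c = comb m b c + c m *: e n.
  rewrite /comb big_ord_recr/= {2}/b' ltnn; congr (_ + _).
  by apply: eq_bigr => j _; rewrite /b' ltn_ord.
exists m.+1, b'; split=> [c|c].
  rewrite b'E => c0; have cm : c m = 0.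
    apply: contrapT => /eqP cm; apply: no; exists (fun j => - (c m)^-1 * c j + 0).
    have /(congr1 (fun v => (c m)^-1 *: v)) := c0.
    rewrite scalerDr scalerA mulVf// scale1r scaler0 => /eqP.
    rewrite addrC addr_eq0 => /eqP ->; rewrite comb_linear scaleNr.
    by rewrite [X in _ + X](_ : _ = 0) ?addr0// /comb big1// => j _; rewrite scale0r.
  move=> j; rewrite ltnS leq_eqVlt => /orP[/eqP -> //|jm].
  by apply: (bi c) => //; move: c0; rewrite cm scale0r addr0.
have [d dE] := bs c; exists (fun j => if (j < m)%N then d j else c n).
rewrite b'E ltnn /comb big_ord_recr/= -[X in X + _]/(comb n e c) dE; congr (_ + _).
by apply: eq_bigr => j _; rewrite ltn_ord.
Qed.

Lemma ucvg_sum m (a : nat -> nat -> R) (l : nat -> R) :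
  (forall j, (j < m)%N -> (fun n => a n j) @ ufil --> l j) ->
  (fun n => \sum_(j < m) a n j) @ ufil --> \sum_(j < m) l j.
Proof.
elim: m => [|m IH] al.
  have -> : (fun n => \sum_(j < 0) a n j) = (fun=> 0) by apply/funext => n; rewrite big_ord0.
  by rewrite big_ord0; exact: cvg_cst.
have -> : (fun n => \sum_(j < m.+1) a n j) = (fun n => \sum_(j < m) a n j + a n m).
  by apply/funext => n; rewrite big_ord_recr.
rewrite big_ord_recr/=; apply: cvgD; last exact: al.
by apply: IH => j jm; apply: al; exact: ltnW.
Qed.

Lemma sphere_limit m (c : nat -> nat -> R) : (forall n, \sum_(j < m) `|c n j| = 1) ->
  exists2 l : nat -> R, \sum_(j < m) `|l j| = 1 &
    forall w : nat -> R, (fun n => \sum_(j < m) `|c n j - l j| * w j) @ ufil --> (0 : R).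
Proof.
move=> c1; have ex j : exists l : R, (j < m)%N -> (fun n => c n j) @ ufil --> l.
  case: (ltnP j m) => jm; last by exists 0.
  have [n|l lP] := @ucvg_bounded R (fun n => c n j) 1; last by exists l.
  by rewrite -(c1 n) (bigD1 (Ordinal jm))//= lerDl sumr_ge0.
have [l lP] := choice ex; exists l.
  apply: (@ucvg_unique R (fun n => \sum_(j < m) `|c n j|)).
    apply: (@ucvg_sum m (fun n j => `|c n j|) (fun j => `|l j|)) => j jm.
    by apply: cvg_norm; exact: lP.
  have -> : (fun n => \sum_(j < m) `|c n j|) = (fun=> 1) by apply/funext.
  exact: cvg_cst.
move=> w; have l0 : \sum_(j < m) `|l j - l j| * w j = 0.
  by rewrite big1// => j _; rewrite subrr normr0 mul0r.
rewrite -[X in _ --> X]l0.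
apply: (@ucvg_sum m (fun n j => `|c n j - l j| * w j) (fun j => `|l j - l j| * w j)) => j jm.
by apply: cvgMr_tmp; apply: cvg_norm; apply: cvgB; [exact: lP|exact: cvg_cst].
Qed.

Lemma comb_limit m b (c : nat -> nat -> R) (l : nat -> R) :
  (forall w : nat -> R, (fun n => \sum_(j < m) `|c n j - l j| * w j) @ ufil --> (0 : R)) ->
  (fun n => `|comb m b (c n)| : R) @ ufil --> (`|comb m b l| : R).
Proof.
move=> cl; apply/cvgrPdist_lt => e e0.
have := ucvgr_near (cl (fun j => `|b j|)) e0; apply: filterS => n /=; rewrite sub0r normrN.
move=> h; apply: le_lt_trans h; apply: le_trans (ler_norm _); apply: (le_trans (ler_dist_dist _ _)).
have -> : comb m b l - comb m b (c n) = - comb m b (fun j => c n j - l j).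
  rewrite /comb -sumrB -sumrN; apply: eq_bigr => j _.
  by rewrite scalerBl opprB.
by rewrite normrN; exact: comb_norm.
Qed.

Lemma comb_scale m b a c : comb m b (fun j => a * c j) = a *: comb m b c.
Proof. by rewrite /comb scaler_sumr; apply: eq_bigr => j _; rewrite scalerA. Qed.

(** Compactness of the l_1 sphere of coefficients: a failure yields limit coefficients whose moduli
    sum to 1 and whose combination vanishes. *)
Lemma independent_bound m b : independent m b ->
  exists2 k : R, 0 < k & forall c : nat -> R, k * \sum_(j < m) `|c j| <= `|comb m b c|.
Proof.
move=> bi; apply: contrapT => no.
have ex n : exists c : nat -> R, \sum_(j < m) `|c j| = 1 /\ `|comb m b c| <= n.+1%:R^-1.
  have n0 : 0 < n.+1%:R^-1 :> R by rewrite invr_gt0.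
  have : ~ forall c : nat -> R, n.+1%:R^-1 * \sum_(j < m) `|c j| <= `|comb m b c|.
    by move=> h; apply: no; exists n.+1%:R^-1.
  move=> /existsNP[c /negP]; rewrite -ltNge => h.
  set s := \sum_(j < m) _ in h; have s0 : 0 < s.
    by rewrite -(pmulr_rgt0 _ n0); exact: le_lt_trans h.
  exists (fun j => s^-1 * c j); split.
    under eq_bigr do rewrite normrM gtr0_norm ?invr_gt0//.
    by rewrite -mulr_sumr mulVf// gt_eqF.
  by rewrite comb_scale normrZ gtr0_norm ?invr_gt0// ler_pdivrMl// mulrC ltW.
have [c cP] := choice ex.
have [l l1 cl] := sphere_limit (fun n => (cP n).1).
have lb := @comb_limit _ b _ _ cl.
have l0 : comb m b l = 0.
  apply/eqP; rewrite -normr_le0; apply/ler_addgt0Pr => e e0; rewrite add0r.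
  apply: (ucvg_le lb); apply: filterS (ufil_ge (Num.truncn e^-1)) => n /= en.
  apply: (le_trans (cP n).2); rewrite invf_ple ?posrE//; apply/ltW.
  by apply: lt_le_trans (truncnS_gt _) _; rewrite ler_nat.
have := oner_neq0 R; rewrite -l1 big1 ?eqxx// => j _.
by rewrite (bi l l0 j (ltn_ord j)) normr0.
Qed.

End FiniteDimension.

Record jarray (R : realType) (X : normedModType R) := JArray {
  jth : R; jf : nat -> nat -> dual X; jx : nat -> nat -> X;
  jth_gt0 : 0 < jth; jarrayP : forall n, james_array jth n (jf n) (jx n) }.

(** * The ultralimit space of a sequence of James arrays *)

Section JamesSpace.
Context {R : realType} (X : normedModType R) (A : jarray X).
Local Notation th := (jth A).

(** Polynomials stand for finitely supported sequences and ['X^i] for the i-th unit vector. The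
    argument is a tag: the norm put on the type depends on it. *)
Definition jspace (_ : jarray X) := {poly R}.
Local Notation jsp := (jspace A).
HB.instance Definition _ := GRing.Lmodule.copy jsp {poly R}.

Definition jval n (p : jsp) : X := \sum_(i < size p) p`_i *: jx A n i.

Lemma jvalE n (p : jsp) m : (size p <= m)%N -> jval n p = \sum_(i < m) p`_i *: jx A n i.
Proof.
move=> pm; rewrite /jval (big_ord_widen m (fun i => p`_i *: jx A n i))// big_mkcond/=.
by apply: eq_bigr => i _; case: ltnP => // h; rewrite nth_default ?scale0r.
Qed.

Lemma jval_linear n : linear (jval n).
Proof.
move=> a p q; pose m := maxn (size (a *: p + q : {poly R})) (maxn (size p) (size q)).
rewrite !(@jvalE _ _ m) ?leq_maxl ?leq_max ?leqnn ?orbT//.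
rewrite scaler_sumr -big_split/=; apply: eq_bigr => i _.
by rewrite coefD coefZ scalerDl scalerA.
Qed.

Definition jbound (p : jsp) : R := \sum_(i < size p) `|p`_i| * 2.

Lemma jval_bound n p : `|jval n p| <= jbound p.
Proof.
apply: (le_trans (ler_norm_sum _ _ _)); apply: ler_sum => i _; rewrite normrZ ler_wpM2l//.
by have [_ x2 _ _] := jarrayP A n.
Qed.

Definition jnorm (p : jsp) : R :=
  xget 0 [set l : R | (fun n => `|jval n p| : R) @ ufil --> l].

Lemma jnormP p : (fun n => `|jval n p| : R) @ ufil --> (jnorm p : R).
Proof.
have [n|l lP] := @ucvg_bounded R (fun n => `|jval n p|) (jbound p).
  by rewrite normr_id jval_bound.
exact: (@xgetI _ _ [set l : R | (fun n => `|jval n p| : R) @ ufil --> l] l lP).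
Qed.

Lemma jnormD p q : jnorm (p + q) <= jnorm p + jnorm q.
Proof.
rewrite -subr_ge0; apply: (ucvg_ge (cvgB (cvgD (@jnormP p) (@jnormP q)) (@jnormP (p + q)))).
apply: filterE => n /=; rewrite -[X in _ <= X]/(`|jval n p| + `|jval n q| - `|jval n (p + q)|).
by have := jval_linear n 1 p q; rewrite !scale1r subr_ge0 => ->; exact: ler_normD.
Qed.

Lemma jval0 n : jval n 0 = 0.
Proof. by have := jval_linear n (-1) 0 0; rewrite scaler0 addr0 scaleN1r addNr. Qed.

Lemma jnormZ a p : jnorm (a *: p) = `|a| * jnorm p.
Proof.
apply: (ucvg_unique (@jnormP (a *: p))).
have -> : (fun n => `|jval n (a *: p)| : R) = (fun n => `|a| * `|jval n p|).
  by apply/funext => n; have := jval_linear n a p 0; rewrite jval0 !addr0 => ->; rewrite normrZ.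
by apply: cvgMl_tmp; exact: (@jnormP p).
Qed.

Lemma jlim_ex k i : exists l : R, (fun n => jf A n k (jx A n i) : R) @ ufil --> l.
Proof.
apply: (@ucvg_bounded R _ (2 * 2)) => n; have [f2 x2 _ _] := jarrayP A n.
by apply: (le_trans (dual_ub _ _)); rewrite ler_pM.
Qed.

Definition jlim k i : R := sval (cid (jlim_ex k i)).

Lemma jlimP k i : (fun n => jf A n k (jx A n i) : R) @ ufil --> jlim k i.
Proof. exact: (svalP (cid (jlim_ex k i))). Qed.

Lemma jlim0 k i : (k < i)%N -> jlim k i = 0.
Proof.
move=> ki; apply/eqP; rewrite -normr_le0; apply/ler_addgt0Pr => e e0; rewrite add0r.
apply: (ucvg_le (cvg_norm (@jlimP k i))).
apply: filterS (ufil_ge (maxn i.+1 (Num.truncn (th / e)))) => n /=; rewrite geq_max => /andP[iN en].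
have [_ _ small _] := jarrayP A n; apply: (le_trans (small k i ki iN)).
rewrite ler_pdivrMr// mulrC -ler_pdivrMr//; apply/ltW.
by apply: lt_le_trans (truncnS_gt _) _; rewrite ler_nat.
Qed.

Lemma jlim_ge k i : (i <= k)%N -> th <= jlim k i.
Proof.
move=> ik; apply: (ucvg_ge (@jlimP k i)); apply: filterS (ufil_ge k.+1) => n /= kn.
by have [_ _ _ big] := jarrayP A n; exact: big.
Qed.

Definition jfun k (p : jsp) : R := \sum_(i < size p) p`_i * jlim k i.

Lemma jfunP k p : (fun n => jf A n k (jval n p) : R) @ ufil --> jfun k p.
Proof.
have -> : (fun n => jf A n k (jval n p) : R) =
    (fun n => \sum_(i < size p) p`_i * (jf A n k (jx A n i) : R)).
  apply/funext => n; rewrite /jval linear_sum; apply: eq_bigr => i _.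
  by rewrite linearZ.
apply: (@ucvg_sum R (size p) (fun n i => p`_i * (jf A n k (jx A n i) : R)) (fun i => p`_i * jlim k i)).
by move=> i _; apply: cvgMl_tmp; exact: (@jlimP k i).
Qed.

Lemma jfun_bound k p : `|jfun k p| <= 2 * jnorm p.
Proof.
rewrite -subr_ge0; apply: (ucvg_ge (cvgB (cvgMl_tmp (@jnormP p)) (cvg_norm (@jfunP k p)))).
apply: filterE => n /=; rewrite -[X in _ <= X]/(2 * `|jval n p| - `|jf A n k (jval n p) : R|).
by rewrite subr_ge0; apply: dual_ub1; have [] := jarrayP A n.
Qed.

(** The limits [jlim k i] form a triangular matrix with diagonal at least [th], so the bounded
    functionals [jfun k] recover the coefficients one after the other; the ultralimit seminorm is a
    norm without passing to a quotient. *)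
Lemma jnorm0 p : jnorm p = 0 -> p = 0.
Proof.
move=> p0; apply/polyP => i; rewrite coef0; elim/ltn_ind: i => k IH.
have : jfun k p = 0.
  by apply/eqP; rewrite -normr_le0; apply: (le_trans (jfun_bound k p)); rewrite p0 mulr0.
have [pk|kp] := leqP (size p) k; first by rewrite nth_default.
rewrite /jfun (bigD1 (Ordinal kp))//= big1 ?addr0; last first.
  move=> i ik; have [lt|gt|E] := ltngtP i k; last by case/eqP: ik; apply: val_inj.
    by rewrite IH// mul0r.
  by rewrite jlim0// mulr0.
move=> /eqP; rewrite mulf_eq0 => /orP[/eqP//|/eqP L0].
by have := lt_le_trans (jth_gt0 A) (jlim_ge (leqnn k)); rewrite L0 ltxx.
Qed.

HB.instance Definition _ := Lmodule_isNormed.Build R jsp jnormD jnormZ jnorm0.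

Lemma jspace_normE (p : jsp) : `|p| = jnorm p. Proof. by []. Qed.

Lemma jfun_ex k : exists f : dual jsp, (forall p, f p = jfun k p) /\ `|f| <= 2.
Proof.
have [||f [fE f2]] := @dual_ex R jsp (jfun k) 2.
- move=> a p q; apply: (ucvg_unique (@jfunP k (a *: p + q))).
  have -> : (fun n => jf A n k (jval n (a *: p + q)) : R) =
      (fun n => a * (jf A n k (jval n p) : R) + (jf A n k (jval n q) : R)).
    by apply/funext => n; rewrite jval_linear linearP.
  exact: (cvgD (cvgMl_tmp (@jfunP k p)) (@jfunP k q)).
- exact: jfun_bound.
by exists f; split=> //; exact: f2.
Qed.

Lemma jmonom_norm i : `|('X^i : jsp)| <= 2.
Proof.
apply: (ucvg_le (@jnormP 'X^i)); apply: filterE => n /=.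
rewrite (@jvalE _ _ i.+1) ?size_polyXn// (bigD1 ord_max)//= big1 ?addr0.
  by rewrite coefXn eqxx scale1r; have [_ x2 _ _] := jarrayP A n.
move=> j ji; rewrite coefXn; case: eqP => [E|_]; last by rewrite scale0r.
by case/eqP: ji; apply: val_inj.
Qed.

Lemma jfun_monom k i : jfun k ('X^i : jsp) = jlim k i.
Proof.
rewrite /jfun size_polyXn (bigD1 ord_max)//= big1 ?addr0 ?coefXn ?eqxx ?mul1r//.
move=> j ji; rewrite coefXn; case: eqP => [E|_]; last by rewrite mul0r.
by case/eqP: ji; apply: val_inj.
Qed.

(** In a reflexive space the vectors ['X^i] would have a weak limit [z], on which every [f k]
    vanishes while the w*-limit [G] of the [f k] is at least [th]. But [z] is a norm limit of finite
    vectors [p], and [G p] is the limit of the small numbers [f k p]. *)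
Lemma jcompletion_nonreflexive : ~ reflexive_space (completion jsp).
Proof.
move=> rY; have [f fP] := choice jfun_ex.
have f2 k : `|f k| <= 2 by have [] := fP k.
have fE k p : f k p = jfun k p by have [] := fP k.
have [G [fG G2]] := wscvg_ex f2.
pose y i : completion jsp := cinj ('X^i : jsp).
have y2 i : `|y i| <= 2 by rewrite completion_normE /= bidual_norm jmonom_norm.
have [z zP] := reflexive_wcvg rY y2.
have ev (g : dual jsp) : (fun i => g ('X^i : jsp) : R) @ ufil --> (completion_val z g : R).
  have [||h [hE _]] := @dual_ex R (completion jsp) (fun w => completion_val w g) `|g|.
  - by move=> a u v.
  - by move=> w; rewrite mulrC; exact: dual_ub.
  have := zP h; rewrite hE; have -> // : (fun n => h (y n) : R) = (fun i => g ('X^i : jsp) : R).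
  by apply/funext => i; rewrite hE /= bidualE.
have zf k : completion_val z (f k) = 0.
  apply: (ucvg_unique (ev (f k))); apply/cvgrPdist_lt => e e0.
  apply: filterS (ufil_ge k.+1) => i /= ki.
  by rewrite fE jfun_monom jlim0// subrr normr0.
have zG : th <= completion_val z G.
  apply: (ucvg_ge (ev G)); apply: filterE => i /=.
  apply: (ucvg_ge (fG 'X^i)); apply: filterS (ufil_ge i) => k /= ik.
  by rewrite fE jfun_monom jlim_ge.
have : completion_val z G <= th / 2.
  (* An error [th / 8] on [z] costs [th / 4] against functionals of norm at most 2, once for the
     [f k] and once for [G]. *)
  have d0 : 0 < th / 2 / 4 by rewrite !divr_gt0// jth_gt0.
  have [p pP] := completion_approx z d0.
  have h g : `|g| <= 2 -> `|(completion_val z g : R) - g p| <= th / 4.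
    move=> g2; have := dual_ub (completion_val z - bidual p) g.
    rewrite -[X in `|X| <= _ -> _]/((completion_val z g : R) - bidual p g) bidualE => /le_trans; apply.
    apply: (le_trans (ler_pM _ _ pP g2)) => //; lra.
  have hG := h G G2; have Gp : `|G p : R| <= th / 4.
    apply: (ucvg_le (cvg_norm (fG p))); apply: filterE => k /=.
    by have := h (f k) (f2 k); rewrite zf sub0r normrN.
  move: hG Gp; rewrite !ler_norml => /andP[_ a1] /andP[_ a2].
  by move: a1 a2; move: (completion_val z G : R) (G p : R) => a b; lra.
by have := jth_gt0 A; move: zG; move: (completion_val z G : R) => a; lra.
Qed.

End JamesSpace.

(** * Superreflexivity forces the derivations to terminate *)

Section Superreflexive.
Context {R : realType} (X : completeNormedModType R).

(** A basis of the span is moved into the dense subspace with error [eps * k / 2], where [k]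
    controls coefficients by the norm, and then mapped to X by one [jval N]. If every N failed,
    coefficients on the l_1 sphere would have a limit [l] with norm defect at least
    [eps * |comb m b l| >= eps * k], exceeding that error. *)
Lemma jcompletion_representable (A : jarray X) :
  finitely_representable (completion (jspace A)) X.
Proof.
move=> n e eps eps0.
have [m [b [bi bs]]] := @basis_ex R (completion (jspace A)) n
  (fun i => if insub i is Some j then e j else 0).
have [k k0 kP] := independent_bound bi.
have d0 : 0 < eps * k / 2 by rewrite divr_gt0// mulr_gt0.
have [p pP] := choice (fun j => completion_approx (b j) d0).
have pb (c : nat -> R) : `|(`|comb m p c| : R) - `|comb m b c| | <= eps * k / 2 * \sum_(j < m) `|c j|.
  rewrite -bidual_norm completion_normE; apply: (le_trans (ler_dist_dist _ _)).
  have -> : bidual (comb m p c) - completion_val (comb m b c) =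
      \sum_(j < m) c j *: (bidual (p j) - completion_val (b j)).
    apply: dual_ext => g; rewrite dual_sumE -[LHS]/((bidual (comb m p c) g : R) - completion_val (comb m b c) g).
    rewrite bidualE /comb linear_sum.
    have -> : completion_val (\sum_(j < m) c j *: b j) g = \sum_(j < m) c j * (completion_val (b j) g : R).
      by elim/big_rec2: _ => [//|j u v _ <-].
    rewrite -sumrB; apply: eq_bigr => j _; rewrite linearZ/=.
    by rewrite -[RHS]/(c j * ((bidual (p j) g : R) - completion_val (b j) g)) bidualE mulrBr.
  apply: (le_trans (ler_norm_sum _ _ _)); rewrite mulr_sumr; apply: ler_sum => j _.
  by rewrite normrZ mulrC ler_wpM2r// distrC.
have [N NP] : exists N, forall c,
    `|(`|comb m (fun j => jval N (p j)) c| : R) - `|comb m b c| | <= eps * `|comb m b c|.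
  apply: contrapT => /forallNP no.
  have ex N : exists c : nat -> R, \sum_(j < m) `|c j| = 1 /\ eps * `|comb m b c| <=
      `|(`|comb m (fun j => jval N (p j)) c| : R) - `|comb m b c| |.
    have /existsNP[c /negP] := no N; rewrite -ltNge => h; set s := \sum_(j < m) `|c j|.
    have s0 : 0 < s.
      rewrite lt_def sumr_ge0// andbT; apply/eqP => s0.
      have z j : (j < m)%N -> c j = 0.
        move=> jm; apply/eqP; rewrite -normr_le0 -s0 /s (bigD1 (Ordinal jm))//= lerDl.
        by rewrite sumr_ge0.
      have c0 (W : normedModType R) (u : nat -> W) : comb m u c = 0.
        by rewrite /comb big1// => j _; rewrite z// scale0r.
      by move: h; rewrite !c0 !normr0 mulr0 subrr normr0 ltxx.
    exists (fun j => s^-1 * c j); split.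
      under eq_bigr do rewrite normrM gtr0_norm ?invr_gt0//.
      by rewrite -mulr_sumr mulVf// gt_eqF.
    rewrite !comb_scale !normrZ gtr0_norm ?invr_gt0// -mulrBr normrM gtr0_norm ?invr_gt0//.
    by rewrite mulrCA ler_wpM2l ?invr_ge0 ?(ltW s0)// ltW.
  have [c cP] := choice ex.
  have [l l1 cl] := sphere_limit (fun N => (cP N).1).
  have lb := @comb_limit _ _ _ b _ _ cl.
  have lp : (fun N => `|comb m (fun j => jval N (p j)) (c N)| : R) @ ufil --> (`|comb m p l| : R).
    apply/cvgrPdist_lt => e' e'0; have e2 : 0 < e' / 2 by rewrite divr_gt0.
    have h1 := ucvgr_near (cl (fun j => jbound (p j))) e2.
    have h2 := ucvgr_near (@jnormP _ _ A (comb m p l)) e2.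
    apply: filterS (filterI h1 h2) => N /= [] {h1 h2}; rewrite sub0r normrN => h1 h2.
    rewrite jspace_normE; rewrite (splitr e'); apply: le_lt_trans (ltrD h2 h1).
    apply: (le_trans (dist_triangle _ _ `|jval N (comb m p l)|)); rewrite lerD2l distrC.
    apply: le_trans (ler_norm _); apply: (le_trans (ler_dist_dist _ _)).
    have -> : jval N (comb m p l) = comb m (fun j => jval N (p j)) l.
      rewrite /comb; elim/big_rec2: _ => [|j u v _ <-]; first exact: jval0.
      by rewrite jval_linear.
    have -> : comb m (fun j => jval N (p j)) l - comb m (fun j => jval N (p j)) (c N) =
        - comb m (fun j => jval N (p j)) (fun j => c N j - l j).
      rewrite /comb -sumrB -sumrN; apply: eq_bigr => j _.
      by rewrite scalerBl opprB.
    rewrite normrN; apply: (le_trans (comb_norm _ _ _)); apply: ler_sum => j _.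
    by rewrite ler_wpM2l//; exact: jval_bound.
  have : 0 <= `|(`|comb m p l| : R) - `|comb m b l| | - eps * `|comb m b l|.
    apply: (ucvg_ge (cvgB (cvg_norm (cvgB lp lb)) (cvgMl_tmp lb))); apply: filterE => N /=.
    rewrite -[X in _ <= X]/(`|(`|comb m (fun j => jval N (p j)) (c N)| : R)
      - `|comb m b (c N)| | - eps * `|comb m b (c N)|).
    by rewrite subr_ge0; exact: (cP N).2.
  rewrite subr_ge0 => /le_trans /(_ (pb l)); rewrite l1 mulr1 => h'.
  have := kP l; rewrite l1 mulr1 => /(ler_wpM2l (ltW eps0)) /le_trans /(_ h').
  by have := mulr_gt0 eps0 k0; move: (eps * k) => x; lra.
pose cf (y : completion (jspace A)) := xget (fun=> 0) [set c : nat -> R | y = comb m b c].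
have cfP y : Defs.span e y -> y = comb m b (cf y).
  move=> [c ->]; have [d dE] := bs (fun i => if insub i is Some j then c j else 0).
  apply: (@xgetI _ _ [set d : nat -> R | \sum_i c i *: e i = comb m b d] d) => /=.
  by rewrite -dE /comb; apply: eq_bigr => i _; rewrite valK.
exists (fun y => comb m (fun j => jval N (p j)) (cf y)); split=> [a y z sy sz|y sy].
  have sayz : Defs.span e (a *: y + z).
    move: sy sz => [c ->] [d ->]; exists (fun i => a * c i + d i).
    by rewrite scaler_sumr -big_split/=; apply: eq_bigr => i _; rewrite scalerDl scalerA.
  rewrite -comb_linear /comb; apply: eq_bigr => j _; congr (_ *: _); apply/eqP.
  rewrite -subr_eq0; apply/eqP.
  apply: (bi (fun j => cf (a *: y + z) j - (a * cf y j + cf z j))) => //.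
  have -> : comb m b (fun j => cf (a *: y + z) j - (a * cf y j + cf z j)) =
      comb m b (cf (a *: y + z)) - comb m b (fun j => a * cf y j + cf z j).
    by rewrite /comb -sumrB; apply: eq_bigr => i _; rewrite scalerBl.
  by rewrite comb_linear -!cfP// subrr.
have := NP (cf y); rewrite -cfP// ler_norml => /andP[h1 h2].
by apply/andP; split; move: h1 h2; move: `|comb _ _ _| `|y| => u v; lra.
Qed.

Lemma superreflexive_no_james (th : R) : superreflexive X -> 0 < th ->
  ~ forall n, exists f x, @james_array R X th n f x.
Proof.
move=> sX th0 ex; have [f fP] := choice ex; have [x xP] := choice fP.
pose A := JArray th0 xP.
exact: (jcompletion_nonreflexive (sX _ (@jcompletion_representable A))).
Qed.

Lemma superreflexive_reflexive : superreflexive X -> reflexive_space X.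
Proof.
move=> sX; apply: sX => n e eps eps0; exists id; split=> // y _.
by rewrite mulrBl mulrDl mul1r gerBl lerDl mulr_ge0// ltW.
Qed.

(** A derivation that never stops yields James arrays of all sizes with the fixed constant
    [eps / 8]: directly for the ball of the dual of X, and after exchanging points and functionals
    for the ball of the bidual. *)
Lemma superreflexive_derivation : superreflexive X ->
  (forall eps : R, 0 < eps -> exists n, wdern n eps (dball (Z := X)) = set0) /\
  (forall eps : R, 0 < eps -> exists n, wdern n eps (dball (Z := dual X)) = set0).
Proof.
move=> sX; have rX := superreflexive_reflexive sX.
split=> eps eps0; apply: contrapT => /forallNP no.
all: have e2 : 0 < eps / 2 by [rewrite divr_gt0]; rewrite (splitr eps) in no.
all: have e8 : 0 < eps / 2 / 4 by rewrite divr_gt0.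
  exact: (superreflexive_no_james sX e8 (wdern_james e2 no)).
apply: (superreflexive_no_james sX e8) => n.
have [F [x Fx]] := wdern_james e2 no n.
exact: james_array_dual rX Fx.
Qed.

End Superreflexive.

Theorem theorem5p4 (R : realType) :
  exists Xu : completeNormedModType R,
    [/\ separable Xu,
        reflexive_space Xu,
        (forall X : completeNormedModType R,
           infinite_dimensional X -> separable X -> reflexive_space X ->
           szlenk X = omega -> szlenk (dual X) = omega ->
           embeds_as_closed_subspace X Xu) &
        (forall X : completeNormedModType R,
           separable X -> superreflexive X ->
           embeds_as_closed_subspace X Xu)].
Proof.
exists (dual (fspace (@tree_frame R))); split.
- exact: fspace_dual_separable.
- exact: fspace_dual_reflexive.
- move=> X _ sX rX szX szY; apply: derivation_embeds => // eps eps0.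
    exact: szlenk_omega_wdern.
  by apply: szlenk_omega_wdern => //; exact: separable_dual.
- move=> X sX srX; have [HX HY] := superreflexive_derivation srX.
  by apply: derivation_embeds => //; exact: superreflexive_reflexive.
Qed.
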